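(* $\displaystyle \mathrm{m}_{\mathbb{D}} (\sqrt{2}+x+y)=\frac{L(\chi_{-4},2)}{\pi} + \mathcal{C}_{\sqrt{2}}+ \frac{3}{8}-\frac{3}{2\pi}$, where $$\mathcal{C}_{\sqrt{2}} = \frac{\Gamma\left(\frac{3}{4}\right)^2}{\sqrt{2\pi^3}}\, {}_4F_3\!\left(\tfrac{1}{4}, \tfrac{1}{4}, \tfrac{3}{4}, \tfrac{3}{4}; \tfrac{1}{2}, \tfrac{5}{4}, \tfrac{5}{4}; 1\right) - \frac{\Gamma\left(\frac{1}{4}\right)^2}{72\sqrt{2\pi^3}}\, {}_4F_3\!\left(\tfrac{3}{4}, \tfrac{3}{4}, \tfrac{5}{4}, \tfrac{5}{4}; \tfrac{3}{2}, \tfrac{7}{4}, \tfrac{7}{4}; 1\right).$$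
   Context: For a nonzero rational function $P\in\mathbb{C}(x_1,\dots,x_n)$, the (logarithmic) areal Mahler measure is $\mathrm{m}_\mathbb{D}(P)=\frac{1}{\pi^n}\int_{\mathbb{D}^n}\log|P(x_1,\dots,x_n)|\,dA(x_1)\cdots dA(x_n)$, where $\mathbb{D}=\{x\in\mathbb{C}:|x|\le 1\}$ and $dA$ is Lebesgue (area) measure on $\mathbb{C}$. $L(\chi_{-4},s)$ is the Dirichlet $L$-function of the character $\chi_{-4}=\left(\frac{-4}{\cdot}\right)$ of conductor 4 (so $L(\chi_{-4},2)$ is Catalan's constant). The generalized hypergeometric function is ${}_pF_q(a_1,\dots,a_p;b_1,\dots,b_q;z)=\sum_{n\ge0}\frac{(a_1)_n\cdots(a_p)_n}{(b_1)_n\cdots(b_q)_n}\frac{z^n}{n!}$ with Pochhammer symbol $(a)_0=1$, $(a)_n=a(a+1)\cdots(a+n-1)$. *)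

(* Defs.v *)
From mathcomp Require Import all_boot all_order all_algebra.
From mathcomp Require Import all_classical all_reals all_analysis.
From mathcomp Require Import complex.
Import Order.TTheory GRing.Theory Num.Theory.
Local Open Scope ring_scope.
Local Open Scope classical_set_scope.

Section Defs.
Variable R : realType.

Definition to_C (p : R * R) : R[i] := (p.1 +i* p.2)%C.

Definition cmod (z : R[i]) : R := ComplexField.Normc.normc z.

Definition unit_disk : set (R * R) := [set p | cmod (to_C p) <= 1].

Definition area_measure := ((@lebesgue_measure R) \x (@lebesgue_measure R))%E.

Definition areal_mahler2 (P : R[i] -> R[i] -> R[i]) : \bar R :=
  ((pi ^+ 2)^-1)%:E *
  (\int[(area_measure \x area_measure)%E]_(z in unit_disk `*` unit_disk)
      (ln (cmod (P (to_C z.1) (to_C z.2))))%:E)%E.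

Definition Gamma (s : R) : R :=
  fine (\int[@lebesgue_measure R]_(t in (`]0%R, +oo[%classic : set R))
          ((t `^ (s - 1)) * expR (- t))%:E)%E.

Definition pochhammer (a : R) (n : nat) : R := \prod_(i < n) (a + i%:R).

Definition hypergeom (as_ bs : seq R) (z : R) : R :=
  limn (fun N => \sum_(0 <= n < N)
     ((\prod_(a <- as_) pochhammer a n) / (\prod_(b <- bs) pochhammer b n)
       * z ^+ n / (n`!)%:R)).

Definition chi_m4 (n : nat) : R :=
  if (n %% 4 == 1)%N then 1 else if (n %% 4 == 3)%N then -1 else 0.

Definition L_chi_m4 (s : R) : R :=
  limn (fun N => \sum_(1 <= n < N) (chi_m4 n * (n%:R) `^ (- s))).

End Defs.

Arguments to_C {R}.
Arguments cmod {R}.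
Arguments areal_mahler2 {R}.
Arguments Gamma {R}.
Arguments pochhammer {R}.
Arguments hypergeom {R}.
Arguments L_chi_m4 {R}.

(* Main.v *)
(** The integral of F(x + y) over the product of two unit disks equals the
    integral over 0 < t < 2 of sqrt(4 - t^2) times the integral of F over the
    disk |w| <= t, because the area of the intersection of two unit disks at distance
    |w| is the integral of sqrt(4 - t^2) over t > |w|; this reduces the areal Mahler measure
    to the logarithmic potential of a disk of radius t at the point -sqrt 2.
    That potential comes from averaging log|w - a| over the symmetry
    w -> -w repeatedly: log|w - a| may be replaced by log|w^N - a^N| / N with
    N = 2^n, which tends to log max(a, |w|). The substitution t = 2 cos x turns
    the remaining integral over t into elementary terms plus a multiple of
    X = int_0^(pi/4) x tan x dx, and the Fourier series of tan gives
    L(chi_{-4}, 2) = 2 X + (pi/4) ln 2.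

    The hypergeometric bracket equals (ln 2)/4. With b_k = (1/2)_k / k!, the
    identity Gamma(a)^2 = Gamma(2a) B(a, a) at a = k/2 + 3/4 identifies its
    k-th term, even and odd k coming from the two series, with
    (-1)^k b_k D_k / (4 pi), where D_k = int_0^oo z^(k+1/2) / (2k+1) dv / (sqrt v (1+v))
    and z = 2 sqrt v / (1+v). Summing over k gives
    (4 pi)^(-1) int_0^oo arcsinh(sqrt z) dv / (sqrt v (1+v)), and writing
    arcsinh as an integral and exchanging the order of integration evaluates
    this integral to pi ln 2. *)
Require Import Defs.
From HB Require Import structures.
From mathcomp Require Import all_boot all_order all_algebra.
From mathcomp Require Import all_classical all_reals all_analysis.
From mathcomp Require Import complex.
From mathcomp Require Import measurable_realfun.
From mathcomp Require Import ring lra.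
Import Order.TTheory GRing.Theory Num.Theory.
Import numFieldNormedType.Exports.
Local Open Scope classical_set_scope.
Local Open Scope ring_scope.

(** * Calculus on the real line *)

(** The logarithm is unbounded below on these domains, so ln 4 minus the logarithm is integrated
    instead: it is nonnegative for |w| <= 2, because a <= 2. Every exchange of integrals is then
    Tonelli's theorem in the extended reals, and finiteness comes out of the computation. Polar
    coordinates never appear: invariance under rotations and the areas of disks replace them. The
    averaging works because rotation by pi/N sends w^N to -w^N. Its limit is uniform only away from
    the circle |w| = a, so that circle is approached from both sides and then discarded as a null
    set. For the bracket, even partial sums of the alternating series bracket arcsinh with an
    explicit error, so integrating inequalities replaces an exchange of limit and integral. Since
    even and odd terms form two separate series, each must be shown to converge; a telescoping sum
    bounds both. The term (ln 2)/2 of the Mahler measure is the sum of (ln 2)/4 from L(chi_{-4},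
    2)/pi and (ln 2)/4 from the bracket. *)

Section Derivatives.
Variable R : realType.
Implicit Types (f g : R -> R) (x c df dg : R).

Lemma derive_cst x c : is_derive x 1 (fun=> c) 0.
Proof. exact: is_derive_cst. Qed.

Lemma derive_id x : is_derive x 1 (fun y => y) 1.
Proof. exact: is_derive_id. Qed.

Lemma derive_add x f g df dg : is_derive x 1 f df -> is_derive x 1 g dg ->
  is_derive x 1 (fun y => f y + g y) (df + dg).
Proof. by move=> hf hg; apply: is_deriveD. Qed.

Lemma derive_opp x f df : is_derive x 1 f df ->
  is_derive x 1 (fun y => - f y) (- df).
Proof. by move=> hf; apply: is_deriveN. Qed.

Lemma derive_mul x f g df dg : is_derive x 1 f df -> is_derive x 1 g dg ->
  is_derive x 1 (fun y => f y * g y) (df * g x + f x * dg).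
Proof.
move=> hf hg; have h := is_deriveM hf hg; apply: is_derive_eq h _.
by rewrite /GRing.scale /= addrC mulrC.
Qed.

Lemma derive_inv x f df : f x != 0 -> is_derive x 1 f df ->
  is_derive x 1 (fun y => (f y)^-1) (- df / f x ^+ 2).
Proof.
move=> f0 hf; have h := is_deriveV f0 hf; apply: is_derive_eq h _.
by rewrite /GRing.scale /= !mulNr mulrC.
Qed.

Lemma derive_exp x f df n : is_derive x 1 f df ->
  is_derive x 1 (fun y => f y ^+ n) (n%:R * f x ^+ n.-1 * df).
Proof. move=> hf; have := is_deriveX n hf.
rewrite (_ : f ^+ n = fun y => f y ^+ n); last first.
  by apply/funext => y; elim: n => [|n IH]; rewrite ?expr0// !exprS -IH.
by []. Qed.

Lemma derive_comp x f g df dg : is_derive (f x) 1 g dg -> is_derive x 1 f df ->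
  is_derive x 1 (fun y => g (f y)) (dg * df).
Proof. by move=> hg hf; apply: is_derive1_comp. Qed.

Lemma derive_ln x f df : 0 < f x -> is_derive x 1 f df ->
  is_derive x 1 (fun y => ln (f y)) (df / f x).
Proof.
move=> f0 hf; rewrite mulrC.
by apply: derive_comp => //; exact: is_derive1_ln.
Qed.

Lemma derive_sqrt x f df : 0 < f x -> is_derive x 1 f df ->
  is_derive x 1 (fun y => Num.sqrt (f y)) (df / (2 * Num.sqrt (f x))).
Proof.
move=> f0 hf; rewrite mulrC.
by apply: derive_comp => //; exact: is_derive1_sqrt.
Qed.

Lemma derive_expR x f df : is_derive x 1 f df ->
  is_derive x 1 (fun y => expR (f y)) (expR (f x) * df).
Proof. by move=> hf; apply: derive_comp => //; exact: is_derive_expR. Qed.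

Lemma derive_atan x f df : is_derive x 1 f df ->
  is_derive x 1 (fun y => atan (f y)) (df / (1 + f x ^+ 2)).
Proof.
move=> hf; rewrite mulrC.
by apply: derive_comp => //; exact: is_derive1_atan.
Qed.

Lemma derive_sin x f df : is_derive x 1 f df ->
  is_derive x 1 (fun y => sin (f y)) (cos (f x) * df).
Proof. by move=> hf; apply: derive_comp => //; exact: is_derive_sin. Qed.

Lemma derive_cos x f df : is_derive x 1 f df ->
  is_derive x 1 (fun y => cos (f y)) (- sin (f x) * df).
Proof. by move=> hf; apply: derive_comp => //; exact: is_derive_cos. Qed.

Lemma derive_powR x f df p : 0 < f x -> is_derive x 1 f df ->
  is_derive x 1 (fun y => f y `^ p) (p * f x `^ (p - 1) * df).
Proof.
move=> f0 hf.
by apply: (derive_comp _ _ (fun y => y `^ p)) => //; exact: is_derive1_powR.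
Qed.

Lemma is_derive_continuous x f df : is_derive x 1 f df -> {for x, continuous f}.
Proof.
move=> hf; apply: differentiable_continuous; apply/derivable1_diffP.
exact: ex_derive.
Qed.

End Derivatives.

(* [is_derive] is a type class: [notypeclasses refine] leaves the unresolved
   premises as goals. *)
Ltac derive_step :=
  match goal with
  | |- is_derive _ _ (fun y => y) _ => notypeclasses refine (derive_id _ _)
  | |- is_derive _ _ (fun _ => ?c) _ => notypeclasses refine (derive_cst _ _ _)
  | |- is_derive _ _ (fun y => (@?f y + @?g y)%R) _ => notypeclasses refine (@derive_add _ _ f g _ _ _ _)
  | |- is_derive _ _ (fun y => (- @?f y)%R) _ => notypeclasses refine (@derive_opp _ _ f _ _)
  | |- is_derive _ _ (fun y => (@?f y * @?g y)%R) _ => notypeclasses refine (@derive_mul _ _ f g _ _ _ _)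
  | |- is_derive _ _ (fun y => ((@?f y)^-1)%R) _ => notypeclasses refine (@derive_inv _ _ f _ _ _)
  | |- is_derive _ _ (fun y => (@?f y ^+ ?n)%R) _ => notypeclasses refine (@derive_exp _ _ f _ n _)
  | |- is_derive _ _ (fun y => ln (@?f y)) _ => notypeclasses refine (@derive_ln _ _ f _ _ _)
  | |- is_derive _ _ (fun y => Num.sqrt (@?f y)) _ => notypeclasses refine (@derive_sqrt _ _ f _ _ _)
  | |- is_derive _ _ (fun y => expR (@?f y)) _ => notypeclasses refine (@derive_expR _ _ f _ _)
  | |- is_derive _ _ (fun y => atan (@?f y)) _ => notypeclasses refine (@derive_atan _ _ f _ _)
  | |- is_derive _ _ (fun y => sin (@?f y)) _ => notypeclasses refine (@derive_sin _ _ f _ _)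
  | |- is_derive _ _ (fun y => cos (@?f y)) _ => notypeclasses refine (@derive_cos _ _ f _ _)
  | |- is_derive _ _ (fun y => powR (@?f y) ?p) _ => notypeclasses refine (@derive_powR _ _ f _ p _ _)
  end.
Ltac derive_tac := repeat (derive_step; cbv beta).
Ltac derive_eq := notypeclasses refine (@is_derive_eq _ _ _ _ _ _ _ _ _ _); [derive_tac | cbv beta].

Section Measurability.
Variable R : realType.
Context d (T : measurableType d).
Implicit Types f g : T -> R.

Lemma mfun_add f g : measurable_fun setT f -> measurable_fun setT g ->
  measurable_fun setT (fun x => f x + g x).
Proof. exact: measurable_funD. Qed.

Lemma mfun_opp f : measurable_fun setT f -> measurable_fun setT (fun x => - f x).
Proof. exact: measurable_funN. Qed.

Lemma mfun_mul f g : measurable_fun setT f -> measurable_fun setT g ->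
  measurable_fun setT (fun x => f x * g x).
Proof. exact: measurable_funM. Qed.

Lemma measurable_invr : measurable_fun setT (@GRing.inv R).
Proof.
(* The only discontinuity is at 0, where the inverse is 0 by convention; splitting it off leaves a
   continuous function on an open set. *)
rewrite (_ : @GRing.inv R = fun x => if x == 0 then 0 else x^-1); last first.
  by apply/funext => x; case: ifPn => // /eqP ->; rewrite invr0.
apply: measurable_fun_if => //.
- exact: measurable_fun_eqr.
- apply: open_continuous_measurable_fun.
    rewrite setTI (_ : _ @^-1` _ = ~` [set 0]).
      apply: closed_openC; exact: closed_eq.
    by apply/seteqP; split => x /=; [move=> /negbT/eqP|move=> /eqP/negbTE].
  by move=> x; rewrite inE /= => -[_ /negbT x0]; apply: inv_continuous.
Qed.

Lemma mfun_inv f : measurable_fun setT f -> measurable_fun setT (fun x => (f x)^-1).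
Proof. by move=> mf; apply: measurableT_comp => //; exact: measurable_invr. Qed.

Lemma mfun_exp f n : measurable_fun setT f -> measurable_fun setT (fun x => f x ^+ n).
Proof. exact: measurable_funX. Qed.

Lemma mfun_ln f : measurable_fun setT f -> measurable_fun setT (fun x => ln (f x)).
Proof. by move=> mf; apply: measurableT_comp => //; exact: measurable_ln. Qed.

Lemma mfun_expR f : measurable_fun setT f -> measurable_fun setT (fun x => expR (f x)).
Proof. by move=> mf; apply: measurableT_comp. Qed.

Lemma mfun_sqrt f : measurable_fun setT f -> measurable_fun setT (fun x => Num.sqrt (f x)).
Proof.
move=> mf; apply: measurableT_comp => //.
by apply: continuous_measurable_fun; exact: sqrt_continuous.
Qed.

Lemma mfun_powR f p : measurable_fun setT f -> measurable_fun setT (fun x => f x `^ p).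
Proof. move=> mf; refine (measurableT_comp (measurable_powR p) mf). Qed.

End Measurability.

(** Logarithm, inverse, root and power are total functions, so measurability is proved on the whole
    space by syntactic recursion and restricted to a domain only afterwards. *)
Ltac mfun_step :=
  match goal with
  | H : measurable_fun setT ?f |- measurable_fun setT ?f => exact: H
  | H : measurable_fun setT ?f |- measurable_fun setT (fun x => ?f x) => exact: H
  | |- measurable_fun _ (fun x => x) => apply: measurable_id
  | |- measurable_fun _ (fun _ => ?c) => apply: measurable_cst
  | |- measurable_fun _ (Order.le ?a) => apply: (@measurable_fun_ler _ _ _ setT (fun=> a) (fun x => x))
  | |- measurable_fun _ (Order.lt ?a) => apply: (@measurable_fun_ltr _ _ _ setT (fun=> a) (fun x => x))
  | |- measurable_fun _ fst => apply: measurable_fst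
  | |- measurable_fun _ snd => apply: measurable_snd
  | |- measurable_fun _ (fun z => fst z) => apply: measurable_fst
  | |- measurable_fun _ (fun z => snd z) => apply: measurable_snd
  | |- measurable_fun _ (fun z => fst (@?f z)) => apply: (measurableT_comp measurable_fst)
  | |- measurable_fun _ (fun z => snd (@?f z)) => apply: (measurableT_comp measurable_snd)
  | |- measurable_fun _ (fun z => (@?f z, @?g z)) => apply: measurable_fun_pair
  | |- measurable_fun _ (fun z => EFin (@?f z)) => apply/measurable_EFinP; change (measurable_fun setT f)
  | |- measurable_fun _ (fun z => (@?f z + @?g z)%R) => apply: (@mfun_add _ _ _ f g)
  | |- measurable_fun _ (fun z => (- @?f z)%R) => apply: (@mfun_opp _ _ _ f)
  | |- measurable_fun _ (fun z => (@?f z * @?g z)%R) => apply: (@mfun_mul _ _ _ f g)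
  | |- measurable_fun _ (fun z => ((@?f z)^-1)%R) => apply: (@mfun_inv _ _ _ f)
  | |- measurable_fun _ (fun z => (@?f z ^+ ?n)%R) => apply: (@mfun_exp _ _ _ f n)
  | |- measurable_fun _ (fun z => ln (@?f z)) => apply: (@mfun_ln _ _ _ f)
  | |- measurable_fun _ (fun z => expR (@?f z)) => apply: (@mfun_expR _ _ _ f)
  | |- measurable_fun _ (fun z => Num.sqrt (@?f z)) => apply: (@mfun_sqrt _ _ _ f)
  | |- measurable_fun _ (fun z => powR (@?f z) ?p) => apply: (@mfun_powR _ _ _ f p)
  | |- measurable_fun _ (fun z => if _ then _ else _) =>
        apply: measurable_fun_ifT
  | |- measurable_fun _ (fun z => (@?f z) && (@?g z)) => apply: (@measurable_and _ _ setT f g)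
  | |- measurable_fun _ (fun z => (@?f z) || (@?g z)) => apply: (@measurable_or _ _ setT f g)
  | |- measurable_fun _ (fun z => ((@?f z) < (@?g z))%R) => apply: (@measurable_fun_ltr _ _ _ setT f g)
  | |- measurable_fun _ (fun z => ((@?f z) <= (@?g z))%R) => apply: (@measurable_fun_ler _ _ _ setT f g)
  | H : measurable_fun setT ?h |- measurable_fun _ (fun z => ?h (@?f z)) =>
        apply: (measurableT_comp H)
  end.
Ltac mfun_tac := repeat (mfun_step; cbv beta).

(** * Fundamental theorem of calculus on open and unbounded intervals *)

Section FTC.
Variable R : realType.
Notation mu := (@lebesgue_measure R).
Implicit Types (f F : R -> R) (a b l la lb x : R).

(** The compact version applies on each [[a_ n, b_ n]], and monotone convergence passes to the
    union. Nonnegativity makes integrability a consequence, so improper integrals need no separate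
    treatment. *)
Lemma ge0_FTC_exhaustion f F (a_ b_ : nat -> R) (D : set R) l :
  nonincreasing_seq a_ -> nondecreasing_seq b_ -> (forall n, a_ n < b_ n) ->
  D = \bigcup_n `[a_ n, b_ n]%classic ->
  (forall x, D x -> 0 <= f x) ->
  (forall x, D x -> {for x, continuous f}) ->
  (forall x, D x -> is_derive x 1 F (f x)) ->
  (F (b_ n) - F (a_ n)) @[n --> \oo] --> l ->
  (\int[mu]_(x in D) (f x)%:E = l%:E)%E.
Proof.
move=> da ub ab DE f0 cf dF Fl.
have sD n x : x \in `[a_ n, b_ n] -> D x by move=> h; rewrite DE; exists n; [exact: I|exact: h].
have E n : (\int[mu]_(x in `[a_ n, b_ n]) (f x)%:E = (F (b_ n) - F (a_ n))%:E)%E.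
  have cF x : x \in `[a_ n, b_ n] -> {for x, continuous F}.
    move=> xab. refine (is_derive_continuous _ _ _ _ (dF x (sD n x xab))).
  rewrite (@continuous_FTC2 _ f F) ?EFinB//.
  - apply: continuous_in_subspaceT => x; rewrite inE => xab.
    by apply: cf; apply: (sD n).
  - split.
    + move=> x xab; apply: (@ex_derive _ _ _ _ _ _ _ (dF x _)).
      by apply: (sD n); exact: subset_itv_oo_cc xab.
    + by apply: cvg_at_right_filter; apply: cF; rewrite in_itv/= lexx ltW.
    + by apply: cvg_at_left_filter; apply: cF; rewrite in_itv/= lexx ltW.
  - move=> x xab; rewrite derive1E; apply: (@derive_val _ _ _ _ _ _ _ (dF x _)).
    by apply: (sD n); exact: subset_itv_oo_cc xab.
have C : ((F (b_ n) - F (a_ n))%:E @[n --> \oo] --> \int[mu]_(x in D) (f x)%:E)%E.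
  rewrite DE; under eq_fun do rewrite -E.
  apply: ge0_nondecreasing_set_cvg_integral.
  - move=> m n mn; rewrite subsetEset => x /=; rewrite !in_itv/=.
    by have := da _ _ mn; have := ub _ _ mn; lra.
  - by move=> n; exact: measurable_itv.
  - move=> n; apply/measurable_EFinP; apply: subspace_continuous_measurable_fun => //.
    apply: continuous_in_subspaceT => x; rewrite inE => xab.
    by apply: cf; apply: (sD n).
  - by move=> n x xab; rewrite lee_fin; apply: f0; apply: (sD n).
apply: (cvg_unique _ C) => //.
by apply: cvg_EFin => //; exact: nearW.
Qed.

Lemma ge0_FTC_oo f F a b la lb : a < b ->
  (forall x, a < x < b -> 0 <= f x) ->
  (forall x, a < x < b -> {for x, continuous f}) ->
  (forall x, a < x < b -> is_derive x 1 F (f x)) ->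
  F x @[x --> a^'+] --> la -> F x @[x --> b^'-] --> lb ->
  (\int[mu]_(x in `]a, b[) (f x)%:E = (lb - la)%:E)%E.
Proof.
move=> ab f0 cf dF Fa Fb.
(* Starting the denominators at 3 keeps e n below half the length, so []a + e n, b - e n[] is never
   empty. *)
pose e n : R := (b - a) / (n.+3)%:R.
have ba0 : 0 < b - a by rewrite subr_gt0.
have e0 n : 0 < e n by rewrite divr_gt0.
have de : nonincreasing_seq e.
  by move=> m n mn; rewrite ler_pM2l// lef_pV2 ?posrE// ler_nat !ltnS.
have e3 n : e n <= (b - a) / 3.
  by rewrite ler_pM2l// lef_pV2 ?posrE// ler_nat.
have ecvg : e n @[n --> \oo] --> 0.
  rewrite -[X in _ --> X](mulr0 (b - a)); apply: cvgMr.
  have := @cvg_harmonic R; rewrite -(cvg_shiftn 2) => h.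
  by apply: cvg_trans h; apply: near_eq_cvg; near=> n => /=; rewrite addn2.
apply: (@ge0_FTC_exhaustion f F (fun n => a + e n) (fun n => b - e n)).
- by move=> m n mn /=; rewrite lerD2l de.
- by move=> m n mn /=; rewrite lerD2l lerN2 de.
- by move=> n; have := e3 n; lra.
- apply/seteqP; split => x /=.
    rewrite in_itv/= => /andP[ax xb].
    have [n _ hn] : \forall n \near \oo, e n < Num.min (x - a) (b - x).
      by apply: (cvgr_lt 0) => //; rewrite lt_min !subr_gt0 ax.
    exists n => //=; have := hn n (leqnn n); rewrite lt_min in_itv/=; lra.
  move=> [n _]; rewrite /= !in_itv/=; have := e0 n; lra.
- exact: f0.
- exact: cf.
- apply: cvgB.
  + have := (cvg_at_leftP F b lb).1 Fb; apply; split.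
      by move=> n; have := e0 n; lra.
    by rewrite -[X in _ --> X]subr0; apply: cvgB => //; exact: cvg_cst.
  + have := (cvg_at_rightP F a la).1 Fa; apply; split.
      by move=> n; have := e0 n; lra.
    by rewrite -[X in _ --> X]addr0; apply: cvgD => //; exact: cvg_cst.
Unshelve. all: by end_near. Qed.

Lemma ge0_FTC_oy f F a la l :
  (forall x, a < x -> 0 <= f x) ->
  (forall x, a < x -> {for x, continuous f}) ->
  (forall x, a < x -> is_derive x 1 F (f x)) ->
  F x @[x --> a^'+] --> la -> F x @[x --> +oo] --> l ->
  (\int[mu]_(x in `]a, +oo[) (f x)%:E = (l - la)%:E)%E.
Proof.
move=> f0 cf dF Fa Fb.
pose e n : R := (n.+1)%:R^-1.
have e0 n : 0 < e n by rewrite invr_gt0.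
have de : nonincreasing_seq e.
  by move=> m n mn; rewrite lef_pV2 ?posrE// ler_nat !ltnS.
have e1 n : e n <= 1 by rewrite invf_le1 ?ler1n// ltr0n.
(* Since e n <= 1, the summand 2 keeps the right end strictly above the left end already at n =
   0. *)
apply: (@ge0_FTC_exhaustion f F (fun n => a + e n) (fun n => a + 2 + n%:R)).
- by move=> m n mn /=; rewrite lerD2l de.
- by move=> m n mn /=; rewrite lerD2l ler_nat.
- by move=> n; have := e1 n; have := ler0n R n; lra.
- apply/seteqP; split => x /=.
    rewrite in_itv/= andbT => ax.
    have [n _ hn] : \forall n \near \oo, e n < (x - a).
      by apply: (cvgr_lt 0); [exact: cvg_harmonic|rewrite subr_gt0].
    pose m := maxn n (Num.bound (x - a)).
    exists m => //=; have := hn m (leq_maxl _ _).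
    have : x - a < m%:R.
      apply: (@lt_le_trans _ _ (Num.bound (x - a))%:R); rewrite ?ler_nat ?leq_maxr// archi_boundP// subr_ge0 ltW//.
    by rewrite /= in_itv/=; lra.
  move=> [n _]; rewrite /= !in_itv/=; have := e0 n; lra.
- by move=> x /=; rewrite in_itv/= andbT; exact: f0.
- by move=> x /=; rewrite in_itv/= andbT; exact: cf.
- by move=> x /=; rewrite in_itv/= andbT; exact: dF.
- apply: cvgB.
  + apply: (cvg_comp _ _ _ Fb); apply/cvgryPge => A.
    near=> n; suff : A - a - 2 <= n%:R by lra.
    by near: n; exact: nbhs_infty_ger.
  + have := (cvg_at_rightP F a la).1 Fa; apply; split.
      by move=> n; have := e0 n; lra.
    by rewrite -[X in _ --> X]addr0; apply: cvgD; [exact: cvg_cst|exact: cvg_harmonic].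
Unshelve. all: by end_near. Qed.

End FTC.

(** * Affine changes of variable, shears and rotations for Lebesgue measure *)

Section ChangeOfVariables.
Variable R : realType.
Notation mu := (@lebesgue_measure R).
Notation mu2 := (mu \x mu)%E.

Section Tonelli.
Variable f : R * R -> \bar R.
Hypotheses (mf : measurable_fun setT f) (f0 : forall z, (0 <= f z)%E).

Lemma tonelli1 : (\int[mu2]_z f z = \int[mu]_x \int[mu]_y f (x, y))%E.
Proof. by rewrite fubini_tonelli1//; exact: mf. Qed.

Lemma tonelli2 : (\int[mu2]_z f z = \int[mu]_y \int[mu]_x f (x, y))%E.
Proof. by rewrite fubini_tonelli2//; exact: mf. Qed.

Lemma tonelli_swap :
  (\int[mu]_x \int[mu]_y f (x, y) = \int[mu]_y \int[mu]_x f (x, y))%E.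
Proof. by rewrite -tonelli1 tonelli2. Qed.

Lemma measurable_tonelli1 : measurable_fun setT (fun x : R => (\int[mu]_y f (x, y))%E).
Proof. exact: (@measurable_fun_fubini_tonelli_F _ _ _ _ _ mu f mf). Qed.

End Tonelli.

Lemma measurable_affine (c a : R) : measurable_fun setT (fun x : R => c * x + a).
Proof. by mfun_tac. Qed.

(** Both sides are measures in A, and they agree on half-open intervals; uniqueness of Lebesgue
    measure does the rest. *)
Lemma lebesgue_measure_affine (c a : R) (A : set R) : 0 < c -> measurable A ->
  (c%:E * pushforward mu ((fun x => c * x + a)%R : R -> measurableTypeR R) A = mu A)%E.
Proof.
move=> c0 mA; apply/esym.
apply: (@lebesgue_measure_unique _ (mscale (NngNum (ltW c0))
  (pushforward mu ((fun x => c * x + a)%R : R -> measurableTypeR R)))) => //.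
  exact: measurable_affine.
move=> ? _ [[u v]] _ <-; rewrite /= /mscale /= /pushforward.
rewrite (_ : _ @^-1` `]u, v] = `](u - a) / c, (v - a) / c]%classic); last first.
  apply/seteqP; split => x /=; rewrite !in_itv /=.
    by rewrite ltr_pdivrMr// ler_pdivlMr//; lra.
  by rewrite ltr_pdivrMr// ler_pdivlMr//; lra.
rewrite !lebesgue_measure_itv /= !lte_fin ltr_pM2r ?invr_gt0// ltrBrDr subrK.
case: ifPn => _; last by rewrite mule0.
by rewrite -!EFinB -EFinM; congr (_%:E); field; rewrite gt_eqF.
Qed.

Lemma ge0_integral_affine (c a : R) (f : R -> \bar R) : 0 < c ->
  measurable_fun setT f -> (forall x, (0 <= f x)%E) ->
  (c%:E * \int[mu]_x f (c * x + a)%R = \int[mu]_x f x)%E.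
Proof.
move=> c0 mf f0.
pose phi : measurableTypeR R -> measurableTypeR R := fun x => (c * x + a)%R.
have mphi : measurable_fun setT phi by exact: measurable_affine.
rewrite -(@ge0_integral_pushforward _ _ (measurableTypeR R) (measurableTypeR R) R
  phi mphi mu setT f)//.
rewrite -(@ge0_integral_mscale _ _ _ _ _ _ (NngNum (ltW c0)))//.
apply: eq_measure_integral => /= A mA _.
by rewrite /mscale /= lebesgue_measure_affine.
Qed.

Lemma ge0_integral_shift (a : R) (f : R -> \bar R) :
  measurable_fun setT f -> (forall x, (0 <= f x)%E) ->
  (\int[mu]_x f (x + a)%R = \int[mu]_x f x)%E.
Proof.
move=> mf f0; rewrite -[RHS](@ge0_integral_affine 1 a)// mul1e.
by apply: eq_integral => x _; rewrite mul1r.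
Qed.

Section Plane.
Variable f : R * R -> \bar R.
Hypotheses (mf : measurable_fun setT f) (f0 : forall z, (0 <= f z)%E).

Let mfc d (T : measurableType d) (h : T -> R * R) :
  measurable_fun setT h -> measurable_fun setT (fun x => f (h x)).
Proof. by move=> mh; exact: (measurableT_comp mf mh). Qed.

Lemma ge0_integral_shear1 (a : R) :
  (\int[mu2]_z f (z.1 + a * z.2, z.2)%R = \int[mu2]_z f z)%E.
Proof.
have mg : measurable_fun setT (fun z : R * R => f (z.1 + a * z.2, z.2)).
  by apply: mfc; mfun_tac.
rewrite (tonelli2 _ mg (fun=> f0 _)) (tonelli2 _ mf f0).
apply: eq_integral => y _ /=.
apply: (@ge0_integral_shift (a * y) (fun x => f (x, y))) => //.
by apply: mfc; mfun_tac.
Qed.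

Lemma ge0_integral_shear2 (a : R) :
  (\int[mu2]_z f (z.1, z.2 + a * z.1)%R = \int[mu2]_z f z)%E.
Proof.
have mg : measurable_fun setT (fun z : R * R => f (z.1, z.2 + a * z.1)).
  by apply: mfc; mfun_tac.
rewrite (tonelli1 _ mg (fun=> f0 _)) (tonelli1 _ mf f0).
apply: eq_integral => x _ /=.
apply: (@ge0_integral_shift (a * x) (fun y => f (x, y))) => //.
by apply: mfc; mfun_tac.
Qed.

Lemma ge0_integral_shift2 (a : R * R) :
  (\int[mu2]_z f (z.1 + a.1, z.2 + a.2)%R = \int[mu2]_z f z)%E.
Proof.
have mg : measurable_fun setT (fun z : R * R => f (z.1 + a.1, z.2 + a.2)).
  by apply: mfc; mfun_tac.
rewrite (tonelli1 _ mg (fun=> f0 _)) (tonelli1 _ mf f0).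
have F0 x : (0 <= \int[mu]_y f (x, y))%E by apply: integral_ge0.
rewrite -(ge0_integral_shift a.1 _ (measurable_tonelli1 _ mf f0) F0).
apply: eq_integral => x _ /=.
apply: (@ge0_integral_shift a.2 (fun y => f (x + a.1, y))) => //.
by apply: mfc; mfun_tac.
Qed.

End Plane.

Definition rotation (c s : R) (z : R * R) : R * R :=
  (c * z.1 - s * z.2, s * z.1 + c * z.2).

Lemma measurable_rotation c s : measurable_fun setT (rotation c s).
Proof. by rewrite /rotation; mfun_tac. Qed.

(* A rotation other than the half-turn is a product of three shears; the
   half-turn is the square of the quarter-turn. *)
Lemma ge0_integral_rotation (c s : R) (f : R * R -> \bar R) :
  c ^+ 2 + s ^+ 2 = 1 ->
  measurable_fun setT f -> (forall z, (0 <= f z)%E) ->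
  (\int[mu2]_z f (rotation c s z) = \int[mu2]_z f z)%E.
Proof.
move=> cs1.
have step (c' s' : R) (g : R * R -> \bar R) : c' ^+ 2 + s' ^+ 2 = 1 ->
    1 + c' != 0 -> measurable_fun setT g -> (forall z, (0 <= g z)%E) ->
    (\int[mu2]_z g (rotation c' s' z) = \int[mu2]_z g z)%E.
  (* With c' = cos x and s' = sin x, t is tan(x/2): the rotation is the product of shears with
     coefficients -t, s', -t. *)
  move=> cs1' c'1 mg g0; pose t := s' / (1 + c').
  have s2 : s' * t = 1 - c'.
    rewrite /t mulrA; have -> : s' * s' = (1 - c') * (1 + c').
      by rewrite -expr2; have := cs1'; lra.
    by rewrite mulfK.
  have st : t * (1 + c') = s' by rewrite /t divfK.
  rewrite -(@ge0_integral_shear1 _ mg g0 (- t)).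
  rewrite -(@ge0_integral_shear2 (fun z => g (z.1 + - t * z.2, z.2)) _ _ s')//; last first.
    by apply: (measurableT_comp mg); mfun_tac.
  rewrite -(@ge0_integral_shear1
    (fun z => g (z.1 + - t * (z.2 + s' * z.1), z.2 + s' * z.1)) _ _ (- t))//; last first.
    by apply: (measurableT_comp mg); mfun_tac.
  apply: eq_integral => z _; congr g; rewrite /rotation /=; congr (_, _).
    have -> : c' = 1 - s' * t by rewrite s2; lra.
    have -> : s' * z.2 = (t * (1 + c')) * z.2 by rewrite st.
    have -> : c' = 1 - s' * t by rewrite s2; lra.
    ring.
  have -> : c' = 1 - s' * t by rewrite s2; lra.
  ring.
move=> mf f0; have [c1|c1] := eqVneq (1 + c) 0; last exact: step.
have {}c1 : c = -1 by lra.
have s0 : s = 0 by apply/eqP; rewrite -sqrf_eq0; move: cs1; rewrite c1; lra.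
have q1 : 0 ^+ 2 + 1 ^+ 2 = 1 :> R by ring.
have q2 : 1 + 0 != 0 :> R by rewrite addr0 oner_eq0.
rewrite -(step 0 1 f)//.
rewrite -(step 0 1 (fun z => f (rotation 0 1 z)))//.
  apply: eq_integral => z _; congr f; rewrite /rotation /= c1 s0.
  by congr (_, _); ring.
by apply: (measurableT_comp mf); exact: measurable_rotation.
Qed.

End ChangeOfVariables.

Section Continuity.
Variable R : realType.
Implicit Types (f g : R -> R) (x : R).

Lemma cont_add x f g : {for x, continuous f} -> {for x, continuous g} ->
  {for x, continuous (fun y => f y + g y)}.
Proof. by move=> cf cg; apply: cvgD. Qed.

Lemma cont_opp x f : {for x, continuous f} -> {for x, continuous (fun y => - f y)}.
Proof. by move=> cf; apply: cvgN. Qed.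

Lemma cont_mul x f g : {for x, continuous f} -> {for x, continuous g} ->
  {for x, continuous (fun y => f y * g y)}.
Proof. by move=> cf cg; apply: cvgM. Qed.

Lemma cont_inv x f : f x != 0 -> {for x, continuous f} ->
  {for x, continuous (fun y => (f y)^-1)}.
Proof. by move=> f0 cf; apply: cvgV. Qed.

Lemma cont_comp x f g : {for f x, continuous g} -> {for x, continuous f} ->
  {for x, continuous (fun y => g (f y))}.
Proof. by move=> cg cf; apply: continuous_comp. Qed.

Lemma cont_exp x f n : {for x, continuous f} -> {for x, continuous (fun y => f y ^+ n)}.
Proof.
move=> cf; apply: (cont_comp _ _ (fun y => y ^+ n)) => //; exact: exprn_continuous.
Qed.

Lemma cont_sqrt x f : {for x, continuous f} -> {for x, continuous (fun y => Num.sqrt (f y))}.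
Proof.
by move=> cf; apply: (cont_comp _ _ (@Num.sqrt R)) => //; exact: sqrt_continuous.
Qed.

Lemma cont_atan x f : {for x, continuous f} -> {for x, continuous (fun y => atan (f y))}.
Proof. by move=> cf; apply: (cont_comp _ _ (@atan R)) => //; exact: continuous_atan. Qed.

Lemma cont_ln x f : 0 < f x -> {for x, continuous f} ->
  {for x, continuous (fun y => ln (f y))}.
Proof. by move=> f0 cf; apply: (cont_comp _ _ (@ln R)) => //; exact: continuous_ln. Qed.

Lemma cont_expR x f : {for x, continuous f} -> {for x, continuous (fun y => expR (f y))}.
Proof. by move=> cf; apply: (cont_comp _ _ (@expR R)) => //; exact: continuous_expR. Qed.

Lemma cont_sin x f : {for x, continuous f} -> {for x, continuous (fun y => sin (f y))}.
Proof. by move=> cf; apply: (cont_comp _ _ (@sin R)) => //; exact: continuous_sin. Qed.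

Lemma cont_cos x f : {for x, continuous f} -> {for x, continuous (fun y => cos (f y))}.
Proof. by move=> cf; apply: (cont_comp _ _ (@cos R)) => //; exact: continuous_cos. Qed.

Lemma cont_powR x f p : 0 < f x -> {for x, continuous f} ->
  {for x, continuous (fun y => f y `^ p)}.
Proof.
move=> f0 cf; apply: (cont_comp _ _ (fun y => y `^ p)) => //.
by apply: is_derive_continuous; exact: is_derive1_powR.
Qed.

End Continuity.

(** The side conditions for inverse, [ln] and [powR] are left as goals. *)
Ltac cont_step :=
  match goal with
  | |- {for _, continuous (fun y => y)} => apply: cvg_id
  | |- {for _, continuous (fun _ => ?c)} => apply: cvg_cst
  | |- {for _, continuous (fun y => (@?f y + @?g y)%R)} => apply: (@cont_add _ _ f g)
  | |- {for _, continuous (fun y => (- @?f y)%R)} => apply: (@cont_opp _ _ f)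
  | |- {for _, continuous (fun y => (@?f y * @?g y)%R)} => apply: (@cont_mul _ _ f g)
  | |- {for _, continuous (fun y => ((@?f y)^-1)%R)} => apply: (@cont_inv _ _ f)
  | |- {for _, continuous (fun y => (@?f y ^+ ?n)%R)} => apply: (@cont_exp _ _ f n)
  | |- {for _, continuous (fun y => Num.sqrt (@?f y))} => apply: (@cont_sqrt _ _ f)
  | |- {for _, continuous (fun y => ln (@?f y))} => apply: (@cont_ln _ _ f)
  | |- {for _, continuous (fun y => expR (@?f y))} => apply: (@cont_expR _ _ f)
  | |- {for _, continuous (fun y => atan (@?f y))} => apply: (@cont_atan _ _ f)
  | |- {for _, continuous (fun y => sin (@?f y))} => apply: (@cont_sin _ _ f)
  | |- {for _, continuous (fun y => cos (@?f y))} => apply: (@cont_cos _ _ f)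
  | |- {for _, continuous (fun y => powR (@?f y) ?p)} => apply: (@cont_powR _ _ f p)
  end.
Ltac cont_tac := repeat (cont_step; cbv beta).

(** * Lengths of chords and areas of disks *)

Section Planar.
Variable R : realType.
Notation mu := (@lebesgue_measure R).
Notation mu2 := (mu \x mu)%E.

Lemma integral_if (D : set R) (b : R -> bool) (f : R -> R) :
  (forall x, D x <-> b x) ->
  (\int[mu]_x (if b x then f x else 0)%:E = \int[mu]_(x in D) (f x)%:E)%E.
Proof.
move=> Db; rewrite [RHS]integral_mkcond; apply: eq_integral => x _.
rewrite /patch; case: ifPn => bx; case: ifPn => //.
  by move/negP; rewrite inE => /(_ (iffRL (Db x) bx)).
by rewrite inE => /(Db x) h; rewrite h in bx.
Qed.

Lemma integral_if_plane (D : set (R * R)) (b : R * R -> bool) (f : R * R -> R) :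
  (forall x, D x <-> b x) ->
  (\int[mu2]_x (if b x then f x else 0)%:E = \int[mu2]_(x in D) (f x)%:E)%E.
Proof.
move=> Db; rewrite [RHS]integral_mkcond; apply: eq_integral => x _.
rewrite /patch; case: ifPn => bx; case: ifPn => //.
  by move/negP; rewrite inE => /(_ (iffRL (Db x) bx)).
by rewrite inE => /(Db x) h; rewrite h in bx.
Qed.

Lemma integral_segment (a b : R) : a <= b ->
  (\int[mu]_x (if (a <= x) && (x <= b) then 1 else 0)%:E = (b - a)%:E)%E.
Proof.
move=> ab; rewrite (@integral_if `[a, b]%classic)//.
rewrite integral_cst//= mul1e lebesgue_measure_itv/= lte_fin.
by move: ab; rewrite le_eqVlt => /predU1P[->|->]; rewrite ?ltxx ?subrr// EFinB.
Qed.

Lemma integral_pred0 (b : R -> bool) (f : R -> R) : (forall x, ~~ b x) ->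
  (\int[mu]_x (if b x then f x else 0)%:E = 0)%E.
Proof. by move=> b0; apply: integral0_eq => x _; rewrite (negbTE (b0 x)). Qed.

Definition norm2 (z : R * R) : R := Num.sqrt (z.1 ^+ 2 + z.2 ^+ 2).

Lemma norm2_ge0 z : 0 <= norm2 z. Proof. exact: sqrtr_ge0. Qed.

Lemma norm2_le z t : 0 <= t -> (norm2 z <= t) = (z.1 ^+ 2 + z.2 ^+ 2 <= t ^+ 2).
Proof.
move=> t0; rewrite -(@ler_pXn2r _ 2)// ?nnegrE ?norm2_ge0// sqr_sqrtr//.
by rewrite addr_ge0 ?sqr_ge0.
Qed.

Lemma sqr_le_segment (x r : R) : 0 <= r ->
  (x ^+ 2 <= r) = (- Num.sqrt r <= x) && (x <= Num.sqrt r).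
Proof.
by move=> r0; rewrite -{1}(sqr_sqrtr r0) -ler_norml -[RHS](@ler_pXn2r _ 2)//
  ?nnegrE ?sqrtr_ge0// real_normK// num_real.
Qed.

(** A negative r is allowed because the square root is then 0 by convention, which is the length of
    the empty chord. *)
Lemma integral_chord (r : R) :
  (\int[mu]_x (if x ^+ 2 <= r then 1 else 0)%:E = (2 * Num.sqrt r)%:E)%E.
Proof.
have [r0|r0] := leP 0 r; last first.
  rewrite ltr0_sqrtr// mulr0 integral_pred0// => x.
  by rewrite -ltNge (lt_le_trans r0)// sqr_ge0.
under eq_integral do rewrite sqr_le_segment//.
rewrite integral_segment; last by rewrite ge0_cp// ?sqrtr_ge0.
by congr (_%:E); ring.
Qed.

Lemma measurable_norm2 : measurable_fun setT norm2.
Proof. by rewrite /norm2; mfun_tac. Qed.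

Lemma integral_semicircle (s : R) : 0 < s ->
  (\int[mu]_(x in `](- s)%R, s[) (2 * Num.sqrt (s ^+ 2 - x ^+ 2))%R%:E = (pi * s ^+ 2)%R%:E)%E.
Proof.
move=> s0.
(* The arctangent is half of arcsin(x/s), by the half-angle formula. In this form F is continuous on
   the whole line, in particular at the ends of the interval. *)
pose F (x : R) : R := x * Num.sqrt (s ^+ 2 - x ^+ 2) +
  2 * s ^+ 2 * atan (x / (s + Num.sqrt (s ^+ 2 - x ^+ 2))).
have den (x : R) : s + Num.sqrt (s ^+ 2 - x ^+ 2) != 0.
  by rewrite gt_eqF// ltr_pwDl// sqrtr_ge0.
have cF (x : R) : {for x, continuous F}.
  by rewrite /F; cont_tac; exact: den.
have -> : pi * s ^+ 2 = F s - F (- s).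
  rewrite /F sqrrN subrr sqrtr0 !mulr0 !addr0 !add0r mulNr divff ?gt_eqF//.
  by rewrite atanN atan1; field.
apply: (@ge0_FTC_oo _ _ F).
- lra.
- by move=> x _; rewrite mulr_ge0// sqrtr_ge0.
- by move=> x _; cont_tac.
- move=> x /andP[sx xs].
  have r2 : 0 < s ^+ 2 - x ^+ 2 by nra.
  rewrite /F; derive_eq; [exact: r2|exact: den|exact: r2|].
  set r := Num.sqrt _.
  have r0 : 0 < r by rewrite sqrtr_gt0.
  have rE : r ^+ 2 = s ^+ 2 - x ^+ 2 by rewrite sqr_sqrtr// ltW.
  have sE : s ^+ 2 = r ^+ 2 + x ^+ 2 by lra.
  have -> : 1 + (x / (s + r)) ^+ 2 = 2 * s / (s + r).
    transitivity ((s ^+ 2 + 2 * s * r + (r ^+ 2 + x ^+ 2)) / (s + r) ^+ 2).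
      by field; exact: den.
    by rewrite -sE; field; exact: den.
  rewrite /=.
  have nr : r != 0 by rewrite gt_eqF.
  have ns : s != 0 by rewrite gt_eqF.
  transitivity (r - x ^+ 2 / r + s * (1 + (x ^+ 2 / r) / (s + r))).
    by field; rewrite nr ns den.
  transitivity (r - x ^+ 2 / r + s * ((s * r + (r ^+ 2 + x ^+ 2)) / (r * (s + r)))).
    by field; rewrite nr den.
  rewrite -sE; transitivity ((r ^+ 2 - x ^+ 2 + s ^+ 2) / r).
    by field; rewrite nr den.
  by rewrite sE; field.
- by apply: cvg_at_right_filter; exact: cF.
- by apply: cvg_at_left_filter; exact: cF.
Qed.

Lemma area_disk (s : R) : 0 < s ->
  (\int[mu2]_z (if norm2 z <= s then 1 else 0)%:E = (pi * s ^+ 2)%R%:E)%E.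
Proof.
move=> s0; rewrite tonelli1; last 2 first.
- by have := measurable_norm2; rewrite /norm2 => ?; mfun_tac.
- by move=> z; rewrite lee_fin; case: ifP.
have E x : (\int[mu]_y (if norm2 (x, y) <= s then 1 else 0)%:E =
    (2 * Num.sqrt (s ^+ 2 - x ^+ 2))%:E)%E.
  rewrite -integral_chord; apply: eq_integral => y _.
  by rewrite norm2_le/= ?(ltW s0)// lerBrDl.
under eq_integral do rewrite E.
rewrite -(integral_semicircle _ s0) -(@integral_if `](- s)%R, s[%classic (fun x => (- s < x) && (x < s)))//.
apply: eq_integral => x _; case: ifPn => [//|h]; congr (_%:E).
rewrite ler0_sqrtr ?mulr0//.
move: h; rewrite negb_and -!leNgt => /orP[h|h]; nra.
Qed.

End Planar.

(** * The sum of two points of the disk *)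

Section Convolution.
Variable R : realType.
Notation mu := (@lebesgue_measure R).
Notation mu2 := (mu \x mu)%E.

(* The library declares no sigma-finite instance on a product measure. *)
Lemma area_measure_sigma_finite : sigma_finite setT (area_measure R).
Proof.
pose D n := [set` `[(- n%:R)%R, n%:R : R]].
have finD n : (mu (D n) < +oo)%E.
  by rewrite /D lebesgue_measure_itv /=; case: ifP => _; rewrite -?EFinB ltry.
have mD n : measurable (D n : set (measurableTypeR R)) by exact: measurable_itv.
exists (fun n => D n `*` D n).
  apply/seteqP; split => // -[x y] _.
  exists (Num.bound (`|x| + `|y|)) => //.
  have := archi_boundP (addr_ge0 (normr_ge0 x) (normr_ge0 y)).
  set N := (Num.bound _)%:R => hN.
  have := normr_ge0 x; have := normr_ge0 y => hy hx.
  split; rewrite /D /= in_itv /= -ler_norml; lra.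
move=> k; split; first exact: measurableX.
rewrite /area_measure product_measure1E//.
by apply: lte_mul_pinfty; [|rewrite ge0_fin_numE// finD|exact: finD].
Qed.
HB.instance Definition _ := Measure.copy (area_measure R) (mu \x mu)%E.
HB.instance Definition _ := Measure_isSigmaFinite.Build _ _ _ (area_measure R) area_measure_sigma_finite.
Lemma tonelli_plane_line (f : (R * R) * R -> \bar R) :
  measurable_fun setT f -> (forall z, (0 <= f z)%E) ->
  (\int[mu2]_x \int[mu]_y f (x, y) = \int[mu]_y \int[mu2]_x f (x, y))%E.
Proof.
move=> mf f0.
(* The sigma-finite instance is attached to [area_measure], which is convertible with the product
   measure of the statement. *)
have h := (@fubini_tonelli _ _ _ _ R (area_measure R) mu f).
have {}h := h mf f0.
exact: h.
Qed.
Lemma tonelli_plane_plane (f : (R * R) * (R * R) -> \bar R) :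
  measurable_fun setT f -> (forall z, (0 <= f z)%E) ->
  (\int[mu2]_x \int[mu2]_y f (x, y) = \int[mu2]_y \int[mu2]_x f (x, y))%E.
Proof.
move=> mf f0.
have h := (@fubini_tonelli _ _ _ _ R (area_measure R) (area_measure R) f).
have {}h := h mf f0.
exact: h.
Qed.

(** With s = sqrt(1 - y^2), the slice of the lens at height y is [a - s, s], and the condition on t
    describes [a, 2s]. Both have length 2s - a, or are empty when a > 2s; for |y| > 1 both are
    empty. *)
Lemma overlap_slice (a y : R) : 0 <= a ->
  (\int[mu]_x (if (norm2 R (x, y) <= 1) && (norm2 R (a - x, - y) <= 1)
               then 1 else 0)%:E =
   \int[mu]_t (if (a <= t) && (y ^+ 2 <= (4 - t ^+ 2) / 4) then 1 else 0)%:E)%E.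
Proof.
move=> a0; have [y1|y1] := leP (y ^+ 2) 1; last first.
  rewrite !integral_pred0// => x; rewrite negb_and -!ltNge; apply/orP.
    by right; have := sqr_ge0 x; lra.
  by left; rewrite ltNge norm2_le//= -ltNge expr1n; have := sqr_ge0 x; lra.
set s := Num.sqrt (1 - y ^+ 2).
have s0 : 0 <= s by exact: sqrtr_ge0.
have s2 : s ^+ 2 = 1 - y ^+ 2 by rewrite sqr_sqrtr; lra.
have E1 x : (norm2 R (x, y) <= 1) && (norm2 R (a - x, - y) <= 1) =
    (a - s <= x) && (x <= s).
  rewrite !norm2_le//= sqrrN expr1n -!lerBrDr !sqr_le_segment -/s; lra.
have E2 t : (a <= t) && (y ^+ 2 <= (4 - t ^+ 2) / 4) = (a <= t) && (t <= 2 * s).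
  case: (leP a t) => //= at_;  have t0 : 0 <= t by exact: le_trans at_.

  have -> : (t <= 2 * s) = (t ^+ 2 <= (2 * s) ^+ 2).
    by rewrite ler_pXn2r// nnegrE mulr_ge0.
  rewrite exprMn s2.
  by apply/idP/idP; lra.
under eq_integral do rewrite E1.
under [in RHS]eq_integral do rewrite E2.
have [h|h] := leP a (2 * s).
  rewrite !integral_segment//; last lra.
  by congr (_%:E); ring.
by rewrite !integral_pred0// => x; rewrite negb_and -!ltNge; apply/orP; lra.
Qed.

(** After [overlap_slice] the order of y and t is exchanged; for fixed t the admissible y form a
    chord of length sqrt(4 - t^2). *)
Lemma overlap_real (a : R) : 0 <= a ->
  (\int[mu2]_x (if (norm2 R x <= 1)%R && (norm2 R (a - x.1, - x.2) <= 1)%R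
                then 1 else 0)%:E =
   \int[mu]_t (if (a <= t)%R then Num.sqrt (4 - t ^+ 2) else 0)%:E)%E.
Proof.
move=> a0; have mn := @measurable_norm2 R.
rewrite tonelli2; last 2 first.
- by mfun_tac.
- by move=> z; rewrite lee_fin; case: ifP.
under eq_integral do rewrite overlap_slice//.
rewrite (tonelli_swap _ (fun z => (if (a <= z.2) && (z.1 ^+ 2 <= (4 - z.2 ^+ 2) / 4)
  then 1 else 0)%:E)); last 2 first.
- by mfun_tac.
- by move=> z; rewrite lee_fin; case: ifP.
apply: eq_integral => t _ /=; case: (leP a t) => /= at_; last by rewrite integral0.
rewrite integral_chord; congr (_%:E).
transitivity (Num.sqrt (2 ^+ 2 * ((4 - t ^+ 2) / 4))); last by congr Num.sqrt; field.
by rewrite [RHS]sqrtrM ?sqr_ge0// sqrtr_sqr ger0_norm.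
Qed.

Lemma norm2_rotation c s z : c ^+ 2 + s ^+ 2 = 1 ->
  norm2 R (rotation R c s z) = norm2 R z.
Proof.
move=> cs; rewrite /norm2 /rotation /=; congr (Num.sqrt _).
transitivity ((c ^+ 2 + s ^+ 2) * (z.1 ^+ 2 + z.2 ^+ 2)); first by ring.
by rewrite cs mul1r.
Qed.

Lemma overlap (w : R * R) :
  (\int[mu2]_x (if (norm2 R x <= 1)%R && (norm2 R (w.1 - x.1, w.2 - x.2) <= 1)%R
                then 1 else 0)%:E =
   \int[mu]_t (if (norm2 R w <= t)%R then Num.sqrt (4 - t ^+ 2) else 0)%:E)%E.
Proof.
have mn := @measurable_norm2 R.
(* c and s are the cosine and sine of the argument of w, which reduces the lens to one centred on
   the nonnegative real axis. For w = 0 any rotation serves. *)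
have [c [s [cs wE]]] : exists c s, c ^+ 2 + s ^+ 2 = 1 /\ w = rotation R c s (norm2 R w, 0).
  have [w0|w0] := eqVneq (norm2 R w) 0.
    exists 1, 0; split; first by ring.
    have : norm2 R w <= 0 by rewrite w0.
    rewrite norm2_le// expr0n /= => w00.
    have := sqr_ge0 w.1; have := sqr_ge0 w.2 => h2 h1.
    have /eqP : w.1 ^+ 2 = 0 by lra.
    rewrite sqrf_eq0 => /eqP e1.
    have /eqP : w.2 ^+ 2 = 0 by lra.
    rewrite sqrf_eq0 => /eqP e2.
    by rewrite /rotation w0 /= !mulr0 subr0 addr0 [LHS]surjective_pairing e1 e2.
  exists (w.1 / norm2 R w), (w.2 / norm2 R w); split.
    rewrite !exprMn -mulrDl exprVn /norm2 sqr_sqrtr ?addr_ge0 ?sqr_ge0// divff//.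
    by apply: contra w0; rewrite /norm2 => /eqP ->; rewrite sqrtr0.
  by rewrite /rotation /= !mulr0 subr0 addr0 !divfK// -surjective_pairing.
rewrite -overlap_real ?norm2_ge0//.
rewrite -(ge0_integral_rotation _ c s (fun x => (if (norm2 R x <= 1)%R &&
  (norm2 R (w.1 - x.1, w.2 - x.2) <= 1)%R then 1 else 0)%:E) cs); last 2 first.
- by mfun_tac.
- by move=> z; rewrite lee_fin; case: ifP.
apply: eq_integral => x _; rewrite norm2_rotation//.
rewrite (_ : (w.1 - _, _) = rotation R c s (norm2 R w - x.1, - x.2)); last first.
  by rewrite [in LHS]wE /rotation /=; congr (_, _); ring.
by rewrite norm2_rotation.
Qed.

(** Put w = x + y, integrate out x with [overlap], and exchange w with t. Integrating t over the
    whole line costs nothing: the disk is empty for t < 0 and the square root vanishes for t >=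
    2. *)
Lemma integral_disk_sum (F : R * R -> R) :
  measurable_fun setT F -> (forall z, 0 <= F z) ->
  (\int[mu2]_x \int[mu2]_y (if (norm2 R x <= 1)%R && (norm2 R y <= 1)%R
       then F (x.1 + y.1, x.2 + y.2)%R else 0)%:E =
   \int[mu]_t ((Num.sqrt (4 - t ^+ 2))%:E *
     \int[mu2]_w (if (norm2 R w <= t)%R then F w else 0)%:E))%E.
Proof.
move=> mF F0; have mn := @measurable_norm2 R.
have E x : (\int[mu2]_y (if (norm2 R x <= 1)%R && (norm2 R y <= 1)%R
       then F (x.1 + y.1, x.2 + y.2)%R else 0)%:E =
    \int[mu2]_w (if (norm2 R x <= 1)%R && (norm2 R (w.1 - x.1, w.2 - x.2) <= 1)%R
       then F w else 0)%:E)%E.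
  rewrite -(ge0_integral_shift2 _ (fun y => (if (norm2 R x <= 1)%R && (norm2 R y <= 1)%R
       then F (x.1 + y.1, x.2 + y.2)%R else 0)%:E) _ _ (- x.1, - x.2)); last 2 first.
  - by mfun_tac.
  - by move=> z; rewrite lee_fin; case: ifP.
  apply: eq_integral => w _ /=.
  have -> : x.1 + (w.1 - x.1) = w.1 by ring.
  have -> : x.2 + (w.2 - x.2) = w.2 by ring.
  by rewrite -surjective_pairing.
transitivity (\int[mu2]_x \int[mu2]_w (if (norm2 R x <= 1)%R &&
    (norm2 R (w.1 - x.1, w.2 - x.2) <= 1)%R then F w else 0)%:E)%E.
  by apply: eq_integral => x _; exact: E.
rewrite (tonelli_plane_plane (fun z => (if (norm2 R z.1 <= 1)%R &&
   (norm2 R (z.2.1 - z.1.1, z.2.2 - z.1.2) <= 1)%R then F z.2 else 0)%:E)); last 2 first.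
- by mfun_tac.
- by move=> z; rewrite lee_fin; case: ifP.
transitivity (\int[mu2]_w \int[mu]_t
    (if (norm2 R w <= t)%R then Num.sqrt (4 - t ^+ 2) * F w else 0)%:E)%E.
  apply: eq_integral => w _ /=.
  transitivity ((F w)%:E * \int[mu2]_x (if (norm2 R x <= 1)%R &&
     (norm2 R (w.1 - x.1, w.2 - x.2) <= 1)%R then 1 else 0)%:E)%E.
    rewrite -ge0_integralZl_EFin//; last 2 first.
    - by move=> x _; rewrite lee_fin; case: ifP.
    - by mfun_tac.
    by apply: eq_integral => x _; case: ifP => _; rewrite -EFinM ?mulr1 ?mulr0.
  rewrite overlap -ge0_integralZl_EFin//; last 2 first.
  - by move=> x _; rewrite lee_fin; case: ifP => // _; exact: sqrtr_ge0.
  - have mg : measurable_fun setT (fun t : R =>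
        (if norm2 R w <= t then Num.sqrt (4 - t ^+ 2) else 0)%:E) by mfun_tac.
    exact: mg.
  by apply: eq_integral => x _; case: ifP => _; rewrite -EFinM ?mulr0// mulrC.
rewrite (tonelli_plane_line (fun z => (if (norm2 R z.1 <= z.2)%R
   then Num.sqrt (4 - z.2 ^+ 2) * F z.1 else 0)%:E)); last 2 first.
- by mfun_tac.
- by move=> z; rewrite lee_fin; case: ifP => // _; rewrite mulr_ge0// sqrtr_ge0.
apply: eq_integral => t _ /=; rewrite -ge0_integralZl_EFin//; last 2 first.
- by move=> x _; rewrite lee_fin; case: ifP.
- by mfun_tac.
by apply: eq_integral => x _; case: ifP => _; rewrite -EFinM ?mulr0.
Qed.

End Convolution.

(** * Logarithmic potential of a disk *)

Section Averaging.
Variable R : realType.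
Notation mu := (@lebesgue_measure R).
Notation mu2 := (mu \x mu)%E.
Implicit Types z w : R * R.

(** Complex squaring in coordinates, so that [cpow2 n z] is the complex power z^(2^n). *)
Definition csqr z : R * R := (z.1 ^+ 2 - z.2 ^+ 2, 2 * z.1 * z.2).
Definition cpow2 n z := iter n csqr z.

Lemma norm2_sqr z : norm2 R z ^+ 2 = z.1 ^+ 2 + z.2 ^+ 2.
Proof. by rewrite sqr_sqrtr// addr_ge0 ?sqr_ge0. Qed.

Lemma norm2_csqr z : norm2 R (csqr z) = norm2 R z ^+ 2.
Proof.
rewrite norm2_sqr /norm2 /csqr /=.
rewrite (_ : _ + _ = (z.1 ^+ 2 + z.2 ^+ 2) ^+ 2); last by ring.
by rewrite sqrtr_sqr ger0_norm// addr_ge0 ?sqr_ge0.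
Qed.

Lemma norm2_cpow2 n z : norm2 R (cpow2 n z) = norm2 R z ^+ (2 ^ n).
Proof.
elim: n => [|n IH]; first by rewrite expn0 expr1.
by rewrite /cpow2 iterS norm2_csqr IH -exprM expnSr.
Qed.

Lemma cpow2_rotation n c s z :
  cpow2 n (rotation R c s z) =
  rotation R (cpow2 n (c, s)).1 (cpow2 n (c, s)).2 (cpow2 n z).
Proof.
elim: n => [//|n IH]; rewrite /cpow2 !iterS -!/(cpow2 _ _) IH /csqr /rotation /=.
by congr (_, _); ring.
Qed.

Lemma cpow2_cos_sin n (x : R) :
  cpow2 n (cos x, sin x) = (cos (2 ^+ n * x), sin (2 ^+ n * x)).
Proof.
elim: n => [|n IH]; first by rewrite expr0 mul1r.
rewrite /cpow2 iterS -!/(cpow2 _ _) IH /csqr /=.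
have -> : 2 ^+ n.+1 * x = 2 ^+ n * x + 2 ^+ n * x by rewrite exprS; ring.
by rewrite cosD sinD; congr (_, _); ring.
Qed.

(** Rotation by pi / 2^n multiplies the 2^n-th power by exp(i pi) = -1. *)
Lemma cpow2_opp n : exists c s : R, c ^+ 2 + s ^+ 2 = 1 /\
  forall z, cpow2 n (rotation R c s z) = (- (cpow2 n z).1, - (cpow2 n z).2).
Proof.
exists (cos (pi / 2 ^+ n)), (sin (pi / 2 ^+ n)); split; first exact: cos2Dsin2.
move=> z; rewrite cpow2_rotation cpow2_cos_sin /=.
rewrite (_ : 2 ^+ n * _ = pi); last by field; rewrite expf_neq0.
by rewrite cospi sinpi /rotation /=; congr (_, _); ring.
Qed.

Lemma measurable_cpow2 n : measurable_fun setT (cpow2 n).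
Proof.
elim: n => [|n IH]; first exact: measurable_id.
have mc : measurable_fun setT csqr by rewrite /csqr; mfun_tac.
exact: (measurableT_comp mc IH).
Qed.

Lemma norm2_sub_le z A : 0 <= A -> norm2 R (z.1 - A, z.2) <= norm2 R z + A.
Proof.
move=> A0; rewrite norm2_le/=; last by rewrite addr_ge0 ?norm2_ge0.
have := norm2_sqr z; have := norm2_ge0 R z; set r := norm2 R z => r0 rE.
have : - z.1 <= r.
  by rewrite lerNl; apply: (le_trans _ (lerNnormlW (lexx `|z.1|))); rewrite lerN2 -(@ler_pXn2r _ 2) ?nnegrE// real_normK ?num_real// rE lerDl sqr_ge0.
nra.
Qed.

Lemma norm2_sub_ge z A : 0 <= A -> `|norm2 R z - A| <= norm2 R (z.1 - A, z.2).
Proof.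
move=> A0; rewrite -(@ler_pXn2r _ 2) ?nnegrE ?norm2_ge0// real_normK ?num_real//.
rewrite [leRHS]norm2_sqr /=.
have := norm2_sqr z; have := norm2_ge0 R z; set r := norm2 R z => r0 rE.
have : z.1 <= r.
  apply: (le_trans (ler_norm _)).
  by rewrite -(@ler_pXn2r _ 2) ?nnegrE// real_normK ?num_real// rE lerDl sqr_ge0.
nra.
Qed.

Lemma norm2_sub_mul z A :
  norm2 R (z.1 - A, z.2) * norm2 R (- z.1 - A, - z.2) =
  norm2 R ((csqr z).1 - A ^+ 2, (csqr z).2).
Proof.
rewrite /norm2 /= -sqrtrM ?addr_ge0 ?sqr_ge0//; congr Num.sqrt; ring.
Qed.

Variable a : R.
Hypotheses (a0 : 0 < a) (a2 : a <= 2).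

(* [logdist n w] is log|w^N - a^N| / N with N = 2^n. *)
Definition logdist n w : R :=
  ln (norm2 R ((cpow2 n w).1 - a ^+ (2 ^ n), (cpow2 n w).2)) / 2 ^+ n.

Lemma measurable_logdist n : measurable_fun setT (logdist n).
Proof.
have mn := @measurable_norm2 R; have mc := measurable_cpow2 n.
by rewrite /logdist; mfun_tac.
Qed.

Lemma logdist_le n w : norm2 R w <= 2 -> logdist n w <= ln 4.
Proof.
move=> w2; rewrite /logdist ler_pdivrMr ?exprn_gt0//.
have -> : ln 4 * 2 ^+ n = ln (4 ^+ (2 ^ n)) :> R.
  by rewrite lnXn// -(mulr_natr (ln 4)) natrX.
(* At w^N = a^N the logarithm takes its default value 0, which also obeys the bound. *)
have [h|h] := leP (norm2 R ((cpow2 n w).1 - a ^+ (2 ^ n), (cpow2 n w).2)) 0.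
  by rewrite ln0// ln_ge0// exprn_ege1// ler1n.
rewrite ler_ln ?posrE ?exprn_gt0//.
apply: (le_trans (norm2_sub_le _ _ (exprn_ge0 _ (ltW a0)))).
rewrite norm2_cpow2; apply: (@le_trans _ _ (2 ^+ (2 ^ n) + 2 ^+ (2 ^ n))).
  by rewrite lerD// lerXn2r// ?nnegrE ?norm2_ge0// ltW.
(* The distance is at most 2^N + 2^N with N = 2^n, and this is at most 4^N because 2 <= 2^N. *)
have h4 : 4 = 2 * 2 :> R by ring.
have p2 : 2 <= 2 ^+ (2 ^ n) :> R.
  by rewrite -[leLHS]expr1 ler_eXn2l ?ltr1n// expn_gt0.
rewrite h4 exprMn; nra.
Qed.

(** This is the factorization of w^(2N) - a^(2N) into w^N - a^N and w^N + a^N, in absolute value.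
    Off the circle |w| = a neither factor is 0, so the logarithm of the product splits. *)
Lemma logdist_double n w c s : norm2 R w != a ->
  (forall z, cpow2 n (rotation R c s z) = (- (cpow2 n z).1, - (cpow2 n z).2)) ->
  logdist n w + logdist n (rotation R c s w) = 2 * logdist n.+1 w.
Proof.
move=> wa hr; rewrite /logdist hr /=.
have A0 : 0 <= a ^+ (2 ^ n) by rewrite exprn_ge0// ltW.
have ra : norm2 R (cpow2 n w) - a ^+ (2 ^ n) != 0.
  rewrite subr_eq0 norm2_cpow2; apply: contra wa => /eqP h.
  by rewrite -(@eqrXn2 _ (2 ^ n)) ?expn_gt0 ?norm2_ge0 ?(ltW a0)// h.
have p1 := lt_le_trans (_ : 0 < _) (norm2_sub_ge (cpow2 n w) _ A0).
have p2 := lt_le_trans (_ : 0 < _) (norm2_sub_ge (- (cpow2 n w).1, - (cpow2 n w).2) _ A0).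
have nN z : norm2 R (- z.1, - z.2) = norm2 R z by rewrite /norm2 /= !sqrrN.
rewrite nN normr_gt0 in p2; rewrite normr_gt0 in p1.
have -> : 2 ^+ n.+1 = 2 * 2 ^+ n :> R by rewrite exprS.
rewrite -mulrDl -lnM ?posrE ?p1 ?p2//= norm2_sub_mul.
rewrite -exprM -expnSr; field.
by rewrite expf_neq0.
Qed.

(** Rotation invariance lets the integral be written twice, once in the rotated variable;
    [logdist_double] then adds the two integrands. The region depends on |w| only, hence is itself
    invariant. *)
Lemma integral_logdist_step n (e : R -> bool) : measurable_fun setT e ->
  (forall r, e r -> r <= 2 /\ r != a) ->
  (\int[mu2]_w (if e (norm2 R w) then ln 4 - logdist n w else 0)%:E =
   \int[mu2]_w (if e (norm2 R w) then ln 4 - logdist n.+1 w else 0)%:E)%E.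
Proof.
move=> me he; have mn := @measurable_norm2 R.
have ml := measurable_logdist n; have ml1 := measurable_logdist n.+1.
pose g k w := if e (norm2 R w) then ln 4 - logdist k w else 0.
have g0 k w : 0 <= g k w.
  by rewrite /g; case: ifP => // /he[h _]; rewrite subr_ge0 logdist_le.
have mg k : measurable_fun setT (fun w => (g k w)%:E).
  have mlk := measurable_logdist k; rewrite /g; mfun_tac.
have [c [s [cs hr]]] := cpow2_opp n.
have mr := measurable_rotation R c s.
have mgr : measurable_fun setT (fun w => (g n (rotation R c s w))%:E).
  exact: (measurableT_comp (mg n) mr).
(* The integrals are not known to be finite here; the factor 2 is cancelled by multiplying by 1/2,
   which is valid in the extended reals. *)
have E : (2%:E * \int[mu2]_w (g n w)%:E = 2%:E * \int[mu2]_w (g n.+1 w)%:E)%E.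
  rewrite -[RHS]ge0_integralZl_EFin//; last 2 first.
  - by move=> w _; rewrite lee_fin.
  - exact: mg.
  have -> : 2%:E = (1%:E + 1%:E)%E :> \bar R by rewrite -EFinD.
  rewrite ge0_muleDl// !mul1e.
  rewrite -{2}(ge0_integral_rotation _ c s (fun w => (g n w)%:E) cs (mg n) (fun=> g0 n _)).
  rewrite -ge0_integralD//; last 3 first.
  - by move=> w _; rewrite lee_fin.
  - exact: mg.
  - by move=> w _; rewrite lee_fin.
  apply: eq_integral => w _; rewrite -!EFinD -EFinM; congr (_%:E).
  rewrite /g norm2_rotation//; case: ifP => [/he[_ wa]|_]; last by rewrite addr0 mulr0.
  have := logdist_double n w c s wa hr; lra.
have := congr1 (fun x => (2^-1)%:E * x)%E E.
by rewrite !muleA -EFinM mulVf// !mul1e.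
Qed.

End Averaging.

(** * Limit of the averaged logarithms away from the circle |w| = a *)

Section DiskPotential.
Variable R : realType.
Notation mu := (@lebesgue_measure R).
Notation mu2 := (mu \x mu)%E.
Implicit Types w : R * R.

(** It turns a uniform error c on the disk of radius 2 into an error 4 pi c on integrals. The
    additive form avoids subtracting integrals that could be infinite. *)
Lemma le_integral_disk (f g : R * R -> R) (c : R) : 0 <= c ->
  measurable_fun setT f -> measurable_fun setT g ->
  (forall w, 0 <= f w) -> (forall w, 0 <= g w) ->
  (forall w, f w <= g w + (if norm2 R w <= 2 then c else 0)) ->
  (\int[mu2]_w (f w)%:E <= \int[mu2]_w (g w)%:E + (c * (pi * 4))%:E)%E.
Proof.
move=> c0 mf mg f0 g0 fg; have mn := @measurable_norm2 R.
have <- : (\int[mu2]_w (c%:E * (if norm2 R w <= 2 then 1 else 0)%:E) = (c * (pi * 4))%:E)%E.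
  rewrite ge0_integralZl_EFin//; last 2 first.
  - by move=> w _; rewrite lee_fin; case: ifP.
  - by mfun_tac.
  by rewrite area_disk// -EFinM; congr (_%:E); ring.
have m1 : measurable_fun setT (fun w : R * R => (c%:E * (if norm2 R w <= 2 then 1 else 0)%:E)%E).
  rewrite (_ : (fun w => _) = (fun w => (c * (if norm2 R w <= 2 then 1 else 0))%:E))//.
  by mfun_tac.
have m2 : measurable_fun setT (fun w : R * R => (g w)%:E) by mfun_tac.
have m3 : measurable_fun setT (fun w : R * R => (f w)%:E) by mfun_tac.
have h0 (w : R * R) : setT w -> (0 <= c%:E * (if norm2 R w <= 2 then 1 else 0)%:E)%E.
  by move=> _; rewrite -EFinM lee_fin; case: ifP => _; rewrite ?mulr0 ?mulr1.
have g0' (w : R * R) : setT w -> (0 <= (g w)%:E)%E by rewrite lee_fin.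
rewrite -(ge0_integralD mu2 measurableT g0' m2 h0 m1).
apply: ge0_le_integral => //.
- by move=> w _; rewrite lee_fin.
- exact: (emeasurable_funD m2 m1).
- move=> w _; rewrite -EFinM -EFinD lee_fin; apply: (le_trans (fg w)).
  by case: ifP => _; rewrite ?mulr1 ?mulr0.
Qed.

Lemma pow2_sum_bounds (n : nat) (x m q : R) : 0 <= x -> 0 < m -> 0 < q < 1 -> x <= q * m ->
  m ^+ (2 ^ n) * (1 - q) <= m ^+ (2 ^ n) - x ^+ (2 ^ n) /\
  m ^+ (2 ^ n) + x ^+ (2 ^ n) <= 2 * m ^+ (2 ^ n).
Proof.
move=> x0 m0 /andP[q0 q1] xq.
have h : x ^+ (2 ^ n) <= q * m ^+ (2 ^ n).
  apply: (@le_trans _ _ ((q * m) ^+ (2 ^ n))).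
    by rewrite lerXn2r// nnegrE// mulr_ge0// ltW.
  rewrite exprMn ler_pM2r ?exprn_gt0//.
  have := expn_gt0 2 n; case: (2 ^ n)%N => // k _.
  by rewrite exprS ler_piMr ?(ltW q0)// exprn_ile1 ?(ltW q0)// ltW.
have : 0 < m ^+ (2 ^ n) by rewrite exprn_gt0.
nra.
Qed.

Variable a : R.
Hypotheses (a0 : 0 < a) (a2 : a <= 2).

(** With m = max(a, |w|) and N = 2^n, the smaller of the two moduli is at most q m, so |w^N - a^N|
    lies between (1 - q) m^N and 2 m^N. After taking logarithms and dividing by N, only O(1/N)
    separates it from ln m. *)
Lemma logdist_approx n w (q : R) : 0 < q < 1 ->
  (norm2 R w <= q * a) || (a <= q * norm2 R w) ->
  `|logdist R a n w - ln (Num.max a (norm2 R w))| <= (ln 2 - ln (1 - q)) / 2 ^+ n.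
Proof.
move=> q01 h; have /andP[q0 q1] := q01.
set r := norm2 R w in h *; set m := Num.max a r; have r0 : 0 <= r := norm2_ge0 _ _.
have m0 : 0 < m by rewrite lt_max a0.
have A0 : 0 <= a ^+ (2 ^ n) by rewrite exprn_ge0// ltW.
set d := norm2 R ((cpow2 R n w).1 - a ^+ (2 ^ n), (cpow2 R n w).2).
have [d1 d2] : m ^+ (2 ^ n) * (1 - q) <= d /\ d <= 2 * m ^+ (2 ^ n).
  have hg := norm2_sub_ge _ (cpow2 R n w) _ A0.
  have hl := norm2_sub_le _ (cpow2 R n w) _ A0.
  rewrite norm2_cpow2 -/r -/d in hg hl.
  case/orP: h => h.
    have [b1 b2] := pow2_sum_bounds n r a q r0 a0 q01 h.
    have -> : m = a.
      apply/max_idPl; apply: (le_trans h); rewrite ler_piMl// ltW//.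
    split; last lra.
    by apply: (le_trans b1); rewrite (le_trans _ hg)// distrC ler_norm.
  have rp : 0 < r by rewrite -(pmulr_rgt0 _ q0); exact: lt_le_trans h.
  have [b1 b2] := pow2_sum_bounds n a r q (ltW a0) rp q01 h.
  have -> : m = r.
    apply/max_idPr; apply: (le_trans h); rewrite ler_piMl// ltW//.
  split; last lra.
  by apply: (le_trans b1); rewrite (le_trans _ hg)// ler_norm.
have mN : 0 < m ^+ (2 ^ n) by rewrite exprn_gt0.
have q1' : 0 < 1 - q by lra.
have dp : 0 < d by apply: (lt_le_trans _ d1); rewrite mulr_gt0.
have l1 : ln (m ^+ (2 ^ n) * (1 - q)) <= ln d by rewrite ler_ln ?posrE ?mulr_gt0.
have l2 : ln d <= ln (2 * m ^+ (2 ^ n)) by rewrite ler_ln ?posrE ?mulr_gt0.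
move: l1 l2; rewrite !lnM ?posrE// lnXn// -(mulr_natr (ln m)) natrX.
have ln2 : 0 <= ln 2 :> R by rewrite ln_ge0// ler1n.
have lnq : ln (1 - q) <= 0 by rewrite ln_le0//; lra.
have p2 : 0 < 2 ^+ n :> R by rewrite exprn_gt0.
rewrite /logdist -/d.
rewrite -[X in `|_ - X|](mulfK (lt0r_neq0 p2)) -mulrBl normrM.
rewrite (ger0_norm (_ : 0 <= 2 ^- n)) ?invr_ge0 ?(ltW p2)// ler_pM2r ?invr_gt0// ler_norml.
lra.
Qed.

(** The integral at level 0 equals the one at every level n, and at level n the integrand is
    uniformly within C / 2^n of the limit. Each inequality is proved up to an arbitrary positive
    error, which needs no finiteness. *)
Lemma integral_logdist_region (e : R -> bool) (q : R) : 0 < q < 1 ->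
  measurable_fun setT e ->
  (forall r, e r -> r <= 2 /\ ((r <= q * a) || (a <= q * r))) ->
  (\int[mu2]_w (if e (norm2 R w) then ln 4 - logdist R a 0 w else 0)%:E =
   \int[mu2]_w (if e (norm2 R w) then ln 4 - ln (Num.max a (norm2 R w)) else 0)%:E)%E.
Proof.
move=> q01 me he; have /andP[q0 q1] := q01; have mn := @measurable_norm2 R.
have mmax : measurable_fun setT (fun w : R * R => ln (Num.max a (norm2 R w))).
  by apply: mfun_ln; apply: (measurable_maxr (measurable_cst _)).
have I n : (\int[mu2]_w (if e (norm2 R w) then ln 4 - logdist R a 0 w else 0)%:E =
   \int[mu2]_w (if e (norm2 R w) then ln 4 - logdist R a n w else 0)%:E)%E.
  elim: n => [//|n ->]; apply: integral_logdist_step => // r er.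
  have [r2 h] := he r er; split => //; apply: contraPneq h => ->; apply/negP.
  by rewrite negb_or -!ltNge; apply/andP; split; rewrite gtr_pMl.
pose C := ln 2 - ln (1 - q).
have C0 : 0 <= C.
  have : 0 <= ln 2 :> R by rewrite ln_ge0// ler1n.
  have : ln (1 - q) <= 0 by rewrite ln_le0//; lra.
  by rewrite /C; lra.
pose g n w := if e (norm2 R w) then ln 4 - logdist R a n w else 0.
pose h w := if e (norm2 R w) then ln 4 - ln (Num.max a (norm2 R w)) else 0.
have mg n : measurable_fun setT (g n).
  by have ml := measurable_logdist R a n; rewrite /g; mfun_tac.
have mh : measurable_fun setT h by rewrite /h; mfun_tac.
have g0 n w : 0 <= g n w.
  by rewrite /g; case: ifP => // /he[r2 _]; rewrite subr_ge0 logdist_le.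
have h0 w : 0 <= h w.
  rewrite /h; case: ifP => // /he[r2 _]; rewrite subr_ge0 ler_ln ?posrE//.
    have r4 : norm2 R w <= 4 by lra.
    have a4 : a <= 4 by apply: (le_trans a2); rewrite ler_nat.
    by rewrite ge_max a4.
  by rewrite lt_max a0.
have gh n w : `|g n w - h w| <= if norm2 R w <= 2 then C / 2 ^+ n else 0.
  rewrite /g /h; case: ifPn => [ew|_].
    have [-> hq] := he _ ew.
    rewrite (_ : _ - _ - _ = - (logdist R a n w - ln (Num.max a (norm2 R w)))); last by ring.
    by rewrite normrN; exact: logdist_approx.
  by rewrite subrr normr0; case: ifP => // _; rewrite divr_ge0// exprn_ge0.
have eps (x : R) : 0 < x -> exists n, C / 2 ^+ n * (pi * 4) <= x.
  move=> x0; pose K := C * (pi * 4) / x.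
  have K0 : 0 <= K by rewrite !(mulr_ge0, invr_ge0)// ?pi_ge0// ltW.
  exists (Num.bound K); have := archi_boundP K0.
  have : (Num.bound K)%:R <= 2 ^+ Num.bound K :> R.
    by rewrite -natrX ler_nat ltnW// ltn_expl.
  set N := Num.bound K => h1 h2.
  have p2 : 0 < 2 ^+ N :> R by rewrite exprn_gt0.
  have kp := ltW (lt_le_trans h2 h1); rewrite /K ler_pdivrMr// in kp.
  by rewrite mulrAC ler_pdivrMr// (mulrC x).
apply/eqP; rewrite eq_le; apply/andP; split.
  apply/lee_addgt0Pr => x x0; have [n hn] := eps x x0; rewrite (I n).
  apply: (@le_trans _ _ (\int[mu2]_w (h w)%:E + (C / 2 ^+ n * (pi * 4))%:E)%E).
    apply: (le_integral_disk (g n) h) => //; first by rewrite divr_ge0// exprn_ge0.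
    by move=> w; rewrite -lerBlDl; have := gh n w; rewrite ler_norml => /andP[].
  by rewrite leeD2l// lee_fin.
apply/lee_addgt0Pr => x x0; have [n hn] := eps x x0; rewrite (I n).
apply: (@le_trans _ _ (\int[mu2]_w (g n w)%:E + (C / 2 ^+ n * (pi * 4))%:E)%E).
  apply: (le_integral_disk h (g n)) => //; first by rewrite divr_ge0// exprn_ge0.
  by move=> w; rewrite -lerBlDl -opprB lerNl; have := gh n w; rewrite ler_norml => /andP[].
by rewrite leeD2l// lee_fin.
Qed.

(** Each vertical line meets the circle in at most two points, so Tonelli integrates zeros. *)
Lemma circle_null (s : R) : mu2 [set w | norm2 R w = s] = 0.
Proof.
have mn := @measurable_norm2 R.
have mS : measurable [set w | norm2 R w = s].
  rewrite -[X in measurable X]setTI (_ : [set w | _] = norm2 R @^-1` [set s])//.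
  exact: mn.
have [s0|s0] := ltP s 0.
  rewrite (_ : [set w | _] = set0) ?measure0// -subset0 => w /= ws.
  by have := norm2_ge0 R w; rewrite ws leNgt s0.
rewrite -[LHS]mul1e -integral_cst// integral_mkcond.
transitivity (\int[mu2]_w (if (norm2 R w <= s) && (s <= norm2 R w) then 1 else 0)%:E)%E.
  apply: eq_integral => w _; rewrite /patch -eq_le.
  have -> : (w \in [set w | norm2 R w = s]) = (norm2 R w == s).
    by apply/idP/eqP; rewrite inE.
  by case: ifP.
rewrite tonelli1; last 2 first.
- by mfun_tac.
- by move=> z; rewrite lee_fin; case: ifP.
apply: integral0_eq => x _.
pose S := [set y : R | norm2 R (x, y) = s].
rewrite (@integral_if _ S); last first.
  move=> y; rewrite /S /=; split => [->|/andP[h1 h2]]; first by rewrite lexx.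
  by apply/eqP; rewrite eq_le h1.
have cS : countable S.
  apply: (@sub_countable _ _ _ [set Num.sqrt (s ^+ 2 - x ^+ 2); - Num.sqrt (s ^+ 2 - x ^+ 2)]).
    apply: subset_card_le => y /= hy.
    have hy2 := norm2_sqr R (x, y); rewrite hy /= in hy2.
    have -> : s ^+ 2 - x ^+ 2 = y ^+ 2 by lra.
    rewrite sqrtr_sqr; case: (ger0P y) => _; [by left|by right; rewrite opprK].
  exact: finite_set_countable.
have mSy : measurable S.
  have mm : measurable_fun setT (fun y : R => norm2 R (x, y)) by rewrite /norm2; mfun_tac.
  by rewrite -[X in measurable X]setTI (_ : S = (fun y => norm2 R (x, y)) @^-1` [set s])//; exact: mm.
by rewrite integral_cst//= mul1e; exact: countable_lebesgue_measure0.
Qed.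

End DiskPotential.

(** * The potential on a full disk and its closed form *)

Section RadialPotential.
Variable R : realType.
Notation mu := (@lebesgue_measure R).
Notation mu2 := (mu \x mu)%E.
Implicit Types w : R * R.
Variable a : R.
Hypotheses (a0 : 0 < a) (a2 : a <= 2).

Lemma measurable_logmax : measurable_fun setT (fun w => ln (Num.max a (norm2 R w))).
Proof.
have mn := @measurable_norm2 R.
by apply: mfun_ln; apply: (measurable_maxr (measurable_cst _)).
Qed.

Lemma logmax_le w : norm2 R w <= 2 -> ln (Num.max a (norm2 R w)) <= ln 4.
Proof.
move=> w2; rewrite ler_ln ?posrE//; last by rewrite lt_max a0.
have r4 : norm2 R w <= 4 by apply: (le_trans w2); rewrite ler_nat.
have a4 : a <= 4 by apply: (le_trans a2); rewrite ler_nat.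
by rewrite ge_max a4.
Qed.

(** As q increases to 1 the regions of [integral_logdist_region] exhaust the disk minus the circle
    |w| = a. Monotone convergence applies to both sides, and the circle is null. *)
Lemma integral_logdist_disk (t : R) : t <= 2 ->
  (\int[mu2]_w (if norm2 R w <= t then ln 4 - logdist R a 0 w else 0)%:E =
   \int[mu2]_w (if norm2 R w <= t then ln 4 - ln (Num.max a (norm2 R w)) else 0)%:E)%E.
Proof.
move=> t2; have mn := @measurable_norm2 R.
have ml := measurable_logdist R a 0; have mx := measurable_logmax.
(* The offset 2 makes q k positive from k = 0 on. *)
pose q k : R := 1 - (k.+2)%:R^-1.
have q01 k : 0 < q k < 1.
  rewrite /q subr_gt0 invf_lt1 ?ltr1n ?ltr0n//= ltrBlDr ltrDl invr_gt0 ltr0n//.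
pose e k r := (r <= t) && ((r <= q k * a) || (a <= q k * r)).
pose D k := [set w | e k (norm2 R w)].
have me k : measurable_fun setT (e k) by rewrite /e; mfun_tac.
have eq_k k : (\int[mu2]_(w in D k) (ln 4 - logdist R a 0 w)%:E =
    \int[mu2]_(w in D k) (ln 4 - ln (Num.max a (norm2 R w)))%:E)%E.
  have bD w : D k w <-> e k (norm2 R w) by split.
  rewrite -(integral_if_plane _ _ _ (fun w => ln 4 - logdist R a 0 w) bD).
  rewrite -(integral_if_plane _ _ _ (fun w => ln 4 - ln (Num.max a (norm2 R w))) bD).
  apply: (integral_logdist_region _ a a0 a2 _ (q k)) => //.
  by move=> r /andP[rt ->]; split => //; exact: le_trans t2.
have mD k : measurable (D k).
  rewrite -[X in measurable X]setTI.
  rewrite (_ : D k = (fun w => e k (norm2 R w)) @^-1` [set true])//.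
  have mb : measurable_fun setT (fun w => e k (norm2 R w)).
    by apply: measurableT_comp; [exact: me|exact: mn].
  exact: mb.
have ndD : nondecreasing_seq D.
  move=> m n mn'; rewrite subsetEset => w /= /andP[wt h].
  have qmn : q m <= q n.
    by rewrite /q lerD2l lerN2 lef_pV2 ?posrE ?ltr0n// ler_nat !ltnS.
  rewrite /D /= /e wt /=; case/orP: h => h; apply/orP; [left|right].
    by apply: (le_trans h); rewrite ler_pM2r.
  by apply: (le_trans h); rewrite ler_wpM2r// norm2_ge0.
have mf1 : measurable_fun setT (fun w : R * R => (ln 4 - logdist R a 0 w)%:E) by mfun_tac.
have mf2 : measurable_fun setT (fun w : R * R => (ln 4 - ln (Num.max a (norm2 R w)))%:E).
  by mfun_tac.
have pos1 w : norm2 R w <= t -> (0 <= (ln 4 - logdist R a 0 w)%:E)%E.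
  by move=> wt; rewrite lee_fin subr_ge0 logdist_le// (le_trans wt).
have pos2 w : norm2 R w <= t -> (0 <= (ln 4 - ln (Num.max a (norm2 R w)))%:E)%E.
  by move=> wt; rewrite lee_fin subr_ge0 logmax_le// (le_trans wt).
have c1 : (\int[mu2]_(w in D k) (ln 4 - logdist R a 0 w)%:E @[k --> \oo] -->
    \int[mu2]_(w in \bigcup_k D k) (ln 4 - logdist R a 0 w)%:E)%E.
  apply: ge0_nondecreasing_set_cvg_integral => //.
    by move=> k; exact: measurable_funTS.
  by move=> k w /= /andP[wt _]; exact: pos1.
have c2 : (\int[mu2]_(w in D k) (ln 4 - ln (Num.max a (norm2 R w)))%:E @[k --> \oo] -->
    \int[mu2]_(w in \bigcup_k D k) (ln 4 - ln (Num.max a (norm2 R w)))%:E)%E.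
  apply: ge0_nondecreasing_set_cvg_integral => //.
    by move=> k; exact: measurable_funTS.
  by move=> k w /= /andP[wt _]; exact: pos2.
pose E := [set w | norm2 R w <= t].
pose N := [set w | norm2 R w = a].
have mE : measurable E.
  rewrite -[X in measurable X]setTI.
  have mb : measurable_fun setT (fun w : R * R => norm2 R w <= t) by mfun_tac.
  rewrite (_ : E = (fun w => norm2 R w <= t) @^-1` [set true])//.
  exact: mb.
have mN : measurable N.
  rewrite -[X in measurable X]setTI (_ : N = norm2 R @^-1` [set a])//.
  exact: mn.
have UD : \bigcup_k D k = E `\` N.
  apply/seteqP; split => w /=.
    move=> [k _ /andP[wt h]]; split => // wa; have /andP[q0 q1] := q01 k.
    by move: h; rewrite wa; apply/negP; rewrite negb_or -!ltNge gtr_pMl ?q1.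
  move=> [wt wa].
  have qk (x : R) : x < 1 -> exists k, x <= q k.
    move=> x1; have d0 : 0 <= (1 - x)^-1 by rewrite invr_ge0; lra.
    exists (Num.bound (1 - x)^-1); rewrite /q; have := archi_boundP d0.
    set M := Num.bound _ => hM.
    have : (M.+2)%:R^-1 <= 1 - x.
      rewrite -[leRHS]invrK lef_pV2 ?posrE ?invr_gt0 ?ltr0n//; last by lra.
      by rewrite (le_trans (ltW hM))// ler_nat -addn2 leq_addr.
    by rewrite lerBrDl -lerBrDr.
  have [lt|gt|//] := ltgtP (norm2 R w) a.
    have [k hk] : exists k, norm2 R w / a <= q k by apply: qk; rewrite ltr_pdivrMr// mul1r.
    by exists k => //; rewrite /D /= /e wt -ler_pdivrMr// hk.
  have r0 : 0 < norm2 R w := lt_trans a0 gt.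
  have [k hk] : exists k, a / norm2 R w <= q k by apply: qk; rewrite ltr_pdivrMr// mul1r.
  have hk' : a <= q k * norm2 R w by rewrite -ler_pdivrMr.
  by exists k => //; rewrite /D /= /e wt hk' orbT.
rewrite !(@integral_if_plane _ E)//.
rewrite (@ge0_negligible_integral _ _ _ mu2 E N)//; last 2 first.
- exact: measurable_funTS.
- exact: circle_null.
rewrite [RHS](@ge0_negligible_integral _ _ _ mu2 E N)//; last 2 first.
- exact: measurable_funTS.
- exact: circle_null.
by rewrite -UD; rewrite (funext eq_k) in c1; exact: (cvg_unique _ c1 c2).
Qed.

(** 1/pi times the integral of ln max(a, |w|) over |w| <= t, that is the integral of 2 r ln max(a,
    r) for 0 < r < t. *)
Definition disk_potential (t : R) : R :=
  if t <= a then t ^+ 2 * ln a else t ^+ 2 * ln t - (t ^+ 2 - a ^+ 2) / 2.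

(** For t > a, ln t - ln max(a, |w|) is the integral of 1/s over max(a, |w|) < s < t. Exchanging s
    and w leaves areas of disks, so the area formula stands in for polar coordinates. *)
Lemma integral_logmax_disk (t : R) : 0 < t -> t <= 2 ->
  (\int[mu2]_w (if norm2 R w <= t then ln 4 - ln (Num.max a (norm2 R w)) else 0)%:E =
   (pi * (t ^+ 2 * ln 4 - disk_potential t))%:E)%E.
Proof.
move=> t0 t2; have mn := @measurable_norm2 R.
have mnt : measurable_fun setT (fun w : R * R => (if norm2 R w <= t then 1 else 0)%:E : \bar R).
  by mfun_tac.
have cst_disk (c : R) : 0 <= c ->
    (\int[mu2]_w (if norm2 R w <= t then c else 0)%:E = (pi * (t ^+ 2 * c))%:E)%E.
  move=> c0; transitivity (c%:E * \int[mu2]_w (if norm2 R w <= t then 1 else 0)%:E)%E.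
    rewrite -ge0_integralZl_EFin//.
    - by apply: eq_integral => w _; case: ifP; rewrite -EFinM ?mulr1 ?mulr0.
    - by move=> w _; rewrite lee_fin; case: ifP.
  by rewrite area_disk// -EFinM; congr (_%:E); ring.
have t4 : t <= 4 by apply: (le_trans t2); rewrite ler_nat.
have a4 : a <= 4 by apply: (le_trans a2); rewrite ler_nat.
rewrite /disk_potential; case: ifPn => [ta|].
  transitivity (\int[mu2]_w (if norm2 R w <= t then ln 4 - ln a else 0)%:E)%E.
    apply: eq_integral => w _; case: ifP => // wt; congr (_ - ln _)%:E.
    by apply/max_idPl; exact: le_trans ta.
  by rewrite cst_disk ?subr_ge0 ?ler_ln ?posrE//; congr (_%:E); ring.
rewrite -ltNge => at_.
have FTC_ln (x : R) : 0 < x -> x <= t ->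
    (\int[mu]_(s in `]x, t[) (s^-1)%:E = (ln t - ln x)%:E)%E.
  move=> x0; rewrite le_eqVlt => /predU1P[->|xt].
    by rewrite set_itvoo0 integral_set0 subrr.
  apply: (@ge0_FTC_oo _ _ (@ln R)) => //.
  - by move=> s /andP[h _]; rewrite invr_ge0 ltW// (lt_trans x0).
  - by move=> s /andP[h _]; apply: inv_continuous; rewrite gt_eqF// (lt_trans x0).
  - by move=> s /andP[h _]; apply: is_derive1_ln; exact: lt_trans h.
  - by apply: cvg_at_right_filter; exact: continuous_ln.
  - by apply: cvg_at_left_filter; exact: continuous_ln.
pose b w s := (a < s) && (norm2 R w <= s) && (s < t).
have pos w s : 0 <= (if b w s then s^-1 else 0).
  by case: ifP => // /andP[/andP[h _] _]; rewrite invr_ge0 ltW// (lt_trans a0).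
have ms : measurable_fun setT (fun z : (R * R) * R => (if b z.1 z.2 then z.2^-1 else 0)%:E).
  by rewrite /b; mfun_tac.
transitivity (\int[mu2]_w ((if norm2 R w <= t then ln 4 - ln t else 0)%:E +
   \int[mu]_s (if b w s then s^-1 else 0)%:E))%E.
  apply: eq_integral => w _; case: ifPn => /= wt; last first.
    rewrite integral_pred0 ?adde0// => s; rewrite /b; move: wt; rewrite -ltNge => wt.
    by apply/negP => /andP[/andP[_ h1] h2]; lra.
  have [ra|ra] := leP (norm2 R w) a.
    rewrite (@integral_if _ `]a, t[%classic); last first.
      move=> s; rewrite /b /= in_itv /=; split => [/andP[h1 h2]|/andP[/andP[h1 _] h2]].
        by rewrite h1 h2 (le_trans ra (ltW h1)).
      by rewrite h1 h2.
    by rewrite FTC_ln ?ltW// -EFinD; congr (_%:E); ring.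
  rewrite (@integral_if _ `[norm2 R w, t[%classic); last first.
    move=> s; rewrite /b /= in_itv /=; split => [/andP[h1 h2]|/andP[/andP[_ h1] h2]].
      by rewrite h1 h2 (lt_le_trans ra h1).
    by rewrite h1 h2.
  rewrite -integral_itv_obnd_cbnd; last first.
    have mi : measurable_fun setT (fun s : R => (s^-1)%:E) by mfun_tac.
    exact: (measurable_funTS mi).
  by rewrite FTC_ln ?(lt_trans a0)// -EFinD; congr (_%:E); ring.
have mst : measurable_fun setT (fun w : R * R => \int[mu]_s (if b w s then s^-1 else 0)%:E)%E.
  have ms0 (z : (R * R) * R) : (0 <= (if b z.1 z.2 then z.2^-1 else 0)%:E)%E.
    by rewrite lee_fin.
  exact: (@measurable_fun_fubini_tonelli_F _ _ _ _ _ mu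
    (fun z => (if b z.1 z.2 then z.2^-1 else 0)%:E) ms ms0).
have mc : measurable_fun setT (fun w : R * R => (if norm2 R w <= t then ln 4 - ln t else 0)%:E).
  by mfun_tac.
have ln4t : 0 <= ln 4 - ln t by rewrite subr_ge0 ler_ln ?posrE.
have cp w : setT w -> (0 <= (if norm2 R w <= t then ln 4 - ln t else 0)%:E)%E.
  by rewrite lee_fin; case: ifP.
have ip w : setT w -> (0 <= \int[mu]_s (if b w s then s^-1 else 0)%:E)%E.
  by move=> _; apply: integral_ge0 => s _; rewrite lee_fin.
rewrite (ge0_integralD mu2 measurableT cp mc ip mst) cst_disk//.
rewrite (tonelli_plane_line _ (fun z => (if b z.1 z.2 then z.2^-1 else 0)%:E) ms); last first.
  by move=> z; rewrite lee_fin.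
transitivity ((pi * (t ^+ 2 * (ln 4 - ln t)))%:E +
   \int[mu]_s (if (a < s) && (s < t) then pi * s else 0)%:E)%E.
  congr (_ + _)%E; apply: eq_integral => s _ /=.
  case: ifPn => [/andP[as_ st]|h]; last first.
    apply: integral0_eq => w _; case: ifP => // /andP[/andP[h1 _] h2].
    by rewrite h1 h2 in h.
  have s0 : 0 < s := lt_trans a0 as_.
  transitivity ((s^-1)%:E * \int[mu2]_w (if norm2 R w <= s then 1 else 0)%:E)%E.
    rewrite -ge0_integralZl_EFin//.
    - apply: eq_integral => w _; rewrite /b as_ st andbT /=.
      by case: ifP; rewrite -EFinM ?mulr1 ?mulr0.
    - by move=> w _; rewrite lee_fin; case: ifP.
    - by mfun_tac.
    - by rewrite invr_ge0 ltW.
  rewrite area_disk// -EFinM; congr (_%:E); field; exact: lt0r_neq0.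
rewrite (@integral_if _ `]a, t[%classic)//.
have cP (x : R) : {for x, continuous (fun s : R => pi * (s ^+ 2 / 2))} by cont_tac.
have -> : (\int[mu]_(x in `]a, t[) (pi * x)%:E = (pi * (t ^+ 2 / 2) - pi * (a ^+ 2 / 2))%:E)%E.
  apply: (@ge0_FTC_oo _ _ (fun s => pi * (s ^+ 2 / 2))) => //.
  - by move=> x /andP[h _]; rewrite mulr_ge0 ?pi_ge0// ltW// (lt_trans a0).
  - by move=> x _; exact: mulrl_continuous.
  - by move=> x _; derive_eq => /=; field.
  - by apply: cvg_at_right_filter; exact: cP.
  - by apply: cvg_at_left_filter; exact: cP.
by rewrite -EFinD; congr (_%:E); field.
Qed.

End RadialPotential.

(** * Catalan's constant *)

Section Catalan.
Variable R : realType.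
Notation mu := (@lebesgue_measure R).
Implicit Types (x y : R) (N : nat).

(** Multiplied by cos x the sum telescopes, by 2 sin(2(k+1)x) cos x = sin((2k+3)x) +
    sin((2k+1)x). *)
Lemma tan_fourier N x : cos x != 0 ->
  sin x / cos x = 2 * (\sum_(k < N) (-1) ^+ k * sin (2 * k.+1%:R * x)) +
    (-1) ^+ N * sin ((2 * N%:R + 1) * x) / cos x.
Proof.
move=> c0; elim: N => [|N IH].
  have -> : (2 * 0%:R + 1) * x = x by ring.
  by rewrite big_ord0 expr0 mulr0 add0r mul1r.
rewrite big_ord_recr /= IH exprS.
have -> : (2 * N.+1%:R + 1) * x = 2 * N.+1%:R * x + x by ring.
have -> : (2 * N%:R + 1) * x = 2 * N.+1%:R * x - x by rewrite -natr1; ring.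
by rewrite sinB sinD; field.
Qed.

Definition fourier_prim N y : R :=
  \sum_(k < N) (-1) ^+ k * (- (y * cos (2 * k.+1%:R * y)) / k.+1%:R
                            + sin (2 * k.+1%:R * y) / (2 * k.+1%:R ^+ 2)).

Lemma is_derive_fourier_prim N x : is_derive x 1 (fourier_prim N)
  (x * (2 * (\sum_(k < N) (-1) ^+ k * sin (2 * k.+1%:R * x)))).
Proof.
elim: N => [|N IH].
  rewrite (_ : fourier_prim 0 = fun=> 0); last by apply/funext => y; rewrite /fourier_prim big_ord0.
  by rewrite big_ord0 !mulr0; exact: derive_cst.
rewrite (_ : fourier_prim N.+1 = fun y => fourier_prim N y + (-1) ^+ N *
   (- (y * cos (2 * N.+1%:R * y)) / N.+1%:R + sin (2 * N.+1%:R * y) / (2 * N.+1%:R ^+ 2))); last first.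
  by apply/funext => y; rewrite /fourier_prim big_ord_recr.
have n0 : N.+1%:R != 0 :> R by rewrite pnatr_eq0.
rewrite big_ord_recr /=; set n := N.+1%:R in n0 *.
notypeclasses refine (@is_derive_eq _ _ _ _ _ _ _ _ _ _).
  notypeclasses refine (@derive_add _ _ _ _ _ _ IH _).
  by derive_tac.
by move: ((-1) ^+ N) => e; field; rewrite ?n0.
Qed.

Lemma continuous_fourier_prim N x : {for x, continuous (fourier_prim N)}.
Proof. exact: (is_derive_continuous _ _ _ _ (is_derive_fourier_prim N x)). Qed.

Lemma cos_gt0_quarter x : 0 <= x <= pi / 4 -> 0 < cos x.
Proof.
move=> /andP[x0 x4]; apply: cos_gt0_pihalf; have := pi_gt0 R; lra.
Qed.

Lemma sin_ge0_quarter x : 0 <= x <= pi / 4 -> 0 <= sin x.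
Proof. by move=> /andP[x0 x4]; apply: sin_ge0_pi; have := pi_gt0 R; lra. Qed.

Let g y : R := y / cos y.
Let dg y : R := (cos y + y * sin y) / cos y ^+ 2.
Let xtan y : R := y * (sin y / cos y).
(** With M = 2N + 1, the remainder (-1)^N sin(M y) g(y) is integrated by parts with the primitive (1
    - (-1)^N cos(M y)) / M of its oscillating factor. The constant 1 makes that primitive, hence
    [err], nonnegative and gives the bound 2/M. *)
Let err N y : R := (1 - (-1) ^+ N * cos ((2 * N%:R + 1) * y)) * (dg y / (2 * N%:R + 1)).
Let prim N y : R := fourier_prim N y + (1 - (-1) ^+ N * cos ((2 * N%:R + 1) * y)) * (g y / (2 * N%:R + 1)).

Let M0 N : 0 < 2 * N%:R + 1 :> R.
Proof. by rewrite ltr_pwDr// mulr_ge0. Qed.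

Let dg_ge0 y : 0 <= y <= pi / 4 -> 0 <= dg y.
Proof.
move=> hy; have c0 := cos_gt0_quarter _ hy; have s0 := sin_ge0_quarter _ hy.
by rewrite divr_ge0 ?exprn_ge0 ?addr_ge0 ?mulr_ge0 ?(ltW c0)//; case/andP: hy.
Qed.

Let sgn_bound N y : 0 <= 1 - (-1) ^+ N * cos ((2 * N%:R + 1) * y) <= 2.
Proof.
have : `|(-1) ^+ N * cos ((2 * N%:R + 1) * y)| <= 1.
  by rewrite normrM normrX normrN1 expr1n mul1r ler_norml cos_geN1 cos_le1.
by rewrite ler_norml; lra.
Qed.

Let err_ge0 N y : 0 <= y <= pi / 4 -> 0 <= err N y.
Proof.
move=> hy; have /andP[h _] := sgn_bound N y.
by rewrite mulr_ge0// divr_ge0 ?dg_ge0// ltW.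
Qed.

Let xtan_ge0 y : 0 <= y <= pi / 4 -> 0 <= xtan y.
Proof.
move=> hy; have c0 := cos_gt0_quarter _ hy; have s0 := sin_ge0_quarter _ hy.
by rewrite mulr_ge0 ?divr_ge0 ?(ltW c0)//; case/andP: hy.
Qed.

Let quarter y : 0 < y < pi / 4 -> 0 <= y <= pi / 4.
Proof. by move=> /andP[h1 h2]; rewrite !ltW. Qed.

Let cos_neq0 y : 0 < y < pi / 4 -> cos y != 0.
Proof. by move=> /quarter/cos_gt0_quarter/lt0r_neq0. Qed.

Let pi40 : 0 < pi / 4 :> R. Proof. by rewrite divr_gt0 ?pi_gt0. Qed.

Let c4 : cos (pi / 4) != 0 :> R.
Proof. by rewrite lt0r_neq0// cos_gt0_quarter// lexx ltW. Qed.

Let cont_g y : cos y != 0 -> {for y, continuous g}.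
Proof. by move=> c0; rewrite /g; cont_tac. Qed.

Let cont_prim N y : cos y != 0 -> {for y, continuous (prim N)}.
Proof.
move=> c0; rewrite /prim /g; apply: cont_add; first exact: continuous_fourier_prim.
by cont_tac.
Qed.

Lemma integral_xtan_err N :
  (\int[mu]_(y in `]0%R, (pi / 4)%R[) (xtan y + err N y)%:E = (prim N (pi / 4))%:E)%E.
Proof.
have f0 : prim N 0 = 0.
  rewrite /prim /g mul0r mul0r mulr0 addr0 /fourier_prim big1// => i _.
  by rewrite mulr0 sin0 !mul0r oppr0 mul0r addr0 mulr0.
have -> : prim N (pi / 4) = prim N (pi / 4) - prim N 0 by rewrite f0 subr0.
apply: (@ge0_FTC_oo _ _ (prim N)) => //.
- by move=> y /quarter hy; rewrite addr_ge0 ?xtan_ge0 ?err_ge0.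
- move=> y /cos_neq0 c0; rewrite /xtan /err /dg; cont_tac => //.
  by rewrite expf_neq0.
- move=> y /cos_neq0 c0; rewrite /prim /g.
  notypeclasses refine (@is_derive_eq _ _ _ _ _ _ _ _ _ _).
    notypeclasses refine (@derive_add _ _ _ _ _ _ (is_derive_fourier_prim N y) _).
    by derive_tac.
  rewrite /xtan /err /dg (tan_fourier N)//.
  have m0 := lt0r_neq0 (M0 N); set M := 2 * N%:R + 1 in m0 *.
  move: ((-1) ^+ N) (\sum_(k < N) _) => e s.
  by field; rewrite c0 m0.
- by apply: cvg_at_right_filter; apply: cont_prim; rewrite cos0 oner_eq0.
- by apply: cvg_at_left_filter; exact: cont_prim.
Qed.

Lemma integral_dg : (\int[mu]_(y in `]0%R, (pi / 4)%R[) (dg y)%:E = (g (pi / 4))%:E)%E.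
Proof.
have -> : g (pi / 4) = g (pi / 4) - g 0 by rewrite /g mul0r subr0.
apply: (@ge0_FTC_oo _ _ g) => //.
- by move=> y /quarter/dg_ge0.
- move=> y /cos_neq0 c0; rewrite /dg; cont_tac.
  by rewrite expf_neq0.
- move=> y /cos_neq0 c0; rewrite /g /dg; derive_eq => //.
  by rewrite /=; field.
- by apply: cvg_at_right_filter; apply: cont_g; rewrite cos0 oner_eq0.
- by apply: cvg_at_left_filter; exact: cont_g.
Qed.

Let mcos : measurable_fun setT (@cos R).
Proof. by apply: continuous_measurable_fun; exact: continuous_cos. Qed.
Let msin : measurable_fun setT (@sin R).
Proof. by apply: continuous_measurable_fun; exact: continuous_sin. Qed.

Let mdg : measurable_fun setT dg.
Proof. by rewrite /dg; have := mcos; have := msin => ? ?; mfun_tac. Qed.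
Let mxtan : measurable_fun setT xtan.
Proof. by rewrite /xtan; have := mcos; have := msin => ? ?; mfun_tac. Qed.
Let merr N : measurable_fun setT (err N).
Proof. by rewrite /err; have := mcos; have := mdg => ? ?; mfun_tac. Qed.

(** The oscillating factor lies between 0 and 2, and [dg] is the derivative of [g], which gives an
    error O(1/N). *)
Lemma integral_err N :
  (\int[mu]_(y in `]0%R, (pi / 4)%R[) (err N y)%:E <= (2 * g (pi / 4) / (2 * N%:R + 1))%:E)%E.
Proof.
have -> : ((2 * g (pi / 4) / (2 * N%:R + 1))%:E =
   (2 / (2 * N%:R + 1))%:E * \int[mu]_(y in `]0%R, (pi / 4)%R[) (dg y)%:E)%E.
  by rewrite integral_dg -EFinM mulrAC.
have m1 : measurable_fun `]0%R, (pi / 4)%R[ (fun y : R => (dg y)%:E).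
  by apply: measurable_funTS; apply/measurable_EFinP; exact: mdg.
rewrite -ge0_integralZl_EFin//; last first.
  by move=> y; rewrite /= in_itv/= lee_fin => /quarter/dg_ge0.
apply: ge0_le_integral => //.
- by move=> y; rewrite /= in_itv/= lee_fin => /quarter/err_ge0.
- by apply: measurable_funTS; apply/measurable_EFinP; exact: merr.
- by apply: emeasurable_funM => //; exact: measurable_cst.
- move=> y; rewrite /= in_itv/= -EFinM lee_fin => /quarter hy.
  rewrite /err [leRHS]mulrAC -mulrA; have /andP[_ h] := sgn_bound N y.
  by rewrite ler_wpM2r// divr_ge0 ?dg_ge0// ltW.
Qed.

Definition xtan_integral : R := fine (\int[mu]_(y in `]0%R, (pi / 4)%R[) (y * (sin y / cos y))%:E).

Lemma prim_bounds N : exists e : R, 0 <= e <= 2 * g (pi / 4) / (2 * N%:R + 1) /\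
  (\int[mu]_(y in `]0%R, (pi / 4)%R[) (xtan y)%:E = xtan_integral%:E)%E /\
  prim N (pi / 4) = xtan_integral + e.
Proof.
have D : (\int[mu]_(y in `]0%R, (pi / 4)%R[) (xtan y)%:E +
    \int[mu]_(y in `]0%R, (pi / 4)%R[) (err N y)%:E = (prim N (pi / 4))%:E)%E.
  rewrite -integral_xtan_err -ge0_integralD//.
  - by move=> y; rewrite /= in_itv/= lee_fin => /quarter/xtan_ge0.
  - by apply: measurable_funTS; apply/measurable_EFinP; exact: mxtan.
  - by move=> y; rewrite /= in_itv/= lee_fin => /quarter/err_ge0.
  - by apply: measurable_funTS; apply/measurable_EFinP; exact: merr.
have i1 : (0 <= \int[mu]_(y in `]0%R, (pi / 4)%R[) (xtan y)%:E)%E.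
  by apply: integral_ge0 => y; rewrite /= in_itv/= lee_fin => /quarter/xtan_ge0.
have i2 : (0 <= \int[mu]_(y in `]0%R, (pi / 4)%R[) (err N y)%:E)%E.
  by apply: integral_ge0 => y; rewrite /= in_itv/= lee_fin => /quarter/err_ge0.
have i3 := integral_err N.
move: D i1 i2 i3; rewrite /xtan_integral -/(xtan _).
(* Two nonnegative integrals with a finite sum are finite; this is where the integral of y tan y is
   seen to be finite. *)
case: (\int[mu]_(y in `]0%R, (pi / 4)%R[) (err N y)%:E)%E => [e||]//.
case: (\int[mu]_(y in `]0%R, (pi / 4)%R[) (xtan y)%:E)%E => [s||]//.
rewrite -EFinD => -[<-] _; rewrite !lee_fin => e0 e1.
by exists e; rewrite e0 e1.
Qed.

Lemma integral_xtan : (\int[mu]_(y in `]0%R, (pi / 4)%R[) (y * (sin y / cos y))%:E = xtan_integral%:E)%E.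
Proof. by have [e [_ [h _]]] := prim_bounds 0. Qed.

(** For e = 1 and e = -1 the function [h e] vanishes at 0 and has derivative y^m + e (-y)^m / (1 +
    y) >= 0 on ]0, 1[. Its two values at 1 are the two halves of the bound. *)
Lemma alternating_harmonic_bound m :
  `|ln 2 - \sum_(k < m) (-1) ^+ k / k.+1%:R| <= (m.+1%:R)^-1 :> R.
Proof.
pose h (e : R) y : R := y ^+ m.+1 / m.+1%:R +
  e * (ln (1 + y) - \sum_(k < m) (-1) ^+ k * y ^+ k.+1 / k.+1%:R).
have dS (n : nat) y : 1 + y != 0 -> is_derive y 1 (fun y => \sum_(k < n) (-1) ^+ k * y ^+ k.+1 / k.+1%:R)
    ((1 - (- y) ^+ n) / (1 + y)).
  move=> y1; elim: n => [|n IH].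
    rewrite (_ : (fun y => _) = fun=> 0); last by apply/funext => z; rewrite big_ord0.
    by rewrite expr0 subrr mul0r; exact: derive_cst.
  rewrite (_ : (fun y => _) = fun y => \sum_(k < n) (-1) ^+ k * y ^+ k.+1 / k.+1%:R +
     (-1) ^+ n * y ^+ n.+1 / n.+1%:R); last by apply/funext => z; rewrite big_ord_recr.
  have n0 : n.+1%:R != 0 :> R by rewrite pnatr_eq0.
  notypeclasses refine (@is_derive_eq _ _ _ _ _ _ _ _ _ _).
    notypeclasses refine (@derive_add _ _ _ _ _ _ IH _).
    by derive_tac.
  rewrite /= !exprS -[- y]mulN1r exprMn; set p := y ^+ n; set q := (-1) ^+ n.
  move: (n.+1%:R) n0 => M n0; field; by rewrite ?n0 ?y1.
have d0 (e : R) y : 0 <= y -> is_derive y 1 (h e)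
    (y ^+ m + e * ((- y) ^+ m / (1 + y))).
  move=> y0; have y1 : 0 < 1 + y by lra.
  have n0 : m.+1%:R != 0 :> R by rewrite pnatr_eq0.
  notypeclasses refine (@is_derive_eq _ _ _ _ _ _ _ _ _ _).
    notypeclasses refine (@derive_add _ _ _ _ _ _ _ _); first by derive_tac.
    notypeclasses refine (@derive_mul _ _ _ _ _ _ (derive_cst _ _ _) _).
    notypeclasses refine (@derive_add _ _ _ _ _ _ _ _); first by derive_tac.
    by notypeclasses refine (@derive_opp _ _ _ _ (dS _ _ _)); exact: lt0r_neq0.
  rewrite /=; set p := y ^+ m; set q := (- y) ^+ m.
  move: (m.+1%:R) n0 => M n0; field; by rewrite ?n0 ?lt0r_neq0.
have key (e : R) : `|e| = 1 -> h e 0 <= h e 1.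
  move=> e1; apply: (@ger0_derive1_le_cc _ (h e) 0 1) => //.
  - by move=> y; rewrite in_itv/= => /andP[y0 _]; exact: (@ex_derive _ _ _ _ _ _ _ (d0 e y (ltW y0))).
  - move=> y; rewrite in_itv/= => /andP[y0 _].
    rewrite derive1E (@derive_val _ _ _ _ _ _ _ (d0 e y (ltW y0))).
    have : `|e * ((- y) ^+ m / (1 + y))| <= y ^+ m.
      rewrite normrM e1 mul1r normrM normrX normrN (gtr0_norm y0).
      rewrite ler_piMr ?exprn_ge0 ?(ltW y0)// normfV gtr0_norm ?invf_le1; lra.
    by rewrite ler_norml; lra.
  - apply: derivable_within_continuous => y; rewrite in_itv/= => /andP[y0 _].
    exact: (@ex_derive _ _ _ _ _ _ _ (d0 e y y0)).
  - by rewrite in_itv/= lexx ler01.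
  - by rewrite in_itv/= lexx ler01.
have h00 e : h e 0 = 0.
  rewrite /h addr0 ln1 exprS !mul0r add0r big1 ?subr0 ?mulr0// => i _.
  by rewrite exprS !(mul0r, mulr0).
have h1 e : h e 1 = m.+1%:R^-1 + e * (ln 2 - \sum_(k < m) (-1) ^+ k / k.+1%:R).
  rewrite /h expr1n mul1r; congr (_ + _ * (ln _ - _)).
  by apply: eq_bigr => i _; rewrite expr1n mulr1.
rewrite ler_norml; have := key 1 (normr1 _); have := key (-1) (normrN1 _).
by rewrite !h00 !h1; move: (m.+1%:R^-1) => u; lra.
Qed.

Lemma cvg_harmonic_bound (u : nat -> R) (l C : R) :
  (forall n, `|u n - l| <= C * n.+1%:R^-1) -> u n @[n --> \oo] --> l.
Proof.
move=> h; apply/cvgrPdist_le => e e0.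
have cC : C * n.+1%:R^-1 @[n --> \oo] --> 0.
  by rewrite -[X in _ --> X](mulr0 C); apply: cvgMr; exact: cvg_harmonic.
near=> n; rewrite distrC; apply: (le_trans (h n)).
by near: n; exact: (cvgr_le 0 cC).
Unshelve. all: by end_near. Qed.

Lemma cos_sin_4n (q : nat) : cos ((q * 4)%:R * (pi / 2)) = 1 :> R /\ sin ((q * 4)%:R * (pi / 2)) = 0 :> R.
Proof.
elim: q => [|q [IHc IHs]]; first by rewrite mul0n mul0r cos0 sin0.
rewrite (_ : _ * _ = (q * 4)%:R * (pi / 2) + pi + pi); last by rewrite mulSn natrD; field.
by rewrite !cosDpi !sinDpi !opprK.
Qed.

(** sin(n pi/2) already is the character; the factor -(-1)^n equals 1 for odd n and is inserted to
    match the signs of the terms of [fourier_prim]. *)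
Lemma chi_m4_sin n : chi_m4 R n = - (-1) ^+ n * sin (n%:R * (pi / 2)).
Proof.
rewrite (divn_eq n 4); have := ltn_pmod n (isT : (0 < 4)%N).
set q := (n %/ 4)%N; set r := (n %% 4)%N => r4.
rewrite /chi_m4 modnMDl modn_mod -/r.
have [c s] := cos_sin_4n q.
rewrite natrD mulrDl sinD c s mul1r mul0r add0r exprD mulnC exprM.
rewrite (_ : (-1) ^+ 4 = 1 :> R); last by ring.
rewrite expr1n mul1r.
move: r r4 => [|[|[|[|//]]]] _ /=.
- by rewrite mul0r sin0 mulr0.
- by rewrite mul1r sin_pihalf mulr1 expr1 opprK.
- by rewrite (_ : 2 * (pi / 2) = pi); [rewrite sinpi mulr0|field].
- by rewrite (_ : 3 * (pi / 2) = pi / 2 + pi); [rewrite sinDpi sin_pihalf; ring|field].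
Qed.

Lemma cos_half_odd (m : nat) : cos ((m.*2.+1)%:R * (pi / 2)) = 0 :> R /\
  cos ((m.*2)%:R * (pi / 2)) = (-1) ^+ m :> R.
Proof.
elim: m => [|m [IH1 IH2]].
  by rewrite double0 mul0r cos0 mul1r cos_pihalf expr0.
have e1 : (m.+1.*2.+1)%:R * (pi / 2) = (m.*2.+1)%:R * (pi / 2) + pi :> R.
  by rewrite doubleS -(natr1 m.*2.+2) -(natr1 m.*2.+1); field.
have e2 : (m.+1.*2)%:R * (pi / 2) = (m.*2)%:R * (pi / 2) + pi :> R.
  by rewrite doubleS -(natr1 m.*2.+1) -(natr1 m.*2); field.
by rewrite e1 e2 !cosDpi IH1 IH2 oppr0 exprS mulN1r.
Qed.

(** The cosine part of [fourier_prim N] at pi/4 is pi/4 times this sum, while the sine part is half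
    a partial sum of L(chi_{-4}, 2). Only even indices contribute to [v], and they form -1/2 times
    the alternating harmonic series. *)
Let v N : R := \sum_(k < N) (-1) ^+ k.+1 * cos (k.+1%:R * (pi / 2)) / k.+1%:R.

Let v_even m : v m.*2 = - 2^-1 * \sum_(k < m) (-1) ^+ k / k.+1%:R.
Proof.
elim: m => [|m IH]; first by rewrite /v !big_ord0 mulr0.
rewrite /v doubleS 2!big_ord_recr /= -/(v _) IH.
rewrite (cos_half_odd m).1 mulr0 mul0r addr0 -doubleS (cos_half_odd m.+1).2.
rewrite big_ord_recr /= mulrDr; congr (_ + _).
have -> : (-1) ^+ m.+1.*2 = 1 :> R by rewrite -mul2n exprM sqrrN expr1n expr1n.
have -> : (m.+1.*2)%:R = 2 * m.+1%:R :> R by rewrite -mul2n natrM.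
have : m.+1%:R != 0 :> R by rewrite pnatr_eq0.
by rewrite exprS; move: (m.+1%:R) => K K0; field.
Qed.

Let v_bound N : `|v N + 2^-1 * ln 2| <= N.+1%:R^-1.
Proof.
have vE : v N = v (N./2).*2.
  rewrite -{1}(odd_double_half N); case: (odd N) => //=.
  by rewrite /v big_ord_recr /= (cos_half_odd _).1 mulr0 mul0r addr0.
rewrite vE v_even.
rewrite (_ : _ + _ = 2^-1 * (ln 2 - \sum_(k < N./2) (-1) ^+ k / k.+1%:R)); last by ring.
rewrite normrM gtr0_norm ?invr_gt0//.
apply: (@le_trans _ _ (2^-1 * (N./2.+1)%:R^-1)).
  by rewrite ler_pM2l ?invr_gt0//; exact: alternating_harmonic_bound.
rewrite -invfM -natrM lef_pV2 ?posrE ?ltr0n ?muln_gt0// ler_nat.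
by rewrite -{1}(odd_double_half N) mul2n doubleS; case: (odd N).
Qed.

Lemma L_chi_m4_2 : L_chi_m4 2 = 2 * xtan_integral + pi / 4 * ln 2.
Proof.
(* The sum over 1 <= n < N + 1 has N terms, as many as [fourier_prim N]. *)
apply: cvg_lim => //; rewrite -(cvg_shiftS _).
apply: (@cvg_harmonic_bound _ _ (2 * (2 * g (pi / 4) + pi / 4))) => N.
have g0 : 0 <= g (pi / 4).
  by rewrite /g divr_ge0 ?(ltW pi40)// ltW// cos_gt0_quarter// lexx ltW.
have uE : \sum_(1 <= n < N.+1) chi_m4 R n * n%:R `^ (- 2) =
    2 * (fourier_prim N (pi / 4) - pi / 4 * v N).
  rewrite big_add1 /= big_mkord /fourier_prim /v mulr_sumr -sumrB mulr_sumr.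
  apply: eq_bigr => k _; rewrite chi_m4_sin.
  have n0 : k.+1%:R != 0 :> R by rewrite pnatr_eq0.
  have -> : k.+1%:R `^ (- 2) = (k.+1%:R ^+ 2)^-1 :> R by rewrite powRN powR_mulrn// ler0n.
  have -> : 2 * k.+1%:R * (pi / 4) = k.+1%:R * (pi / 2) :> R by field.
  rewrite exprS; move: (k.+1%:R) n0 => K K0; by field.
have [e [/andP[e0 e1] [_ pE]]] := prim_bounds N.
have /andP[s0 s2] := sgn_bound N (pi / 4).
have fE : `|fourier_prim N (pi / 4) - xtan_integral| <= 2 * g (pi / 4) / (2 * N%:R + 1).
  have -> : fourier_prim N (pi / 4) = xtan_integral + e -
     (1 - (-1) ^+ N * cos ((2 * N%:R + 1) * (pi / 4))) * (g (pi / 4) / (2 * N%:R + 1)).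
    by rewrite -pE /prim; ring.
  set w := g (pi / 4) / (2 * N%:R + 1); have w0 : 0 <= w by rewrite divr_ge0// ltW.
  rewrite -mulrA -/w in e1 *.
  move: s0 s2; set sg := 1 - _ => s0 s2.
  rewrite ler_norml; apply/andP; split; nra.
rewrite [X in `|X - _|]uE.
rewrite (_ : _ - _ = 2 * ((fourier_prim N (pi / 4) - xtan_integral) - pi / 4 * (v N + 2^-1 * ln 2))); last by field.
rewrite normrM (ger0_norm (ler0n _ 2)) -[leRHS]mulrA ler_pM2l//.
apply: (le_trans (ler_normB _ _)); rewrite [leRHS]mulrDl lerD//.
  apply: (le_trans fE); apply: ler_wpM2l; first by rewrite mulr_ge0// ltW.
  have h : N.+1%:R <= 2 * N%:R + 1 :> R by rewrite -natr1 lerD2r ler_peMl// ler1n.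
  by rewrite lef_pV2// posrE ?ltr0n// (lt_le_trans _ h)// ltr0n.
by rewrite normrM gtr0_norm// ler_pM2l//; exact: v_bound.
Qed.

End Catalan.

(** * The areal Mahler measure *)

Section RadialIntegral.
Variable R : realType.
Notation mu := (@lebesgue_measure R).
Notation s2 := (Num.sqrt (2 : R)).

Lemma integral_cos_subst (G : R -> R) (al be : R) : 0 <= al -> al < be -> be <= pi ->
  (forall x, 2 * cos be <= x <= 2 * cos al -> {for x, continuous G}) ->
  (\int[mu]_(x in `[(2 * cos be)%R, (2 * cos al)%R]) (G x)%:E =
   \int[mu]_(x in `[al, be]) (G (2 * cos x) * (2 * sin x))%:E)%E.
Proof.
move=> a0 ab bpi cG; pose F y : R := 2 * cos y.
have dF (y : R) : is_derive y 1 F (- (2 * sin y)).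
  by rewrite /F; derive_eq => /=; ring.
have F'E : F^`()%classic = fun y => - (2 * sin y).
  by apply/funext => y; rewrite derive1E (@derive_val _ _ _ _ _ _ _ (dF y)).
have cF (y : R) : {for y, continuous F} by exact: (is_derive_continuous _ _ _ _ (dF y)).
have cF' (y : R) : {for y, continuous (F^`()%classic)} by rewrite F'E; cont_tac.
rewrite (@integration_by_substitution_decreasing _ F G al be (ltW ab)).
- by apply: eq_integral => y _; rewrite F'E /F /= fctE opprK.
- move=> x y; rewrite !in_itv/= => /andP[x1 x2] /andP[y1 y2] xy.
  rewrite /F ltr_pM2l// ltr_cos// in_itv/=.
    by rewrite (le_trans a0 y1) (le_trans y2 bpi).
  by rewrite (le_trans a0 x1) (le_trans x2 bpi).
- by move=> y _; exact: cF'.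
- by apply: cvgP; apply: cvg_at_right_filter; exact: cF'.
- by apply: cvgP; apply: cvg_at_left_filter; exact: cF'.
- split.
  + by move=> y _; exact: (@ex_derive _ _ _ _ _ _ _ (dF y)).
  + by apply: cvg_at_right_filter; exact: cF.
  + by apply: cvg_at_left_filter; exact: cF.
- by apply: continuous_in_subspaceT => x; rewrite inE /= in_itv /=; exact: cG.
Qed.

Lemma sqrt2_gt0 : 0 < s2. Proof. by rewrite sqrtr_gt0. Qed.

Lemma sqrt2_sqr : s2 ^+ 2 = 2. Proof. by rewrite sqr_sqrtr. Qed.

Lemma sqrt2_lt2 : s2 < 2.
Proof. by have := sqrt2_gt0; have := sqrt2_sqr; nra. Qed.

Lemma cos_quarter : 2 * cos (pi / 4) = s2 :> R.
Proof.
have c0 : 0 < cos (pi / 4) :> R.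
  by apply: cos_gt0_quarter; rewrite lexx divr_ge0// pi_ge0.
have : cos (pi / 4 + pi / 4) = 0 :> R.
  by rewrite (_ : pi / 4 + pi / 4 = pi / 2) ?cos_pihalf//; field.
rewrite cosD -!expr2 sin2cos2 => h.
have h2 : (2 * cos (pi / 4)) ^+ 2 = s2 ^+ 2 :> R by rewrite sqrt2_sqr exprMn; lra.
apply/eqP; rewrite -(@eqrXn2 _ 2)//; [exact/eqP|by rewrite mulr_ge0// ltW].
Qed.

Lemma ln_sqrt2 : ln s2 = ln 2 / 2 :> R.
Proof.
have : ln (s2 ^+ 2) = ln 2 by rewrite sqrt2_sqr.
by rewrite lnXn ?sqrt2_gt0// -mulr_natr; lra.
Qed.

Lemma ln2_ge0 : 0 <= ln 2 :> R.
Proof. by apply: ln_ge0; rewrite ler1n. Qed.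

Lemma ln4 : ln 4 = 2 * ln 2 :> R.
Proof.
rewrite (_ : 4 = 2 ^+ 2); last by ring.
by rewrite lnXn// mulr_natl.
Qed.

Lemma sqrt_cos x : 0 <= sin x -> Num.sqrt (4 - (2 * cos x) ^+ 2) = 2 * sin x :> R.
Proof.
move=> s0; rewrite (_ : _ - _ = (2 * sin x) ^+ 2).
  by rewrite sqrtr_sqr ger0_norm// mulr_ge0.
by have := cos2Dsin2 x; rewrite !exprMn; lra.
Qed.

Let K : R := ln 4 - ln s2.
(** [G1] and [G2] are the radial integrand below and above t = sqrt 2, where [disk_potential]
    changes formula; a^2 = 2 is already inserted in [G2]. *)
Let G1 (t : R) : R := Num.sqrt (4 - t ^+ 2) * (pi * (t ^+ 2 * K)).
Let G2 (t : R) : R := Num.sqrt (4 - t ^+ 2) *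
  (pi * (t ^+ 2 * (ln 4 - ln t) + (t ^+ 2 - 2) / 2)).

Let pi4 : 0 < pi / 4 :> R. Proof. by rewrite divr_gt0// pi_gt0. Qed.
Let pi42 : pi / 4 < pi / 2 :> R. Proof. by have := pi_gt0 R; lra. Qed.
Let pi21 : pi / 2 <= pi :> R. Proof. by have := pi_gt0 R; lra. Qed.

Lemma inner_disk_part :
  (\int[mu]_(t in `[0%R, s2]) (G1 t)%:E = (3 / 4 * pi ^+ 2 * ln 2)%:E)%E.
Proof.
have -> : 0 = 2 * cos (pi / 2) :> R by rewrite cos_pihalf mulr0.
rewrite -cos_quarter integral_cos_subst//; last first.
- by move=> x _; rewrite /G1; cont_tac.
- exact: ltW.
have cp (x : R) : {for x, continuous (fun y => G1 (2 * cos y) * (2 * sin y))}.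
  by rewrite /G1; cont_tac.
rewrite integral_itv_bndoo; last first.
  apply: measurable_funTS; apply/measurable_EFinP; apply: continuous_measurable_fun => x.
  exact: cp.
(* At t = 2 cos y the integrand is 16 pi K sin^2 y cos^2 y = 2 pi K (1 - cos 4y). *)
pose F (y : R) : R := pi * K * (2 * y - sin (4 * y) / 2).
have cF (y : R) : {for y, continuous F} by rewrite /F; cont_tac.
have -> : 3 / 4 * pi ^+ 2 * ln 2 = F (pi / 2) - F (pi / 4).
  rewrite /F /K ln4 ln_sqrt2.
  have -> : 4 * (pi / 2) = pi + pi :> R by field.
  have -> : 4 * (pi / 4) = pi :> R by field.
  by rewrite sinDpi sinpi; field.
have sc (x : R) : pi / 4 < x < pi / 2 -> 0 < sin x.
  by move=> /andP[h1 h2]; apply: sin_gt0_pi; have := pi_gt0 R; lra.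
apply: (@ge0_FTC_oo _ _ F) => //.
- move=> x /sc s0; have K0 : 0 <= K by rewrite /K ln4 ln_sqrt2; have := ln2_ge0; lra.
  have p0 := pi_ge0 R.
  apply: mulr_ge0; last by rewrite mulr_ge0// ltW.
  apply: mulr_ge0; first exact: sqrtr_ge0.
  by apply: mulr_ge0 => //; apply: mulr_ge0 => //; exact: sqr_ge0.
- move=> x hx; rewrite /F /G1 sqrt_cos; last by rewrite ltW// sc.
  derive_eq => /=.
  have -> : 4 * x = (x + x) + (x + x) by ring.
  have := cos2Dsin2 x; rewrite !cosD !sinD.
  move: (cos x) (sin x) => c s cs.
  have -> : (c * c - s * s) * (c * c - s * s) - (s * c + c * s) * (s * c + c * s) =
      (c ^+ 2 + s ^+ 2) ^+ 2 - 8 * c ^+ 2 * s ^+ 2 by ring.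
  by rewrite cs; field.
- by apply: cvg_at_right_filter; exact: cF.
- by apply: cvg_at_left_filter; exact: cF.
Qed.

(** This is an integration by parts against ln 4 - ln(2 cos x). Differentiating the logarithm
    produces tan x, and its factor 2x - sin(4x)/2 leaves the non-elementary term 2 pi x tan x
    besides trigonometric polynomials. *)
Lemma is_derive_outer (x : R) : 0 < 2 * cos x ->
  is_derive x 1 (fun y : R => pi * ((2 * y - sin (4 * y) / 2) * (ln 4 - ln (2 * cos y))
   + 3 / 2 * sin (2 * y) - 3 / 2 * y - 3 / 8 * sin (4 * y)))
  (2 * sin x * (pi * ((2 * cos x) ^+ 2 * (ln 4 - ln (2 * cos x)) + ((2 * cos x) ^+ 2 - 2) / 2)) *
     (2 * sin x) + 2 * pi * (x * (sin x / cos x))).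
Proof.
move=> c0; have cx : cos x != 0 by apply: lt0r_neq0; lra.
derive_eq; first exact: c0.
have cs := cos2Dsin2 x.
have c2 : cos (2 * x) = 2 * cos x ^+ 2 - 1.
  by rewrite (_ : 2 * x = x + x) ?cosD -?expr2; [lra|ring].
have c4 : cos (4 * x) = 8 * cos x ^+ 4 - 8 * cos x ^+ 2 + 1.
  rewrite (_ : 4 * x = 2 * x + 2 * x) ?cosD -?expr2; last by ring.
  by rewrite sin2cos2 c2; ring.
have s4 : sin (4 * x) = 4 * (sin x * cos x) * (2 * cos x ^+ 2 - 1).
  rewrite (_ : 4 * x = 2 * x + 2 * x) ?sinD; last by ring.
  by rewrite c2 (_ : 2 * x = x + x) ?sinD; ring.
rewrite c2 c4 s4; move: (sin (2 * x)) (ln (2 * cos x)) (ln 4) => S l l4.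
move: (cos x) (sin x) cx cs => c s c_neq0 cs.
(* Cosine and sine are free variables here, so the two sides differ by an explicit multiple of 1 -
   c^2 - s^2. *)
have cs0 : 1 - c ^+ 2 - s ^+ 2 = 0 by lra.
apply/eqP; rewrite -subr_eq0; apply/eqP.
transitivity (pi * (1 - c ^+ 2 - s ^+ 2) * (16 * c ^+ 2 * (l4 - l) + 6 * (2 * c ^+ 2 - 1))).
  by field.
by rewrite cs0 mulr0 mul0r.
Qed.

Lemma outer_disk_part :
  (\int[mu]_(t in `[s2, 2%R]) (G2 t)%:E =
   (pi * (3 / 4 * pi * ln 2 + 3 / 2 - 3 / 8 * pi - 2 * xtan_integral R))%:E)%E.
Proof.
have e2 : 2 = 2 * cos 0 :> R by rewrite cos0 mulr1.
have q1 : pi / 4 <= pi :> R by have := pi_gt0 R; lra.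
have q2 (x : R) : 2 * cos (pi / 4) <= x <= 2 * cos 0 -> {for x, continuous G2}.
  rewrite cos_quarter => /andP[x1 _]; rewrite /G2.
  by cont_tac; exact: lt_le_trans sqrt2_gt0 x1.
rewrite -cos_quarter [X in `[_, X]]e2 (integral_cos_subst _ _ _ (lexx 0) pi4 q1 q2).
have c0 (x : R) : 0 <= x <= pi / 4 -> 0 < 2 * cos x.
  by move=> /cos_gt0_quarter h; rewrite mulr_gt0.
pose p (x : R) : R := G2 (2 * cos x) * (2 * sin x).
have cp (x : R) : 0 <= x <= pi / 4 -> {for x, continuous p}.
  by move=> /c0 h; rewrite /p /G2; cont_tac.
have mcos : measurable_fun setT (@cos R).
  by apply: continuous_measurable_fun; exact: continuous_cos.
have msin : measurable_fun setT (@sin R).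
  by apply: continuous_measurable_fun; exact: continuous_sin.
have mp : measurable_fun setT p by rewrite /p /G2; mfun_tac.
rewrite integral_itv_bndoo; last first.
  by apply: measurable_funTS; apply/measurable_EFinP.
pose xt (y : R) : R := y * (sin y / cos y).
have mxt : measurable_fun setT xt by rewrite /xt; mfun_tac.
pose H (y : R) : R := pi * ((2 * y - sin (4 * y) / 2) * (ln 4 - ln (2 * cos y))
   + 3 / 2 * sin (2 * y) - 3 / 2 * y - 3 / 8 * sin (4 * y)).
have oo (x : R) : 0 < x < pi / 4 -> 0 <= x <= pi / 4.
  by move=> /andP[h1 h2]; rewrite !ltW.
have p0 (x : R) : 0 < x < pi / 4 -> 0 <= p x.
  move=> hx; have s0 : 0 <= sin x by apply: sin_ge0_quarter; exact: oo.
  have hc : s2 <= 2 * cos x.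
    rewrite -cos_quarter ler_pM2l//; case/andP: hx => h1 h2.
    by rewrite ltW// ltr_cos// in_itv/=; have := pi_gt0 R; lra.
  have hc2 : 2 <= (2 * cos x) ^+ 2.
    by have := sqrt2_gt0; have := sqrt2_sqr; nra.
  rewrite /p /G2 !mulr_ge0 ?sqrtr_ge0 ?pi_ge0//.
  rewrite addr_ge0//; last by rewrite divr_ge0// subr_ge0.
  rewrite mulr_ge0 ?sqr_ge0// subr_ge0 ler_ln ?posrE ?c0 ?oo//.
  by have := cos_le1 x; lra.
have xt0 (x : R) : 0 < x < pi / 4 -> 0 <= xt x.
  move=> /oo hx; have s0 := sin_ge0_quarter _ _ hx; have hc := cos_gt0_quarter _ _ hx.
  by rewrite /xt mulr_ge0 ?divr_ge0 ?(ltW hc)//; case/andP: hx.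
have cH (x : R) : 0 <= x <= pi / 4 -> {for x, continuous H}.
  by move=> /c0 h; rewrite /H; cont_tac.
(* Only the sum with 2 pi x tan x has an elementary primitive; both summands are nonnegative, so the
   integral of [p] is recovered by subtracting the finite value of the other. *)
have S : (\int[mu]_(x in `]0%R, (pi / 4)%R[) (p x + 2 * pi * xt x)%:E = (H (pi / 4) - H 0)%:E)%E.
  apply: (@ge0_FTC_oo R (fun x => p x + 2 * pi * xt x) H 0 (pi / 4) (H 0) (H (pi / 4)) pi4).
  - move=> x hx; have h1 := p0 x hx; have h2 := xt0 x hx; have h3 := pi_ge0 R.
    by apply: addr_ge0 => //; apply: mulr_ge0 => //; apply: mulr_ge0.
  - move=> x hx; apply: cont_add; first by apply: cp; exact: oo.
    by rewrite /xt; cont_tac; apply: lt0r_neq0; apply: cos_gt0_quarter; exact: oo.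
  - move=> x hx; have s0 : 0 <= sin x by apply: sin_ge0_quarter; exact: oo.
    have hc := c0 _ (oo _ hx).
    have cx : cos x != 0 by apply: lt0r_neq0; apply: cos_gt0_quarter; exact: oo.
    have E : p x + 2 * pi * xt x = 2 * sin x * (pi * ((2 * cos x) ^+ 2 * (ln 4 - ln (2 * cos x)) +
       ((2 * cos x) ^+ 2 - 2) / 2)) * (2 * sin x) + 2 * pi * (x * (sin x / cos x)).
      by rewrite /p /G2 (sqrt_cos _ s0).
    rewrite E; exact: (is_derive_outer x hc).
  - by apply: cvg_at_right_filter; apply: cH; rewrite lexx ltW.
  - by apply: cvg_at_left_filter; apply: cH; rewrite lexx ltW.
have Hv : H (pi / 4) - H 0 = pi * (3 / 4 * pi * ln 2 + 3 / 2 - 3 / 8 * pi).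
  rewrite /H cos_quarter ln_sqrt2 ln4 !mulr0 sin0.
  have -> : 4 * (pi / 4) = pi :> R by field.
  have -> : 2 * (pi / 4) = pi / 2 :> R by field.
  by rewrite sinpi sin_pihalf; field.
have hx := integral_xtan R.
have : (\int[mu]_(x in `]0%R, (pi / 4)%R[) (p x)%:E + (2 * pi * xtan_integral R)%:E =
   (H (pi / 4) - H 0)%:E)%E.
  have mD : measurable (`]0, (pi / 4)[%classic : set R) by [].
  have h1 (x : R) : `]0, (pi / 4)[%classic x -> (0 <= (p x)%:E)%E.
    by rewrite /= in_itv /= lee_fin => /p0.
  have h3 (x : R) : `]0, (pi / 4)[%classic x -> (0 <= (xt x)%:E)%E.
    by rewrite /= in_itv /= lee_fin => /xt0.
  have p20 : 0 <= 2 * pi :> R by rewrite mulr_ge0// pi_ge0.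
  have h2 (x : R) : `]0, (pi / 4)[%classic x -> (0 <= (2 * pi * xt x)%:E)%E.
    by move=> /h3; rewrite !lee_fin; exact: mulr_ge0.
  have m1 : measurable_fun `]0, (pi / 4)[ (fun x : R => (p x)%:E).
    by apply: measurable_funTS; apply/measurable_EFinP; exact: mp.
  have m3 : measurable_fun `]0, (pi / 4)[ (fun x : R => (xt x)%:E).
    by apply: measurable_funTS; apply/measurable_EFinP; exact: mxt.
  have m2 : measurable_fun `]0, (pi / 4)[ (fun x : R => (2 * pi * xt x)%:E).
    apply: measurable_funTS; apply/measurable_EFinP.
    exact: (mfun_mul _ _ _ _ _ (measurable_cst _) mxt).
  rewrite -S EFinM -hx -(ge0_integralZl_EFin mu mD h3 m3 p20).
  by rewrite -(ge0_integralD mu mD h1 m1 h2 m2).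
rewrite Hv; case: (\int[mu]_(x in `]0%R, (pi / 4)%R[) (p x)%:E)%E => [r||]//.
rewrite -EFinD => -[h]; congr (_%:E).
by rewrite -[LHS](addrK (2 * pi * xtan_integral R)) h; ring.
Qed.

Lemma radial_integral :
  (\int[mu]_(t in `]0%R, 2%R[) (Num.sqrt (4 - t ^+ 2) *
     (pi * (t ^+ 2 * ln 4 - disk_potential R s2 t)))%:E =
   (3 / 2 * pi ^+ 2 * ln 2 + 3 / 2 * pi - 3 / 8 * pi ^+ 2 - 2 * pi * xtan_integral R)%:E)%E.
Proof.
set h := fun t : R => Num.sqrt (4 - t ^+ 2) * (pi * (t ^+ 2 * ln 4 - disk_potential R s2 t)).
have mh : measurable_fun setT h by rewrite /h /disk_potential; mfun_tac.
have mhD (D : set R) : measurable D -> measurable_fun D (fun t => (h t)%:E).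
  by move=> mD; apply: measurable_funTS; apply/measurable_EFinP.
have s20 := sqrt2_gt0; have s22 := sqrt2_lt2.
have e1 t : t <= s2 -> h t = G1 t.
  by move=> ts; rewrite /h /disk_potential ts /G1 /K; congr (_ * (_ * _)); ring.
have e2 t : s2 <= t -> h t = G2 t.
  rewrite le_eqVlt => /predU1P[<-|ts]; rewrite /h /disk_potential /G2.
    by rewrite lexx sqrt2_sqr; congr (_ * (_ * _)); ring.
  by rewrite leNgt ts /= sqrt2_sqr; congr (_ * (_ * _)); ring.
have ln4s : 0 <= K by rewrite /K ln4 ln_sqrt2; have := ln2_ge0; lra.
have h0 t : 0 < t < 2 -> 0 <= h t.
  move=> /andP[t0 t2]; have [ts|ts] := leP t s2.
    by rewrite e1// /G1 !mulr_ge0 ?sqrtr_ge0 ?pi_ge0// ltW.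
  rewrite e2; last exact: ltW.
  rewrite /G2; apply: mulr_ge0; first exact: sqrtr_ge0.
  apply: mulr_ge0; first exact: pi_ge0.
  apply: addr_ge0.
    apply: mulr_ge0; first exact: sqr_ge0.
    by rewrite subr_ge0 ler_ln ?posrE//; lra.
  by rewrite divr_ge0// subr_ge0 -sqrt2_sqr lerXn2r// ?nnegrE ltW.
have -> : (\int[mu]_(t in `]0%R, 2%R[) (h t)%:E =
   \int[mu]_(t in `]0%R, s2]) (h t)%:E + \int[mu]_(t in `]s2, 2%R[) (h t)%:E)%E.
  rewrite -ge0_integral_setU//.
  - by congr (integral _ _ _); rewrite -itv_bndbnd_setU// bnd_simp.
  - by apply: mhD; exact: measurableU.
  - move=> t /= [|]; rewrite in_itv /= lee_fin => /andP[h1 h2]; apply: h0.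
      by rewrite h1 (le_lt_trans h2).
    by rewrite h2 (lt_trans s20).
  - apply/disj_setPS => t /= [] /=; rewrite !in_itv /= => /andP[_ h1] /andP[h2 _].
    by move: h1; rewrite leNgt h2.
have -> : (\int[mu]_(t in `]0%R, s2]) (h t)%:E = \int[mu]_(t in `[0%R, s2]) (G1 t)%:E)%E.
  rewrite integral_itv_obnd_cbnd; last exact: mhD.
  by apply: eq_integral => t; rewrite inE /= in_itv /= => /andP[_ ts]; rewrite e1.
have -> : (\int[mu]_(t in `]s2, 2%R[) (h t)%:E = \int[mu]_(t in `[s2, 2%R]) (G2 t)%:E)%E.
  rewrite integral_itv_obnd_cbnd; last exact: mhD.
  rewrite integral_itv_bndo_bndc; last exact: mhD.
  by apply: eq_integral => t; rewrite inE /= in_itv /= => /andP[ts _]; rewrite e2.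
rewrite inner_disk_part outer_disk_part -EFinD; congr (_%:E).
by field.
Qed.

End RadialIntegral.

(** * From the radial integral to the areal Mahler measure *)

Section ArealMahler.
Variable R : realType.
Notation mu := (@lebesgue_measure R).
Notation mu2 := (mu \x mu)%E.
Notation mu4 := (area_measure R \x area_measure R)%E.
Notation s2 := (Num.sqrt (2 : R)).

Let mn := @measurable_norm2 R.

Lemma unit_diskP (p : R * R) : unit_disk R p <-> norm2 R p <= 1.
Proof. by []. Qed.

Lemma measurable_unit_disk : measurable (unit_disk R).
Proof.
have := mn measurableT _ (measurable_itv `]-oo, 1%R]).
rewrite setTI; congr (measurable _); apply/seteqP; split => p /=; rewrite in_itv /=.
Qed.

Lemma area_unit_disk : area_measure R (unit_disk R) = pi%:E.
Proof.
have := area_disk R 1 ltr01; rewrite expr1n mulr1 => <-.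
rewrite (integral_if_plane _ _ _ (fun=> 1) unit_diskP).
have h := integral_cst (area_measure R) measurable_unit_disk 1%E.
by rewrite mul1e in h; rewrite -h.
Qed.

Let a0 : 0 < s2. Proof. exact: sqrt2_gt0. Qed.
Let a2 : s2 <= 2. Proof. exact: ltW (sqrt2_lt2 R). Qed.

(** The truncation at 2 is invisible on sums of two points of the unit disk and makes [F]
    nonnegative on the plane, since |sqrt 2 + w| <= 4 there. *)
Let F (w : R * R) : R := if norm2 R w <= 2 then ln 4 - ln (norm2 R (s2 + w.1, w.2)) else 0.

(** The half-turn w -> -w moves the singularity from -sqrt 2 to the positive point sqrt 2 of
    [logdist]. *)
Let logE (w : R * R) : ln (norm2 R (s2 + w.1, w.2)) = logdist R s2 0 (rotation R (-1) 0 w).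
Proof.
rewrite /logdist /= expr1 divr1 /rotation /norm2 /=; congr (ln (Num.sqrt _)).
by ring.
Qed.

Let n_rot (w : R * R) : norm2 R (rotation R (-1) 0 w) = norm2 R w.
Proof. by apply: norm2_rotation; ring. Qed.

Let F0 w : 0 <= F w.
Proof.
rewrite /F; case: ifP => // w2; rewrite logE subr_ge0; apply: logdist_le => //.
by rewrite n_rot.
Qed.

Let mF : measurable_fun setT F.
Proof.
have ml := measurable_logdist R s2 0; have mr := measurable_rotation R (-1) 0.
have mlr : measurable_fun setT (fun w : R * R => logdist R s2 0 (rotation R (-1) 0 w)).
  exact: (measurableT_comp ml mr).
have -> : F = fun w => if norm2 R w <= 2 then ln 4 - logdist R s2 0 (rotation R (-1) 0 w) else 0.
  by apply/funext => w; rewrite /F logE.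
by mfun_tac.
Qed.

Let inner (t : R) : 0 < t < 2 ->
  (\int[mu2]_w (if (norm2 R w <= t)%R then F w else 0)%:E =
   (pi * (t ^+ 2 * ln 4 - disk_potential R s2 t))%:E)%E.
Proof.
move=> /andP[t0 t2].
rewrite -(integral_logmax_disk R s2 a0 a2 t t0 (ltW t2)).
rewrite -(integral_logdist_disk R s2 a0 a2 t (ltW t2)).
have ml := measurable_logdist R s2 0.
have cs : (-1) ^+ 2 + 0 ^+ 2 = 1 :> R by ring.
have mg : measurable_fun setT (fun w : R * R =>
    (if norm2 R w <= t then ln 4 - logdist R s2 0 w else 0)%:E) by mfun_tac.
have g0 (w : R * R) : (0 <= (if norm2 R w <= t then ln 4 - logdist R s2 0 w else 0)%:E)%E.
  rewrite lee_fin; case: ifP => // w2; rewrite subr_ge0; apply: logdist_le => //.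
  exact: le_trans w2 (ltW t2).
rewrite -(ge0_integral_rotation R (-1) 0 _ cs mg g0).
apply: eq_integral => w _; rewrite n_rot /F; case: ifP => // w2.
by rewrite (le_trans w2 (ltW t2)) logE.
Qed.

Let val : R := 3 / 2 * pi ^+ 2 * ln 2 + 3 / 2 * pi - 3 / 8 * pi ^+ 2 - 2 * pi * xtan_integral R.

Let outer : (\int[mu]_t ((Num.sqrt (4 - t ^+ 2))%:E *
     \int[mu2]_w (if (norm2 R w <= t)%R then F w else 0)%:E) = val%:E)%E.
Proof.
rewrite /val -radial_integral.
set h := fun t : R => Num.sqrt (4 - t ^+ 2) * (pi * (t ^+ 2 * ln 4 - disk_potential R s2 t)).
set J := fun t : R => ((Num.sqrt (4 - t ^+ 2))%:E *
     \int[mu2]_w (if (norm2 R w <= t)%R then F w else 0)%:E)%E.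
have JE (t : R) : 0 < t < 2 -> J t = (h t)%:E by move=> ht; rewrite /J inner.
have mh : measurable_fun setT h by rewrite /h /disk_potential; mfun_tac.
have mJ : measurable_fun (`]0, 2[%classic : set R) J.
  apply: (eq_measurable_fun (fun t => (h t)%:E)).
    by move=> t; rewrite inE /= in_itv /= => /JE.
  by apply: measurable_funTS; apply/measurable_EFinP.
transitivity (\int[mu]_(t in `]0%R, 2%R[) J t)%E; last first.
  by apply: eq_integral => t; rewrite inE /= in_itv /= => /JE.
rewrite integral_itv_obnd_cbnd// [RHS]integral_mkcond; apply: eq_integral => t _.
rewrite /patch; case: ifPn => //; rewrite notin_setE /= in_itv /= => ht.
(* For t < 0 the inner disk is empty; for t >= 2 the square root is 0. *)
rewrite /J; have [t0|t0] := ltP t 0.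
  rewrite [X in (_ * X)%E]integral0_eq ?mule0// => w _.
  by rewrite leNgt (lt_le_trans t0 (norm2_ge0 _ _)).
have t2 : 2 <= t by rewrite leNgt; apply/negP => h2; apply: ht; rewrite t0.
by rewrite ler0_sqrtr ?mul0e//; nra.
Qed.

Let D := unit_disk R `*` unit_disk R.
Let g (z : (R * R) * (R * R)) : R := F (z.1.1 + z.2.1, z.1.2 + z.2.2).

Let mD : measurable D.
Proof. by apply: measurableX; exact: measurable_unit_disk. Qed.

Let DP z : D z <-> (norm2 R z.1 <= 1) && (norm2 R z.2 <= 1).
Proof. by rewrite /D /=; split => [[/unit_diskP -> /unit_diskP ->]|/andP[/unit_diskP ? /unit_diskP ?]]. Qed.

Let mg : measurable_fun setT g.
Proof.
have ms : measurable_fun setT (fun z : (R * R) * (R * R) => (z.1.1 + z.2.1, z.1.2 + z.2.2)).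
  by mfun_tac.
exact: (measurableT_comp mF ms).
Qed.

Let integral_g : (\int[mu4]_(z in D) (g z)%:E = val%:E)%E.
Proof.
rewrite -outer -(integral_disk_sum R F mF F0) integral_mkcond.
have ft := @fubini_tonelli1 _ _ _ _ R (area_measure R) (area_measure R)
  (fun z => (if (norm2 R z.1 <= 1) && (norm2 R z.2 <= 1) then g z else 0)%:E).
transitivity (\int[mu4]_z (if (norm2 R z.1 <= 1)%R && (norm2 R z.2 <= 1)%R then g z else 0)%:E)%E.
  apply: eq_integral => z _; rewrite /patch; case: ifPn => [|].
    by rewrite inE => /DP ->.
  by rewrite notin_setE => zD; case: ifP => // /DP.
rewrite ft//.
- have m : measurable_fun setT (fun z : (R * R) * (R * R) =>
     (if (norm2 R z.1 <= 1) && (norm2 R z.2 <= 1) then g z else 0)%:E) by mfun_tac.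
  exact: m.
- by move=> z; rewrite lee_fin; case: ifP => // _; exact: F0.
Qed.

Let areal_value (p l X : R) : p != 0 ->
  (p ^+ 2)^-1 * (2 * l * (p * p) - (3 / 2 * p ^+ 2 * l + 3 / 2 * p - 3 / 8 * p ^+ 2 - 2 * p * X)) =
  l / 2 - 3 / (2 * p) + 3 / 8 + 2 * X / p.
Proof. by move=> p0; field. Qed.

(** On the product of disks the logarithm is ln 4 - g with g >= 0 of finite integral. The product
    has measure pi^2, so the integral of this signed function splits. *)
Lemma areal_mahler_sqrt2 :
  areal_mahler2 (fun x y : R[i] => ((Num.sqrt (2 : R))%:C + x + y)%C) =
  (ln 2 / 2 - 3 / (2 * pi) + 3 / 8 + 2 * xtan_integral R / pi)%:E.
Proof.
have pi0 := pi_gt0 R.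
have MD : (mu4 D = (pi * pi)%:E)%E.
  have h := @product_measure1E _ _ _ _ R (area_measure R) (area_measure R) _ _
    measurable_unit_disk measurable_unit_disk.
  by rewrite EFinM -area_unit_disk -h.
have ig : mu4.-integrable D (fun z => (g z)%:E).
  apply/integrableP; split.
    by apply: measurable_funTS; apply/measurable_EFinP; exact: mg.
  have -> : (\int[mu4]_(z in D) `|(g z)%:E| = \int[mu4]_(z in D) (g z)%:E)%E.
    by apply: eq_integral => z _; rewrite gee0_abs// lee_fin F0.
  by rewrite integral_g ltry.
have ic : mu4.-integrable D (cst (ln 4)%:E).
  apply/integrableP; split; first exact: measurable_cst.
  have -> : (\int[mu4]_(z in D) `|cst (ln 4)%:E z| = `|(ln 4)%:E| * mu4 D)%E.
    by rewrite -(integral_cst mu4 mD).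
  by rewrite MD abse_EFin -EFinM ltry.
rewrite /areal_mahler2.
have -> : (\int[mu4]_(z in D) (ln (cmod ((Num.sqrt (2 : R))%:C + to_C z.1 + to_C z.2)%C))%:E =
   (ln 4 * (pi * pi) - val)%:E)%E.
  have IC : (\int[mu4]_(z in D) cst (ln 4)%:E z = (ln 4)%:E * (pi * pi)%:E)%E.
    by rewrite -MD; exact: (integral_cst mu4 mD _).
  transitivity (\int[mu4]_(z in D) (cst (ln 4)%:E z - (g z)%:E))%E; last first.
    have IB := @integralB _ _ R mu4 D mD _ _ ic ig.
    by rewrite EFinB EFinM -IC -integral_g; exact: IB.
  apply: eq_integral => -[[x1 x2] [y1 y2]]; rewrite inE => /DP /andP[/= hx hy].
  rewrite /g /F /= -EFinB.
  have -> : norm2 R (x1 + y1, x2 + y2) <= 2.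
    rewrite norm2_le//= in hx; rewrite norm2_le//= in hy; rewrite norm2_le//=.
    by have := sqr_ge0 (x1 - y1); have := sqr_ge0 (x2 - y2); nra.
  rewrite subKr; congr (ln _)%:E.
  by rewrite /cmod /norm2 /= add0r addrA.
rewrite -EFinM; congr (_%:E); rewrite /val ln4.
have p0 : pi != 0 :> R by rewrite gt_eqF.
exact: areal_value.
Qed.

End ArealMahler.

(** * Gamma and beta integrals *)

Section GammaBeta.
Variable R : realType.
Notation mu := (@lebesgue_measure R).

(** Keeping the value in the extended reals lets the product identities below hold without
    convergence hypotheses. *)
Definition gamma_int (s : R) : \bar R :=
  (\int[mu]_(t in `]0%R, +oo[) (t `^ (s - 1) * expR (- t))%:E)%E.

(** Euler's B(a, b) after the substitution u = v / (1 + v), which carries the half-line to the unit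
    interval. *)
Definition beta_int (a b : R) : \bar R :=
  (\int[mu]_(v in `]0%R, +oo[) (v `^ (a - 1) * (1 + v) `^ (- (a + b)))%:E)%E.

Lemma GammaE s : Gamma s = fine (gamma_int s). Proof. by []. Qed.

Lemma in_oy (x : R) : `]0, +oo[%classic x <-> 0 < x.
Proof. by rewrite /= in_itv /= andbT. Qed.

Lemma powR_add (x p q : R) : 0 < x -> x `^ p * x `^ q = x `^ (p + q).
Proof. by move=> x0; rewrite powRD// (gt_eqF x0) implybT. Qed.

Lemma gamma_int_scale (c s : R) : 0 < c ->
  (\int[mu]_y (if 0 < y then y `^ (s - 1) * expR (- (c * y)) else 0)%:E =
   (c `^ (- s))%:E * gamma_int s)%E.
Proof.
move=> c0; rewrite /gamma_int -(integral_if _ _ _ _ in_oy).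
pose f (y : R) : R := if 0 < y then y `^ (s - 1) * expR (- y) else 0.
have mf : measurable_fun setT (fun y : R => (f y)%:E) by rewrite /f; mfun_tac.
have f0 (y : R) : (0 <= (f y)%:E)%E.
  by rewrite lee_fin /f; case: ifP => // y0; rewrite mulr_ge0 ?powR_ge0 ?expR_ge0.
have mg : measurable_fun setT (fun y : R =>
   (if 0 < y then y `^ (s - 1) * expR (- (c * y)) else 0)%:E) by mfun_tac.
have g0 (y : R) : (0 <= (if 0 < y then y `^ (s - 1) * expR (- (c * y)) else 0)%:E)%E.
  by rewrite lee_fin; case: ifP => // y0; rewrite mulr_ge0 ?powR_ge0 ?expR_ge0.
have g0' (y : R) : setT y -> (0 <= (if 0 < y then y `^ (s - 1) * expR (- (c * y)) else 0)%:E)%E.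
  by move=> _; exact: g0.
rewrite -(ge0_integral_affine R c 0 (fun y => (f y)%:E) c0 mf f0) muleA -EFinM.
have -> : (\int[mu]_x (f (c * x + 0)%R)%:E =
    \int[mu]_y ((c `^ (s - 1))%:E * (if (0 < y)%R then y `^ (s - 1) * expR (- (c * y)) else 0)%:E))%E.
  apply: eq_integral => y _; rewrite addr0 /f pmulr_rgt0// -EFinM; congr (_%:E).
  by case: ifP => y0; rewrite ?mulr0// powRM ?(ltW c0) ?(ltW y0)// mulrA.
rewrite (ge0_integralZl_EFin mu measurableT g0' mg (powR_ge0 _ _)) muleA -EFinM.
rewrite (_ : _ * _ = 1) ?mul1e//.
rewrite -{2}(powRr1 (ltW c0)) !powR_add// (_ : _ + _ = 0) ?powRr0//.
by ring.
Qed.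

Lemma gamma_int_ge0 s : (0 <= gamma_int s)%E.
Proof.
by apply: integral_ge0 => t _; rewrite lee_fin mulr_ge0 ?powR_ge0 ?expR_ge0.
Qed.

(* Substituting x = v y in the first factor turns the product of the two
   integrals into an integral over v of the density of the ratio. *)
Lemma gamma_beta (a b : R) : (gamma_int a * gamma_int b = beta_int a b * gamma_int (a + b))%E.
Proof.
pose k (z : R * R) : R := if (0 < z.1) && (0 < z.2) then
  z.1 `^ (a + b - 1) * z.2 `^ (a - 1) * expR (- ((1 + z.2) * z.1)) else 0.
have k0 (z : R * R) : (0 <= (k z)%:E)%E.
  by rewrite lee_fin /k; case: ifP => // _; rewrite !mulr_ge0 ?powR_ge0 ?expR_ge0.
have mk : measurable_fun setT (fun z : R * R => (k z)%:E) by rewrite /k; mfun_tac.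
have mscale (c s : R) : measurable_fun setT (fun y : R =>
    (if 0 < y then y `^ (s - 1) * expR (- (c * y)) else 0)%:E) by mfun_tac.
have scale0 (c s y : R) : (0 <= (if 0 < y then y `^ (s - 1) * expR (- (c * y)) else 0)%:E)%E.
  by rewrite lee_fin; case: ifP => // y0; rewrite mulr_ge0 ?powR_ge0 ?expR_ge0.
have L : (\int[mu]_y \int[mu]_v (k (y, v))%:E = gamma_int a * gamma_int b)%E.
  transitivity (\int[mu]_y ((if 0 < y then y `^ (b - 1) * expR (- y) else 0)%:E * gamma_int a))%E.
    apply: eq_integral => y _; rewrite /k /=; case: (ltP 0 y) => y0 /=; last first.
      by rewrite mul0e integral0_eq.
    transitivity ((y `^ (a + b - 1) * expR (- y))%:E *
        \int[mu]_v (if (0 < v)%R then v `^ (a - 1) * expR (- (y * v)) else 0)%:E)%E.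
      have c0 : 0 <= y `^ (a + b - 1) * expR (- y) by rewrite mulr_ge0 ?powR_ge0 ?expR_ge0.
      rewrite -(ge0_integralZl_EFin mu measurableT (fun v _ => scale0 y a v) (mscale y a) c0).
      apply: eq_integral => v _; rewrite -EFinM; congr (_%:E).
      case: ifP => v0; rewrite ?mulr0//.
      rewrite (_ : - ((1 + v) * y) = - y + - (y * v)) ?expRD; ring.
    rewrite (gamma_int_scale _ _ y0) muleA -EFinM; congr (_%:E * _)%E.
    rewrite mulrAC powR_add//; congr (_ `^ _ * _).
    by ring.
  rewrite [RHS]muleC.
  have mb : measurable_fun setT (fun y : R =>
    (if 0 < y then y `^ (b - 1) * expR (- y) else 0)%:E) by mfun_tac.
  have b0 (y : R) : setT y -> (0 <= (if 0 < y then y `^ (b - 1) * expR (- y) else 0)%:E)%E.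
    by move=> _; rewrite lee_fin; case: ifP => // y0; rewrite mulr_ge0 ?powR_ge0 ?expR_ge0.
  rewrite (ge0_integralZr mu measurableT mb b0 (gamma_int_ge0 a)).
  congr (_ * _)%E; exact: (integral_if _ _ _ _ in_oy).
have Rr : (\int[mu]_v \int[mu]_y (k (y, v))%:E = beta_int a b * gamma_int (a + b))%E.
  transitivity (\int[mu]_v ((if 0 < v then v `^ (a - 1) * (1 + v) `^ (- (a + b)) else 0)%:E
      * gamma_int (a + b)))%E.
    apply: eq_integral => v _; rewrite /k /=; case: (ltP 0 v) => v0 /=; last first.
      by rewrite mul0e integral0_eq// => y _; rewrite andbF.
    have v1 : 0 < 1 + v by rewrite addr_gt0.
    rewrite EFinM -muleA -(gamma_int_scale _ (a + b) v1).
    rewrite -(ge0_integralZl_EFin mu measurableT (fun y _ => scale0 (1 + v) (a + b) y)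
      (mscale (1 + v) (a + b)) (powR_ge0 _ _)).
    apply: eq_integral => y _; rewrite andbT -EFinM; congr (_%:E).
    by case: ifP => y0; rewrite ?mulr0//; ring.
  have mb : measurable_fun setT (fun v : R =>
    (if 0 < v then v `^ (a - 1) * (1 + v) `^ (- (a + b)) else 0)%:E) by mfun_tac.
  have b0 (v : R) : setT v -> (0 <= (if 0 < v then v `^ (a - 1) * (1 + v) `^ (- (a + b)) else 0)%:E)%E.
    by move=> _; rewrite lee_fin; case: ifP => // y0; rewrite mulr_ge0 ?powR_ge0.
  rewrite (ge0_integralZr mu measurableT mb b0 (gamma_int_ge0 _)).
  congr (_ * _)%E; exact: (integral_if _ _ _ _ in_oy).
by rewrite -L -Rr; exact: (tonelli_swap R (fun z => (k z)%:E) mk k0).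
Qed.

Lemma gamma_int1 : gamma_int 1 = 1%E.
Proof.
rewrite /gamma_int.
pose F (t : R) : R := - expR (- t).
have cF (t : R) : {for t, continuous F} by rewrite /F; cont_tac.
have -> : (\int[mu]_(t in `]0%R, +oo[) (t `^ (1 - 1) * expR (- t))%:E =
   \int[mu]_(t in `]0%R, +oo[) (expR (- t))%:E)%E.
  by apply: eq_integral => t _; rewrite subrr powRr0 mul1r.
have -> : 1%E = (0 - F 0)%:E by rewrite /F oppr0 expR0 sub0r opprK.
apply: (@ge0_FTC_oy _ _ F).
- by move=> t _; exact: expR_ge0.
- by move=> t _; cont_tac.
- by move=> t _; rewrite /F; derive_eq; ring.
- by apply: cvg_at_right_filter; exact: cF.
- rewrite -[X in _ --> X]oppr0 /F; apply: cvgN; exact: cvgr_expR.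
Qed.

Lemma cvg_v1v : (fun v : R => v / (1 + v)) x @[x --> +oo] --> (1 : R).
Proof.
apply/cvgrPdist_le => e e0; near=> v.
have v0 : 0 < v by near: v; exact: nbhs_pinfty_gt.
have ve : e^-1 <= v by near: v; apply: nbhs_pinfty_ge; rewrite num_real.
have -> : 1 - v / (1 + v) = (1 + v)^-1.
  by field; rewrite gt_eqF// addr_gt0.
rewrite ger0_norm; last by rewrite invr_ge0 ltW// addr_gt0.
rewrite -(invrK e) lef_pV2 ?posrE ?invr_gt0// ?addr_gt0//.
by apply: (le_trans ve); rewrite lerDr.
Unshelve. all: by end_near. Qed.

Lemma beta_int1 s : 0 < s -> beta_int s 1 = s^-1%:E.
Proof.
(* v / (1 + v) has derivative (1 + v)^(-2), so its s-th power divided by s is a primitive, running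
   from 0 to 1/s. *)
move=> s0; rewrite /beta_int; pose F (v : R) : R := (v / (1 + v)) `^ s / s.
have p1 (v : R) : 0 < v -> 0 < 1 + v by move=> ?; rewrite addr_gt0.
have -> : s^-1 = s^-1 - 0 by rewrite subr0.
apply: (@ge0_FTC_oy _ _ F).
- by move=> v v0; rewrite mulr_ge0 ?powR_ge0.
- by move=> v v0; cont_tac => //; exact: p1.
- move=> v v0; have v1 := p1 _ v0; have n1 : 1 + v != 0 by rewrite gt_eqF.
  rewrite /F; derive_eq; rewrite ?mulr_gt0 ?invr_gt0//.
  have -> : v `^ (s - 1) * (1 + v) `^ (- (s + 1)) =
     (v / (1 + v)) `^ (s - 1) * (1 + v) `^ (-1 - 1).
    rewrite powRM ?invr_ge0 ?(ltW v0) ?(ltW v1)//.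
    rewrite -(powR_inv1 (ltW v1)) -powRrM -mulrA powR_add//; congr (_ * _ `^ _); ring.
  have -> : (1 + v) `^ (-1 - 1) = (1 + v)^-1 ^+ 2.
    by rewrite -powR_add// powR_inv1 ?ltW// expr2.
  move: ((_ / _) `^ _) => P.
  have sn : s != 0 by rewrite gt_eqF.
  by field; rewrite n1 sn.
- rewrite /F -[X in _ --> X](mul0r s^-1); apply: cvgMl.
  apply: (squeeze_cvgr _ (cvg_cst (0 : R)) (powR_cvg0 s0)).
  near=> v; have v0 : 0 < v by near: v; exact: nbhs_right_gt.
  rewrite powR_ge0 ge0_ler_powR ?nnegrE ?(ltW s0) ?(ltW v0)//.
    by rewrite divr_ge0 ?addr_ge0 ?(ltW v0).
  by rewrite ler_pdivrMr ?addr_gt0// mulrDr mulr1 lerDl mulr_ge0 ?ltW.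
- rewrite /F -[X in _ --> X]mul1r; apply: cvgMl.
  have c1 : {for 1, continuous (fun y : R => y `^ s)}.
    by apply: cont_powR => //; cont_tac.
  have := cvg_comp _ _ cvg_v1v c1.
  by rewrite /= powR1; apply.
Unshelve. all: by end_near. Qed.

(** The recursion is the case b = 1 of [gamma_beta], with Gamma(1) = 1 and B(s, 1) = 1/s. *)
Lemma gamma_intS s : 0 < s -> (gamma_int s = s^-1%:E * gamma_int (s + 1))%E.
Proof. by move=> s0; have := gamma_beta s 1; rewrite gamma_int1 mule1 beta_int1. Qed.

Lemma cvgy_sqrt : (@Num.sqrt R) x @[x --> +oo] --> +oo.
Proof.
apply/cvgryPge => A; near=> x.
have [A0|A0] := ltP A 0; first by rewrite (le_trans (ltW A0))// sqrtr_ge0.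
have xA : A ^+ 2 <= x by near: x; apply: nbhs_pinfty_ge; rewrite num_real.
by rewrite -(ger0_norm A0) -sqrtr_sqr; exact: ler_wsqrtr.
Unshelve. all: by end_near. Qed.

Lemma integral_sqrt_weight :
  (\int[mu]_(v in `]0%R, +oo[) ((Num.sqrt v * (1 + v))^-1)%:E = pi%:E)%E.
Proof.
pose F (v : R) : R := 2 * atan (Num.sqrt v).
have p1 (v : R) : 0 < v -> 0 < 1 + v by move=> ?; rewrite addr_gt0.
have -> : pi = 2 * (pi / 2) - F 0 :> R by rewrite /F sqrtr0 atan0 mulr0 subr0; field.
apply: (@ge0_FTC_oy _ _ F).
- by move=> v v0; rewrite invr_ge0 mulr_ge0 ?sqrtr_ge0// ltW// p1.
- by move=> v v0; cont_tac; rewrite mulf_neq0// gt_eqF ?sqrtr_gt0 ?p1.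
- move=> v v0; have v1 := p1 _ v0; have n1 : 1 + v != 0 by rewrite gt_eqF.
  rewrite /F; derive_eq; first by [].
  rewrite sqr_sqrtr ?ltW//.
  have q0 : Num.sqrt v != 0 by rewrite gt_eqF ?sqrtr_gt0.
  by move: (Num.sqrt v) q0 => q q0; field; rewrite n1 q0.
- have cF : {for 0, continuous F} by rewrite /F; cont_tac.
  by apply: cvg_at_right_filter; exact: cF.
- by rewrite /F; apply: cvgMr; exact: (cvg_comp _ _ cvgy_sqrt (@cvgy_atan R)).
Qed.

(** By [gamma_beta], Gamma(1/2)^2 = B(1/2, 1/2), whose integrand is 1 / (sqrt v (1 + v)). *)
Lemma gamma_int_half : gamma_int (1 / 2) = (Num.sqrt pi)%:E.
Proof.
have pi0 := pi_ge0 R.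
have E : (gamma_int (1 / 2) * gamma_int (1 / 2) = pi%:E)%E.
  rewrite gamma_beta (_ : 1 / 2 + 1 / 2 = 1) ?gamma_int1 ?mule1; last by field.
  rewrite /beta_int -integral_sqrt_weight; apply: eq_integral => v; rewrite inE => /in_oy v0.
  have -> : 1 / 2 - 1 = - 2^-1 :> R by field.
  have -> : 1 / 2 + 1 / 2 = 1 :> R by field.
  have e1 : v `^ (- 2^-1) = (Num.sqrt v)^-1 by rewrite powRN (powR12_sqrt (ltW v0)).
  have v1 : 0 <= 1 + v by rewrite addr_ge0 ?ltW.
  by rewrite e1 (powR_inv1 v1) invfM.
move: E (gamma_int_ge0 (1 / 2)); case: (gamma_int _) => [r||]//=.
- rewrite -EFinM => -[E]; rewrite lee_fin => r0; congr (_%:E).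
  by rewrite -E -expr2 sqrtr_sqr ger0_norm.
Qed.

(** On ]0, 1[ the power t^(s-1) is at least 1 because s <= 1, so the integral is at least
    exp(-1). *)
Lemma gamma_int_gt0 s : 0 < s <= 1 -> (0 < gamma_int s)%E.
Proof.
move=> /andP[s0 s1]; apply: (@lt_le_trans _ _ (expR (-1))%:E); first by rewrite lte_fin expR_gt0.
have -> : ((expR (-1))%:E = \int[mu]_(t in `]0%R, 1%R[) (expR (-1))%:E)%E.
  have h := integral_cst mu (measurable_itv `]0, 1[) (expR (-1))%:E.
  have h1 : (mu `]0%R, 1%R[ = 1)%E.
    by rewrite lebesgue_measure_itv /= lte_fin ltr01 oppr0 adde0.
  by rewrite -[LHS]mule1 -h1; exact/esym.
have m (D : set R) : measurable D ->
    measurable_fun D (fun t : R => (t `^ (s - 1) * expR (- t))%:E).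
  move=> mD; apply: measurable_funTS; apply/measurable_EFinP; mfun_tac.
have p (t : R) : (0 <= (t `^ (s - 1) * expR (- t))%:E)%E.
  by rewrite lee_fin mulr_ge0 ?powR_ge0 ?expR_ge0.
apply: (@le_trans _ _ (\int[mu]_(t in `]0%R, 1%R[) (t `^ (s - 1) * expR (- t))%:E)%E).
  apply: ge0_le_integral => //; first exact: m.
  move=> t; rewrite /= in_itv /= => /andP[t0 t1]; rewrite lee_fin.
  have h : 1 <= t `^ (s - 1).
    have q : t `^ (1 - s) <= 1.
      have s10 : 0 <= 1 - s by rewrite subr_ge0.
      have := ge0_ler_powR s10 (ltW t0 : t \is Num.nneg) (ler01 : 1 \is Num.nneg) (ltW t1).
      by rewrite powR1.
    have -> : s - 1 = - (1 - s) by ring.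
    by rewrite powRN invf_ge1 ?powR_gt0.
  apply: le_trans (ler_peMl (expR_ge0 _) h).
  by rewrite ler_expR lerN2 ltW.
apply: ge0_subset_integral => //; [exact: m|].
by move=> t; rewrite /= !in_itv /= andbT => /andP[].
Qed.

End GammaBeta.

(** * The hypergeometric bracket *)

Section ArcsinhSeries.
Variable R : realType.
Notation mu := (@lebesgue_measure R).
Implicit Types (x y v : R) (k n N M : nat).

Lemma pochhammerS (a : R) n : pochhammer a n.+1 = pochhammer a n * (a + n%:R).
Proof. by rewrite /pochhammer big_ord_recr. Qed.

Lemma pochhammer0 (a : R) : pochhammer a 0 = 1.
Proof. by rewrite /pochhammer big_ord0. Qed.

Definition half_coef k : R := pochhammer (1 / 2) k / k`!%:R.
Local Notation b := half_coef.

Lemma half_coef0 : b 0 = 1.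
Proof. by rewrite /b pochhammer0 divr1. Qed.

Lemma half_coefS k : (2 * k%:R + 2) * b k.+1 = (2 * k%:R + 1) * b k.
Proof.
rewrite /b pochhammerS factS natrM -[k.+1%:R]natr1.
have f0 : k`!%:R != 0 :> R by rewrite pnatr_eq0 -lt0n fact_gt0.
have k0 : k%:R + 1 != 0 :> R by rewrite natr1 pnatr_eq0.
by move: (k%:R) (k`!%:R) f0 k0 => K f f0 k0; field; rewrite f0 k0.
Qed.

Lemma half_coef_gt0 k : 0 < b k.
Proof.
by rewrite /b divr_gt0 ?ltr0n ?fact_gt0// /pochhammer prodr_gt0.
Qed.

(** The induction step is (2k+1)(2k+3) <= (2k+2)^2. The bound forces the coefficients to tend to
    0. *)
Lemma half_coef_sqr k : (2 * k%:R + 1) * b k ^+ 2 <= 1.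
Proof.
elim: k => [|k IH]; first by rewrite half_coef0 mulr0 add0r expr1n mulr1.
have := half_coefS k; have := half_coef_gt0 k; have := half_coef_gt0 k.+1.
rewrite -[k.+1%:R]natr1; have := ler0n R k; move: (k%:R) (b k) (b k.+1) IH => K u v IH K0 v0 u0 E.
have E2 : (2 * K + 2) ^+ 2 * v ^+ 2 = (2 * K + 1) ^+ 2 * u ^+ 2 by rewrite -!exprMn E.
have h1 : (2 * K + 2) ^+ 2 * v ^+ 2 <= 2 * K + 1.
  rewrite E2 expr2 -mulrA ler_piMr//; lra.
have p : 0 < (2 * K + 2) ^+ 2 by rewrite exprn_gt0//; lra.
have K3 : 0 <= 2 * K + 3 by lra.
rewrite -(ler_pM2l p) mulr1; have := ler_wpM2l K3 h1; nra.
Qed.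

Lemma cvg_half_coef : b k @[k --> \oo] --> (0 : R).
Proof.
apply/cvgrPdist_le => e e0; near=> k.
rewrite sub0r normrN gtr0_norm ?half_coef_gt0//.
have : (e ^+ 2)^-1 <= k%:R by near: k; exact: nbhs_infty_ger.
have e20 : 0 < e ^+ 2 by rewrite exprn_gt0.
rewrite -[_^-1]mul1r ler_pdivrMr// => h.
rewrite leNgt; apply/negP => be.
have := half_coef_sqr k; apply/negP; rewrite -ltNge.
have h2 : e ^+ 2 < b k ^+ 2 by move: e0 be; move: (b k) => B; nra.
have := ler0n R k; nra.
Unshelve. all: by end_near. Qed.

Definition alt_sum N y : R := \sum_(k < N) (-1) ^+ k * b k * y ^+ k.
(** The factor k cancels the term k = 0, where the truncated exponent [k.-1] would be
    meaningless. *)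
Definition alt_sum' N y : R := \sum_(k < N) (-1) ^+ k * b k * (k%:R * y ^+ k.-1).

Lemma alt_sumS N : alt_sum N.+1 = fun y => alt_sum N y + (-1) ^+ N * b N * y ^+ N.
Proof. by apply/funext => y; rewrite /alt_sum big_ord_recr. Qed.

Lemma is_derive_alt_sum N y : is_derive y 1 (alt_sum N) (alt_sum' N y).
Proof.
elim: N => [|N IH].
  rewrite /alt_sum' big_ord0 (_ : alt_sum 0 = fun=> 0); first exact: derive_cst.
  by apply/funext => z; rewrite /alt_sum big_ord0.
rewrite alt_sumS /alt_sum' big_ord_recr /=; apply: (derive_add _ _ _ _ _ _ IH).
by derive_eq; ring.
Qed.

(* The partial sums of the binomial series of (1+y)^(-1/2) satisfy its
   differential equation up to a single monomial. *)
Lemma alt_sum_ode N y :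
  alt_sum N y + 2 * (1 + y) * alt_sum' N y = - (-1) ^+ N * (2 * N%:R * b N * y ^+ N.-1).
Proof.
elim: N => [|N IH]; first by rewrite /alt_sum /alt_sum' !big_ord0; ring.
rewrite /alt_sum' alt_sumS big_ord_recr /= -/(alt_sum' N y).
have yN : N%:R * y ^+ N.-1 * y = N%:R * y ^+ N.
  by case: N {IH} => [|N]; rewrite ?mul0r// -mulrA -exprSr.
have bN := half_coefS N.
have -> : - (-1) ^+ N.+1 * (2 * N.+1%:R * b N.+1 * y ^+ N) =
    (-1) ^+ N * ((2 * N%:R + 1) * b N) * y ^+ N.
  by rewrite -bN exprS -natr1; ring.
have -> : alt_sum N y + (-1) ^+ N * b N * y ^+ N +
   2 * (1 + y) * (alt_sum' N y + (-1) ^+ N * b N * (N%:R * y ^+ N.-1)) =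
   (alt_sum N y + 2 * (1 + y) * alt_sum' N y) + (-1) ^+ N * b N * y ^+ N +
   2 * (-1) ^+ N * b N * (N%:R * y ^+ N.-1 + N%:R * y ^+ N.-1 * y) by ring.
by rewrite IH yN; ring.
Qed.

Lemma le_of_derive (f f' : R -> R) (x y : R) : x <= y ->
  (forall t, x <= t <= y -> is_derive t 1 f (f' t)) ->
  (forall t, x <= t <= y -> 0 <= f' t) -> f x <= f y.
Proof.
move=> xy df f0; have [||c cxy E] := @MVT_segment _ f f' x y xy.
- by move=> t; rewrite in_itv /= => /andP[t1 t2]; apply: df; rewrite !ltW.
- apply: derivable_within_continuous => t; rewrite in_itv /= => /df h.
  exact: (@ex_derive _ _ _ _ _ _ _ h).
- by rewrite -subr_ge0 E mulr_ge0 ?subr_ge0// f0//; rewrite in_itv in cxy.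
Qed.

Lemma alt_sum_at0 N : alt_sum N.+1 0 = 1.
Proof.
rewrite /alt_sum big_ord_recl /= half_coef0 expr0 !mul1r big1 ?addr0// => i _.
by rewrite /bump /= add1n expr0n /= mulr0.
Qed.

(** By [alt_sum_ode] with an even number N of terms, h = sqrt(1 + t) [alt_sum N t] decreases from 1,
    with derivative -r / sqrt(1 + t) where r is the derivative of b_N t^N. Hence h + b_N t^N
    increases from 1. *)
Lemma alt_sum_bound M y : 0 <= y ->  y <= 1 ->
  alt_sum M.*2 y <= (Num.sqrt (1 + y))^-1 <= alt_sum M.*2 y + b M.*2.
Proof.
move=> y0 y1; have s1 (t : R) : 0 <= t -> 1 <= Num.sqrt (1 + t).
  by move=> t0; rewrite -[leLHS]sqrtr1 ler_wsqrtr// lerDl.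
have s0 (t : R) : 0 <= t -> 0 < Num.sqrt (1 + t) by move=> /s1; exact: lt_le_trans.
(* The empty sum is treated apart: its value at 0 is 0, whereas every nonempty partial sum starts
   from 1. *)
case: M => [|M].
  rewrite /alt_sum big_ord0 half_coef0 add0r invr_ge0 sqrtr_ge0 /=.
  by rewrite invf_le1 ?s1 ?s0.
have signN : (-1) ^+ M.+1.*2 = 1 :> R by rewrite -signr_odd odd_double.
have at0 : alt_sum M.+1.*2 0 = 1 by rewrite doubleS alt_sum_at0.
have N0 : (0 < M.+1.*2)%N by rewrite doubleS.
move: (M.+1.*2) signN at0 N0 => N signN at0 N0.
pose h t : R := Num.sqrt (1 + t) * alt_sum N t.
pose r t : R := N%:R * b N * t ^+ N.-1.
have r0 (t : R) : 0 <= t -> 0 <= r t.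
  by move=> t0; rewrite /r mulr_ge0 ?exprn_ge0// mulr_ge0// ltW// half_coef_gt0.
have dh (t : R) : 0 <= t -> is_derive t 1 h (- r t / Num.sqrt (1 + t)).
  move=> t0; have q0 := s0 _ t0.
  have t10 : 0 < 1 + t by rewrite ltr_wpDr.
  have ds := is_derive_alt_sum N t.
  have dq : is_derive t 1 (fun t => Num.sqrt (1 + t)) ((2 * Num.sqrt (1 + t))^-1).
    by derive_eq => //; rewrite add0r mul1r.
  have hM := derive_mul _ _ _ _ _ _ dq ds; apply: is_derive_eq hM _.
  have ode := alt_sum_ode N t; rewrite signN in ode.
  have E : - r t = (alt_sum N t + 2 * (1 + t) * alt_sum' N t) / 2 by rewrite ode /r; field.
  have q2 : 1 + t = Num.sqrt (1 + t) ^+ 2 by rewrite sqr_sqrtr// ltW.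
  rewrite E [X in 2 * X * _]q2; move: (Num.sqrt (1 + t)) q0 => q q0.
  by field; rewrite gt_eqF.
have h1 : h 0 = 1 by rewrite /h at0 addr0 sqrtr1 mulr1.
have q0 := s0 _ y0.
have up : h y <= 1.
  rewrite -h1 -lerN2; apply: (@le_of_derive (fun t => - h t) (fun t => r t / Num.sqrt (1 + t))) => //.
    move=> t /andP[t0 _]; have hO := derive_opp _ _ _ _ (dh _ t0); apply: is_derive_eq hO _.
    by rewrite mulNr opprK.
  by move=> t /andP[t0 _]; rewrite divr_ge0 ?r0// ltW// s0.
have lo : 1 <= h y + b N * y ^+ N.
  have -> : 1 = h 0 + b N * 0 ^+ N by rewrite h1 expr0n -[N](prednK N0) /= mulr0 addr0.
  apply: (@le_of_derive (fun t => h t + b N * t ^+ N)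
      (fun t => - r t / Num.sqrt (1 + t) + r t)) => //.
    move=> t /andP[t0 _]; apply: derive_add; first exact: dh.
    by derive_eq; rewrite /r; ring.
  move=> t /andP[t0 _]; rewrite mulNr addrC subr_ge0 ler_pdivrMr ?s0//.
  by rewrite ler_peMr ?r0 ?s1.
apply/andP; split; first by rewrite -[leRHS]mul1r ler_pdivlMr// mulrC.
rewrite -[leLHS]mul1r ler_pdivrMr//; apply: (le_trans lo).
rewrite mulrDl /h mulrC lerD2l ler_wpM2l ?(ltW (half_coef_gt0 _))//.
by apply: le_trans (s1 _ y0); rewrite exprn_ile1.
Qed.

Definition asinh_sum N x : R := \sum_(k < N) (-1) ^+ k * (b k * (x ^+ (2 * k + 1) / (2 * k%:R + 1))).
Definition asinh x : R := ln (x + Num.sqrt (1 + x ^+ 2)).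

Lemma is_derive_asinh_sum N x : is_derive x 1 (asinh_sum N) (alt_sum N (x ^+ 2)).
Proof.
elim: N => [|N IH].
  rewrite /alt_sum big_ord0 (_ : asinh_sum 0 = fun=> 0); first exact: derive_cst.
  by apply/funext => z; rewrite /asinh_sum big_ord0.
rewrite alt_sumS (_ : asinh_sum N.+1 = fun x => asinh_sum N x +
   (-1) ^+ N * (b N * (x ^+ (2 * N + 1) / (2 * N%:R + 1)))); last first.
  by apply/funext => z; rewrite /asinh_sum big_ord_recr.
apply: (derive_add _ _ _ _ _ _ IH); derive_eq.
rewrite addn1 /= -exprM -[(2 * N).+1%:R]natr1 natrM.
have n0 : 2 * N%:R + 1 != 0 :> R by rewrite gt_eqF// ltr_wpDl// mulr_ge0.
by move: (N%:R) (x ^+ (2 * N)) n0 => n p n0; field.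
Qed.

Lemma is_derive_asinh x : 0 <= x -> is_derive x 1 asinh (Num.sqrt (1 + x ^+ 2))^-1.
Proof.
move=> x0; rewrite /asinh.
have p0 : 0 < 1 + x ^+ 2 by rewrite ltr_wpDr// sqr_ge0.
have q0 : 0 < Num.sqrt (1 + x ^+ 2) by rewrite sqrtr_gt0.
have l0 : 0 < x + Num.sqrt (1 + x ^+ 2) by rewrite ltr_wpDl.
derive_eq => //; move: (Num.sqrt _) q0 l0 => q q0 l0.
by rewrite /= expr1; field; rewrite !gt_eqF.
Qed.

(** All three functions vanish at 0, and their derivatives at t are compared by [alt_sum_bound] at
    t^2. *)
Lemma asinh_bound M x : 0 <= x <= 1 ->
  asinh_sum M.*2 x <= asinh x <= asinh_sum M.*2 x + b M.*2 * x.
Proof.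
move=> /andP[x0 x1].
have z0 N : asinh_sum N 0 = 0.
  by rewrite /asinh_sum big1// => i _; rewrite addn1 expr0n /= mul0r !mulr0.
have a0 : asinh 0 = 0 by rewrite /asinh expr0n /= addr0 sqrtr1 add0r ln1.
have sq (t : R) : 0 <= t <= x -> 0 <= t ^+ 2 /\ t ^+ 2 <= 1.
  by move=> /andP[t0 tx]; rewrite sqr_ge0 exprn_ile1// (le_trans tx).
apply/andP; split.
  rewrite -subr_ge0.
  have -> : 0 = asinh 0 - asinh_sum M.*2 0 by rewrite z0 a0 subr0.
  apply: (@le_of_derive (fun t => asinh t - asinh_sum M.*2 t)
    (fun t => (Num.sqrt (1 + t ^+ 2))^-1 - alt_sum M.*2 (t ^+ 2))) => //.
    move=> t /andP[t0 _]; apply: derive_add; first exact: is_derive_asinh.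
    by apply: derive_opp; exact: is_derive_asinh_sum.
  move=> t /sq[h1 h2]; rewrite subr_ge0.
  by have /andP[] := alt_sum_bound M _ h1 h2.
rewrite -subr_ge0.
have -> : 0 = asinh_sum M.*2 0 + b M.*2 * 0 - asinh 0 by rewrite z0 a0 mulr0 addr0 subr0.
apply: (@le_of_derive (fun t => asinh_sum M.*2 t + b M.*2 * t - asinh t)
  (fun t => alt_sum M.*2 (t ^+ 2) + b M.*2 - (Num.sqrt (1 + t ^+ 2))^-1)) => //.
  move=> t /andP[t0 _]; apply: derive_add; last first.
    by apply: derive_opp; exact: is_derive_asinh.
  apply: (derive_add _ _ _ (fun t => b M.*2 * t)); first exact: is_derive_asinh_sum.
  by derive_eq; rewrite mul0r add0r mulr1.
move=> t /sq[h1 h2]; rewrite subr_ge0.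
by have /andP[] := alt_sum_bound M _ h1 h2.
Qed.

End ArcsinhSeries.

(** * The integral of arcsinh(sqrt z) / (sqrt v (1 + v)) *)

Section WeightedArcsinh.
Variable R : realType.
Notation mu := (@lebesgue_measure R).
Notation s2 := (Num.sqrt (2 : R)).
Implicit Types (s v q y : R).

Definition weight v : R := (Num.sqrt v * (1 + v))^-1.
Definition arc v : R := Num.sqrt (2 * Num.sqrt v / (1 + v)).

Let sqrt2_gt0 : 0 < s2. Proof. by rewrite sqrtr_gt0. Qed.
Let sqrt2_sqr : s2 ^+ 2 = 2. Proof. by rewrite sqr_sqrtr. Qed.

(* The integrand of arcsinh(sqrt z) / (sqrt v (1 + v)) written as an integral over
   [s] in ]0, 1[. *)
Definition kernel v s : R :=
  let q := Num.sqrt v in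
  s2 * Num.sqrt q * (1 + q) / (q * (1 + q ^+ 2) * ((1 + q) ^+ 2 - 2 * q * s ^+ 2)).

Lemma kernel_den q s : 0 < q -> 0 < s < 1 -> 0 < (1 + q) ^+ 2 - 2 * q * s ^+ 2.
Proof.
move=> q0 /andP[s0 s1]; have s21 : s ^+ 2 < 1 by nra.
have h : 0 < q * (1 - s ^+ 2) by rewrite mulr_gt0// subr_gt0.
by have := sqr_ge0 q; nra.
Qed.

Lemma kernel_ge0 v s : 0 < v -> 0 < s < 1 -> 0 <= kernel v s.
Proof.
move=> v0 hs; have q0 : 0 < Num.sqrt v by rewrite sqrtr_gt0.
rewrite /kernel; apply: divr_ge0; first by rewrite !mulr_ge0 ?sqrtr_ge0// addr_ge0 ?ltW.
apply: mulr_ge0; last by rewrite ltW// kernel_den.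
by apply: mulr_ge0; [exact: ltW|rewrite addr_ge0 ?sqr_ge0].
Qed.

(** With t = sqrt(2q) and r = sqrt(1 + v), [arc v] is t/r and r^2 = (1 + q)^2 - t^2. Therefore
    arcsinh(t/r) is half the logarithm of (1 + q + t)/(1 + q - t), and inserting s in front of t
    gives a primitive of the kernel. *)
Lemma asinh_kernel v : 0 < v ->
  (\int[mu]_(s in `]0%R, 1%R[) (kernel v s)%:E = (weight v * asinh R (arc v))%:E)%E.
Proof.
move=> v0; set q := Num.sqrt v; have q0 : 0 < q by rewrite sqrtr_gt0.
have qq : q ^+ 2 = v by rewrite sqr_sqrtr// ltW.
set t := s2 * Num.sqrt q; have t0 : 0 < t by rewrite mulr_gt0// sqrtr_gt0.
have tt : t ^+ 2 = 2 * q by rewrite exprMn sqrt2_sqr sqr_sqrtr// ltW.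
have t1q : t < 1 + q.
  by rewrite -(@ltr_pXn2r _ 2)// ?nnegrE ?addr_ge0 ?ltW// tt; have := sqr_ge0 q; nra.
set r := Num.sqrt (1 + v); have r0 : 0 < r by rewrite sqrtr_gt0 addr_gt0.
have rr : r ^+ 2 = 1 + q ^+ 2 by rewrite sqr_sqrtr ?qq// addr_ge0// ltW.
pose F (s : R) : R := weight v / 2 * (ln (1 + q + t * s) - ln (1 + q - t * s)).
have pp (s : R) : 0 <= s <= 1 -> 0 < 1 + q + t * s /\ 0 < 1 + q - t * s.
  move=> /andP[h0 h1]; split; nra.
have cF (s : R) : 0 <= s <= 1 -> {for s, continuous F}.
  by move=> /pp[h1 h2]; rewrite /F; cont_tac.
have F0 : F 0 = 0 by rewrite /F !mulr0 subr0 addr0 subrr mulr0.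
have F1 : F 1 = weight v * asinh R (arc v).
  rewrite /F /asinh !mulr1 -mulrA; congr (_ * _).
  have arcE : arc v = t / r.
    rewrite /arc -/q -tt -qq -rr -expr_div_n sqrtr_sqr ger0_norm//.
    by rewrite divr_ge0 ?ltW.
  have -> : Num.sqrt (1 + arc v ^+ 2) = (1 + q) / r.
    rewrite arcE (_ : 1 + (t / r) ^+ 2 = ((1 + q) / r) ^+ 2).
      by rewrite sqrtr_sqr ger0_norm// divr_ge0 ?addr_ge0 ?ltW.
    have e : r ^+ 2 + t ^+ 2 = (1 + q) ^+ 2 by rewrite rr tt; ring.
    have rn := gt_eqF r0.
    transitivity ((r ^+ 2 + t ^+ 2) / r ^+ 2); first by field; rewrite rn.
    by rewrite e expr_div_n.
  have tm : 0 < 1 + q - t by rewrite subr_gt0.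
  have tp : 0 < 1 + q + t by rewrite !addr_gt0.
  rewrite arcE -mulrDl (addrC t) lnM ?posrE ?invr_gt0// lnV ?posrE//.
  have : ln (r ^+ 2) = ln (1 + q + t) + ln (1 + q - t).
    rewrite -lnM ?posrE//; congr ln; rewrite rr.
    by transitivity ((1 + q) ^+ 2 - t ^+ 2); [rewrite tt|]; ring.
  by rewrite lnXn// -mulr_natr; lra.
have -> : weight v * asinh R (arc v) = F 1 - F 0 by rewrite F0 F1 subr0.
apply: (@ge0_FTC_oo R (fun s => kernel v s) F 0 1 (F 0) (F 1) ltr01).
- by move=> s hs; exact: kernel_ge0.
- move=> s hs; rewrite /kernel -/q; cont_tac.
  by rewrite !mulf_neq0 ?gt_eqF ?kernel_den// addr_gt0 ?exprn_gt0.
- move=> s hs; have /pp[p1 p2] : 0 <= s <= 1 by case/andP: hs => h1 h2; rewrite !ltW.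
  have kd := kernel_den _ _ q0 hs.
  rewrite /F /kernel /weight -/q -/t -[in 1 + v]qq; derive_eq => //.
  have -> : (1 + q) ^+ 2 - 2 * q * s ^+ 2 = (1 + q + t * s) * (1 + q - t * s).
    by rewrite -tt; ring.
  have q1 : 1 + q ^+ 2 != 0 by rewrite gt_eqF// addr_gt0 ?exprn_gt0.
  move: (gt_eqF p1) (gt_eqF p2) (gt_eqF q0) => n1 n2 n3.
  by field; rewrite q1 n1 n2 n3.
- by apply: cvg_at_right_filter; apply: cF; rewrite lexx ler01.
- by apply: cvg_at_left_filter; apply: cF; rewrite lexx ler01.
Qed.

Lemma cvg_eta_oo (c : R) : 0 < c ->
  atan ((Num.sqrt (Num.sqrt v) - (Num.sqrt (Num.sqrt v))^-1) / c) @[v --> +oo] --> pi / 2.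
Proof.
move=> c0; apply: (cvg_comp _ _ _ (@cvgy_atan R)).
apply/cvgryPge => A; near=> v.
have h1 : (`|A| * c + 1) ^+ 2 ^+ 2 <= v by near: v; apply: nbhs_pinfty_ge; rewrite num_real.
have B0 : 0 <= `|A| * c by rewrite mulr_ge0// ltW.
have h2 : `|A| * c + 1 <= Num.sqrt (Num.sqrt v).
  have e (x : R) : 0 <= x -> x = Num.sqrt (x ^+ 2) by move=> x0; rewrite sqrtr_sqr ger0_norm.
  rewrite (e (_ + _)) ?addr_ge0// ler_wsqrtr// (e (_ ^+ 2)) ?sqr_ge0//.
  exact: ler_wsqrtr.
move: (Num.sqrt _) h2 => y h2; have y1 : 1 <= y by lra.
have yi : y^-1 <= 1 by rewrite invf_le1// (lt_le_trans ltr01).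
rewrite ler_pdivlMr//.
have := ler_norm A; nra.
Unshelve. all: by end_near. Qed.

Lemma cvg_eta_0 (c : R) : 0 < c ->
  atan ((Num.sqrt (Num.sqrt v) - (Num.sqrt (Num.sqrt v))^-1) / c) @[v --> 0^'+] --> - (pi / 2).
Proof.
move=> c0.
have -> : (fun v : R => atan ((Num.sqrt (Num.sqrt v) - (Num.sqrt (Num.sqrt v))^-1) / c)) =
   (fun v : R => - atan (((Num.sqrt (Num.sqrt v))^-1 - Num.sqrt (Num.sqrt v)) / c)).
  by apply/funext => v; rewrite -atanN -mulNr opprB.
apply: cvgN; apply: (cvg_comp _ _ _ (@cvgy_atan R)).
apply/cvgryPge => A.
have B0 : 0 <= `|A| * c by rewrite mulr_ge0// ltW.
have B1 : 0 < (`|A| * c + 1)^-1 by rewrite invr_gt0 ltr_wpDl.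
near=> v; have v0 : 0 < v by near: v; exact: nbhs_right_gt.
have h1 : v <= (`|A| * c + 1)^-1 ^+ 2 ^+ 2.
  by near: v; apply: nbhs_right_le; do 2 apply: exprn_gt0.
have h2 : Num.sqrt (Num.sqrt v) <= (`|A| * c + 1)^-1.
  have e (x : R) : 0 <= x -> x = Num.sqrt (x ^+ 2) by move=> x0; rewrite sqrtr_sqr ger0_norm.
  rewrite (e _ (ltW B1)) ler_wsqrtr// (e (_ ^+ 2)) ?sqr_ge0//.
  exact: ler_wsqrtr.
have y0 : 0 < Num.sqrt (Num.sqrt v) by rewrite !sqrtr_gt0.
move: (Num.sqrt (Num.sqrt v)) y0 h2 => y y0 h2.
have yi : `|A| * c + 1 <= y^-1 by rewrite -[leLHS]invrK lef_pV2 ?posrE.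
have y1 : y <= 1 by apply: (le_trans h2); rewrite invf_le1 ?lerDr// ltr_wpDl.
rewrite ler_pdivlMr//.
have := ler_norm A; nra.
Unshelve. all: by end_near. Qed.

Lemma derive_atan_div (c x e : R) (f : R -> R) : 0 < c -> is_derive x 1 f e ->
  is_derive x 1 (fun y => atan (f y / c)) (e * c / (c ^+ 2 + f x ^+ 2)).
Proof.
move=> c0 df.
have h : is_derive x 1 (fun y => f y * c^-1) (e / c).
  have h := derive_mul _ _ _ _ _ _ df (derive_cst R x c^-1).
  by apply: is_derive_eq h _; rewrite mulr0 addr0.
have := derive_atan _ _ _ _ h; move=> h'; apply: is_derive_eq h' _.
have p : c ^+ 2 + f x ^+ 2 != 0 by rewrite gt_eqF// ltr_pwDl ?exprn_gt0 ?sqr_ge0.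
by move: (f x) (gt_eqF c0) p => z n p; field; rewrite n p.
Qed.

Lemma integral_kernel s : 0 < s < 1 ->
  (\int[mu]_(v in `]0%R, +oo[) (kernel v s)%:E =
   (2 * pi / (Num.sqrt (2 - s ^+ 2) * (Num.sqrt (2 - s ^+ 2) + 1)))%:E)%E.
Proof.
move=> hs; have s21 : s ^+ 2 < 1 by case/andP: hs => h1 h2; nra.
set r := Num.sqrt (2 - s ^+ 2); have r0 : 0 < r by rewrite sqrtr_gt0; lra.
have rr : r ^+ 2 = 2 - s ^+ 2 by rewrite sqr_sqrtr; lra.
(* The variable y - 1/y, with y = v^(1/4), runs over the whole line. Both quadratic factors of the
   denominator become its square plus a constant, 2 and 2 r^2, so partial fractions give two
   arctangents. *)
pose y v : R := Num.sqrt (Num.sqrt v).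
pose A c v : R := atan ((y v - (y v)^-1) / c).
pose F v : R := 2 / (1 - s ^+ 2) * (A s2 v - r^-1 * A (s2 * r) v).
have sr0 : 0 < s2 * r by rewrite mulr_gt0.
have s1 : 1 - s ^+ 2 != 0 by rewrite gt_eqF// subr_gt0.
have -> : 2 * pi / (r * (r + 1)) =
   2 / (1 - s ^+ 2) * (pi / 2 - r^-1 * (pi / 2)) -
   2 / (1 - s ^+ 2) * (- (pi / 2) - r^-1 * - (pi / 2)).
  have -> : 1 - s ^+ 2 = (r - 1) * (r + 1).
    by transitivity (r ^+ 2 - 1); [rewrite rr|]; ring.
  have r1 : 1 < r by rewrite -(@ltr_pXn2r _ 2)// ?nnegrE ?ltW// rr expr1n; lra.
  have n1 : r - 1 != 0 by rewrite gt_eqF// subr_gt0.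
  have n2 : r + 1 != 0 by rewrite gt_eqF// addr_gt0.
  have n3 : r != 0 by rewrite gt_eqF.
  by field; rewrite n1 n2 n3.
apply: (@ge0_FTC_oy R (fun v => kernel v s) F 0
  (2 / (1 - s ^+ 2) * (- (pi / 2) - r^-1 * - (pi / 2)))
  (2 / (1 - s ^+ 2) * (pi / 2 - r^-1 * (pi / 2)))).
- by move=> v v0; exact: kernel_ge0.
- move=> v v0; have q0 : 0 < Num.sqrt v by rewrite sqrtr_gt0.
  rewrite /kernel; cont_tac.
  by rewrite !mulf_neq0 ?gt_eqF ?kernel_den// addr_gt0 ?exprn_gt0.
- move=> v v0; have q0 : 0 < Num.sqrt v by rewrite sqrtr_gt0.
  have y0 : 0 < y v by rewrite sqrtr_gt0.
  have yy : Num.sqrt v = y v ^+ 2 by rewrite sqr_sqrtr// ltW.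
  have dy : is_derive v 1 y (4 * y v ^+ 3)^-1.
    rewrite /y; derive_eq => //; rewrite -/(y v) yy.
    by have n := gt_eqF y0; field; rewrite n.
  have deta : is_derive v 1 (fun v => y v - (y v)^-1) ((y v ^+ 2 + 1) / (4 * y v ^+ 5)).
    have n : y v != 0 by rewrite gt_eqF.
    have h := derive_add _ _ _ _ _ _ dy (derive_opp _ _ _ _ (derive_inv _ _ _ _ n dy)).
    by apply: is_derive_eq h _; field; rewrite n.
  have d1 := derive_atan_div _ _ _ _ sqrt2_gt0 deta.
  have d2 := derive_atan_div _ _ _ _ sr0 deta.
  have d3 := derive_mul _ _ _ _ _ _ (derive_cst R v r^-1) d2.
  have d4 := derive_add _ _ _ _ _ _ d1 (derive_opp _ _ _ _ d3).
  have d5 := derive_mul _ _ _ _ _ _ (derive_cst R v (2 / (1 - s ^+ 2))) d4.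
  apply: is_derive_eq d5 _; rewrite /kernel yy -/(y v).
  have -> : Num.sqrt (y v ^+ 2) = y v by rewrite -yy.
  have kd := kernel_den _ _ q0 hs; rewrite yy in kd.
  have e1 : s2 ^+ 2 + (y v - (y v)^-1) ^+ 2 = (1 + y v ^+ 2 ^+ 2) / y v ^+ 2.
    by rewrite sqrt2_sqr; have n := gt_eqF y0; field; rewrite n.
  have e2 : (s2 * r) ^+ 2 + (y v - (y v)^-1) ^+ 2 =
      ((1 + y v ^+ 2) ^+ 2 - 2 * y v ^+ 2 * s ^+ 2) / y v ^+ 2.
    by rewrite exprMn sqrt2_sqr rr; have n := gt_eqF y0; field; rewrite n.
  rewrite e1 e2.
  have n1 : 1 + y v ^+ 2 ^+ 2 != 0 by rewrite gt_eqF// addr_gt0 ?exprn_gt0.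
  have n2 := gt_eqF kd; have n3 := gt_eqF y0; have n4 := gt_eqF r0.
  move: (y v) n1 n2 n3 => Y n1 n2 n3.
  by field; rewrite n1 n2 n3 n4 s1.
- rewrite /F; apply: cvgMr; apply: cvgB; first exact: cvg_eta_0.
  by apply: cvgMr; exact: cvg_eta_0.
- rewrite /F; apply: cvgMr; apply: cvgB; first exact: cvg_eta_oo.
  by apply: cvgMr; exact: cvg_eta_oo.
Qed.

Let frac_aux (x y p m c N z : R) : p != 0 -> m != 0 -> x * m - y * p = N ->
  0 * z + c * (x / p + - (y / m)) = c * (N / (p * m)).
Proof. by move=> p0 m0 <-; field; rewrite p0 m0. Qed.

Lemma integral_sqrt_recip :
  (\int[mu]_(s in `]0%R, 1%R[)
    (2 * pi / (Num.sqrt (2 - s ^+ 2) * (Num.sqrt (2 - s ^+ 2) + 1)))%:E = (pi * ln 2)%:E)%E.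
Proof.
pose r s : R := Num.sqrt (2 - s ^+ 2).
pose la : R := s2 - 1.
(* Put s = sqrt 2 sin x and u = tan(x/2) = s / (sqrt 2 + r). The integral becomes that of 2 la / (1
   - la^2 u^2) du, whose primitive is ln((1 + la u)/(1 - la u)). *)
pose F s : R := 2 * pi * (ln (s2 + r s + la * s) - ln (s2 + r s - la * s)).
have s21 : 1 < s2 by rewrite -[ltLHS]sqrtr1 ltr_sqrt// ltr1n.
have la0 : 0 < la by rewrite subr_gt0.
have la1 : la < s2 by rewrite /la; lra.
have rp s : 0 <= s <= 1 -> 0 < r s.
  by move=> /andP[h1 h2]; rewrite sqrtr_gt0; nra.
have rr s : 0 <= s <= 1 -> r s ^+ 2 = 2 - s ^+ 2.
  by move=> /andP[h1 h2]; rewrite sqr_sqrtr//; nra.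
have pp s : 0 <= s <= 1 -> 0 < s2 + r s + la * s /\ 0 < s2 + r s - la * s.
  by move=> hs; have := rp _ hs; case/andP: hs => h1 h2 h3; split; nra.
have cF s : 0 <= s <= 1 -> {for s, continuous F}.
  by move=> /pp[h1 h2]; rewrite /F /r; cont_tac.
have oo s : 0 < s < 1 -> 0 <= s <= 1 by move=> /andP[h1 h2]; rewrite !ltW.
have r1 : r 1 = 1 by rewrite /r expr1n (_ : 2 - 1 = 1) ?sqrtr1//; lra.
have -> : pi * ln 2 = F 1 - F 0.
  rewrite /F r1 !mulr0 addr0 subr0 subrr mulr0 subr0 !mulr1.
  have -> : s2 + 1 + la = 2 * s2 by rewrite /la; ring.
  have -> : s2 + 1 - la = 2 by rewrite /la; ring.
  rewrite lnM ?posrE//.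
  have : ln (s2 ^+ 2) = ln 2 by rewrite sqrt2_sqr.
  rewrite lnXn// -mulr_natr => h; rewrite -h; ring.
apply: (@ge0_FTC_oo R (fun s => 2 * pi / (r s * (r s + 1))) F 0 1 (F 0) (F 1) ltr01).
- move=> s /oo/rp h; rewrite divr_ge0 ?mulr_ge0 ?pi_ge0 ?addr_ge0 ?ltW//.
- move=> s /oo/rp h; rewrite -/(r s) /r; cont_tac.
  by rewrite mulf_neq0 ?gt_eqF// addr_gt0.
- move=> s /oo hs; have [p1 p2] := pp _ hs; have h := rp _ hs.
  have dr : is_derive s 1 r (- s / r s).
    rewrite /r; derive_eq; first by rewrite -sqrtr_gt0.
    by rewrite -/(r s); have n := gt_eqF h; rewrite /= expr1; field; rewrite n.
  have d1 : is_derive s 1 (fun s => s2 + r s + la * s) (- s / r s + la).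
    have := derive_add _ _ _ _ _ _ (derive_add _ _ _ _ _ _ (derive_cst R s s2) dr)
      (derive_mul _ _ _ _ _ _ (derive_cst R s la) (derive_id R s)).
    by move=> d; apply: is_derive_eq d _; ring.
  have d2 : is_derive s 1 (fun s => s2 + r s - la * s) (- s / r s - la).
    have := derive_add _ _ _ _ _ _ (derive_add _ _ _ _ _ _ (derive_cst R s s2) dr)
      (derive_opp _ _ _ _ (derive_mul _ _ _ _ _ _ (derive_cst R s la) (derive_id R s))).
    by move=> d; apply: is_derive_eq d _; ring.
  have d3 := derive_add _ _ _ _ _ _ (derive_ln _ _ (fun s => s2 + r s + la * s) _ p1 d1)
     (derive_opp _ _ _ _ (derive_ln _ _ (fun s => s2 + r s - la * s) _ p2 d2)).
  have d4 := derive_mul _ _ _ _ _ _ (derive_cst R s (2 * pi)) d3.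
  apply: is_derive_eq d4 _; rewrite -/(r s).
  have ss : s ^+ 2 = 2 - r s ^+ 2 by rewrite rr//; ring.
  have E : (s2 + r s + la * s) * (s2 + r s - la * s) = 2 * s2 * la * (r s + s2) * (r s + 1).
    transitivity ((s2 + r s) ^+ 2 - la ^+ 2 * s ^+ 2); first by ring.
    (* The sides agree only modulo sqrt(2)^2 = 2, so their difference is displayed as a multiple of
       2 - sqrt(2)^2. *)
    rewrite ss; apply/eqP; rewrite -subr_eq0; apply/eqP.
    transitivity ((2 - s2 ^+ 2) * (r s ^+ 2 + 2 * s2 * r s - 1 + 2 * s2)); first by rewrite /la; ring.
    by rewrite sqrt2_sqr subrr mul0r.
  have nr := gt_eqF h.
  have N : (- s / r s + la) * (s2 + r s - la * s) - (- s / r s - la) * (s2 + r s + la * s) =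
      2 * la * s2 * (s2 + r s) / r s.
    transitivity (2 * la * (s ^+ 2 + s2 * r s + r s ^+ 2) / r s); first by field; rewrite nr.
    have -> : s ^+ 2 + s2 * r s + r s ^+ 2 = s2 * (s2 + r s).
      by rewrite ss mulrDr -expr2 sqrt2_sqr; ring.
    by rewrite !mulrA.
  rewrite (frac_aux _ _ _ _ _ _ _ (lt0r_neq0 p1) (lt0r_neq0 p2) N) E.
  have n1 := gt_eqF la0; have n2 := gt_eqF sqrt2_gt0.
  have n3 : r s + s2 != 0 by rewrite gt_eqF// addr_gt0.
  have n4 : r s + 1 != 0 by rewrite gt_eqF// addr_gt0.
  move: (r s) (la) (s2) nr n1 n2 n3 n4 => r' l a nr n1 n2 n3 n4.
  by field; rewrite nr n1 n2 n3 n4.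
- by apply: cvg_at_right_filter; apply: cF; rewrite lexx ler01.
- by apply: cvg_at_left_filter; apply: cF; rewrite lexx ler01.
Qed.

Lemma integral_weight_asinh :
  (\int[mu]_(v in `]0%R, +oo[) (weight v * asinh R (arc v))%:E = (pi * ln 2)%:E)%E.
Proof.
pose k (z : R * R) : R := if (0 < z.1) && ((0 < z.2) && (z.2 < 1)) then kernel z.1 z.2 else 0.
have mk : measurable_fun setT (fun z : R * R => (k z)%:E) by rewrite /k /kernel; mfun_tac.
have k0 (z : R * R) : (0 <= (k z)%:E)%E.
  by rewrite lee_fin /k; case: ifP => // /andP[h1 h2]; exact: kernel_ge0.
have I1 (x : R) : `]0, 1[%classic x <-> (0 < x) && (x < 1) by rewrite /= in_itv.
have L : (\int[mu]_v \int[mu]_s (k (v, s))%:E =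
    \int[mu]_(v in `]0%R, +oo[) (weight v * asinh R (arc v))%:E)%E.
  rewrite -(integral_if _ _ _ _ (in_oy R)); apply: eq_integral => v _; rewrite /k /=.
  case: ltP => v0 /=; last by rewrite integral0_eq.
  by rewrite (integral_if _ _ _ _ I1) asinh_kernel.
have Rr : (\int[mu]_s \int[mu]_v (k (v, s))%:E = (pi * ln 2)%:E)%E.
  rewrite -integral_sqrt_recip -(integral_if _ _ _ _ I1); apply: eq_integral => s _; rewrite /k /=.
  case: ifPn => hs; last first.
    by rewrite integral0_eq// => v _; rewrite andbF.
  rewrite -(integral_kernel _ hs) -(integral_if _ _ _ _ (in_oy R)).
  by apply: eq_integral => v _; rewrite andbT.
by rewrite -L -Rr; exact: (tonelli_swap R (fun z => (k z)%:E) mk k0).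
Qed.

End WeightedArcsinh.

(** * Moments of the weight and the alternating sum of the even and odd series *)

Section HypergeometricSum.
Variable R : realType.
Notation mu := (@lebesgue_measure R).
Local Notation b := (half_coef R).
Local Notation w := (weight R).
Local Notation z := (arc R).
Implicit Types (k n N M : nat) (v : R).

(** The local notation [z] is the square root of the z of the overview, whence the exponent 2k + 1
    for z^(k+1/2). *)
Definition moment_fun k v : R := w v * (z v ^+ (2 * k + 1) / (2 * k%:R + 1)).
Local Notation d := moment_fun.
Definition moment k : \bar R := (\int[mu]_(v in `]0%R, +oo[) (d k v)%:E)%E.

Let oy (v : R) : `]0, +oo[%classic v -> 0 < v. Proof. by move=> /in_oy. Qed.
Let moy : measurable (`]0, +oo[%classic : set R). Proof. exact: measurable_itv. Qed.

Lemma weight_ge0 v : 0 < v -> 0 <= w v.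
Proof. by move=> v0; rewrite invr_ge0 mulr_ge0 ?sqrtr_ge0// addr_ge0// ltW. Qed.

Lemma arc_bound v : 0 < v -> 0 <= z v <= 1.
Proof.
move=> v0; rewrite sqrtr_ge0 /= -[leRHS]sqrtr1 ler_wsqrtr//.
rewrite ler_pdivrMr ?mul1r ?addr_gt0//.
have {2}<- : Num.sqrt v ^+ 2 = v by rewrite sqr_sqrtr// ltW.
by have := sqr_ge0 (Num.sqrt v - 1); move: (Num.sqrt v) => q; nra.
Qed.

Lemma odd_natr_gt0 k : 0 < 2 * k%:R + 1 :> R.
Proof. by rewrite ltr_wpDl// mulr_ge0. Qed.

Lemma moment_fun_ge0 k v : 0 < v -> 0 <= d k v.
Proof.
move=> v0; have /andP[z0 _] := arc_bound _ v0.
by rewrite /d mulr_ge0 ?weight_ge0// divr_ge0 ?exprn_ge0// ltW// odd_natr_gt0.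
Qed.

Let mw : measurable_fun setT (w : R -> R).
Proof. by rewrite /weight; mfun_tac. Qed.

Let mz : measurable_fun setT (z : R -> R).
Proof. by rewrite /arc; mfun_tac. Qed.

Let md k : measurable_fun setT (d k).
Proof. by have := mw; have := mz => mz' mw'; rewrite /d; mfun_tac. Qed.

Let mE (D : set R) (f : R -> R) : measurable D -> measurable_fun setT f ->
  measurable_fun D (fun v => (f v)%:E).
Proof. by move=> mD mf; apply: measurable_funTS; apply/measurable_EFinP. Qed.

Lemma moment_ge0 k : (0 <= moment k)%E.
Proof. by apply: integral_ge0 => v /oy v0; rewrite lee_fin moment_fun_ge0. Qed.

Lemma moment_le k : (moment k <= (pi / (2 * k%:R + 1))%:E)%E.
Proof.
have k0 : 0 <= (2 * k%:R + 1 : R)^-1 by rewrite invr_ge0 ltW// odd_natr_gt0.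
have w0 (v : R) : `]0, +oo[%classic v -> (0 <= (w v)%:E)%E.
  by move=> /oy v0; rewrite lee_fin weight_ge0.
rewrite mulrC EFinM -(integral_sqrt_weight R).
rewrite -(ge0_integralZl_EFin mu moy w0 (mE _ _ moy mw) k0).
apply: ge0_le_integral => //.
- by move=> v /oy v0; rewrite lee_fin moment_fun_ge0.
- exact: mE.
- have mk : measurable_fun setT (fun v : R => (2 * k%:R + 1)^-1 * w v).
    exact: (mfun_mul _ _ _ _ _ (measurable_cst _) mw).
  exact: (mE _ _ moy mk).
- move=> v /oy v0; rewrite -EFinM lee_fin /d mulrC -/(w v) ler_wpM2r ?weight_ge0//.
  have /andP[z0 z1] := arc_bound _ v0.
  by rewrite ler_piMl// exprn_ile1.
Qed.

Definition moment_val k : R := fine (moment k).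
Local Notation D := moment_val.

Lemma moment_fin k : moment k = (D k)%:E.
Proof.
rewrite fineK// ge0_fin_numE ?moment_ge0//.
by apply: le_lt_trans (moment_le k) _; rewrite ltry.
Qed.

Lemma moment_val_ge0 k : 0 <= D k.
Proof. by apply: fine_ge0; exact: moment_ge0. Qed.

Lemma moment_val_le k : D k <= pi / (2 * k%:R + 1).
Proof. by have := moment_le k; rewrite moment_fin lee_fin. Qed.

Lemma integral_moment_sum (j : nat -> nat) N :
  (\int[mu]_(v in `]0%R, +oo[) (\sum_(n < N) b (j n) * d (j n) v)%:E =
   (\sum_(n < N) b (j n) * D (j n))%:E)%E.
Proof.
have t0 n (v : R) : 0 < v -> 0 <= b (j n) * d (j n) v.
  by move=> v0; rewrite mulr_ge0 ?moment_fun_ge0// ltW// half_coef_gt0.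
have mt n : measurable_fun setT (fun v : R => b (j n) * d (j n) v).
  exact: (mfun_mul _ _ _ _ _ (measurable_cst _) (md _)).
have ms M : measurable_fun setT (fun v : R => \sum_(n < M) b (j n) * d (j n) v).
  elim: M => [|M IH].
    rewrite (_ : (fun v => _) = fun=> 0); first exact: measurable_cst.
    by apply/funext => v; rewrite big_ord0.
  rewrite (_ : (fun v => _) = fun v => \sum_(n < M) b (j n) * d (j n) v + b (j M) * d (j M) v).
    exact: mfun_add.
  by apply/funext => v; rewrite big_ord_recr.
elim: N => [|N IH].
  by rewrite big_ord0 integral0_eq// => v _; rewrite big_ord0.
rewrite big_ord_recr /= EFinD -IH EFinM -moment_fin.
have d0 (v : R) : `]0, +oo[%classic v -> (0 <= (d (j N) v)%:E)%E.
  by move=> /oy v0; rewrite lee_fin moment_fun_ge0.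
rewrite -(ge0_integralZl_EFin mu moy d0 (mE _ _ moy (md _)) (ltW (half_coef_gt0 _ _))).
have s0 (v : R) : `]0, +oo[%classic v -> (0 <= (\sum_(n < N) b (j n) * d (j n) v)%:E)%E.
  by move=> /oy v0; rewrite lee_fin sumr_ge0// => n _; exact: t0.
have c0 (v : R) : `]0, +oo[%classic v -> (0 <= (b (j N) * d (j N) v)%:E)%E.
  by move=> /oy v0; rewrite lee_fin t0.
rewrite -(ge0_integralD mu moy s0 (mE _ _ moy (ms N)) c0 (mE _ _ moy (mt N))).
by apply: eq_integral => v _; rewrite big_ord_recr.
Qed.

Definition even_sum N : R := \sum_(n < N) b n.*2 * D n.*2.
Definition odd_sum N : R := \sum_(n < N) b n.*2.+1 * D n.*2.+1.

Lemma asinh_sum_split M x :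
  asinh_sum R M.*2 x = \sum_(n < M) b n.*2 * (x ^+ (2 * n.*2 + 1) / (2 * n.*2%:R + 1)) -
   \sum_(n < M) b n.*2.+1 * (x ^+ (2 * n.*2.+1 + 1) / (2 * n.*2.+1%:R + 1)).
Proof.
rewrite /asinh_sum; elim: M => [|M IH]; first by rewrite !big_ord0 subrr.
rewrite doubleS !big_ord_recr /= IH exprS -signr_odd odd_double /= expr0 mulr1 mul1r mulN1r.
by ring.
Qed.

(** [asinh_bound] at [arc v] is integrated against the weight. The odd terms are moved to the other
    side first, so that every integrand is nonnegative. *)
Lemma even_odd_bound M :
  pi * ln 2 + odd_sum M <= even_sum M + b M.*2 * pi /\
  even_sum M <= pi * ln 2 + odd_sum M.
Proof.
pose e (v : R) := \sum_(n < M) b n.*2 * d n.*2 v.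
pose o (v : R) := \sum_(n < M) b n.*2.+1 * d n.*2.+1 v.
pose a (v : R) := w v * asinh R (z v).
have ie : (\int[mu]_(v in `]0%R, +oo[) (e v)%:E = (even_sum M)%:E)%E.
  exact: (integral_moment_sum double M).
have io : (\int[mu]_(v in `]0%R, +oo[) (o v)%:E = (odd_sum M)%:E)%E.
  exact: (integral_moment_sum (fun n => n.*2.+1) M).
have msum (j : nat -> nat) N : measurable_fun setT (fun v : R => \sum_(n < N) b (j n) * d (j n) v).
  elim: N => [|N IH].
    rewrite (_ : (fun v => _) = fun=> 0); first exact: measurable_cst.
    by apply/funext => v; rewrite big_ord0.
  rewrite (_ : (fun v => _) = fun v => \sum_(n < N) b (j n) * d (j n) v + b (j N) * d (j N) v).
    apply: mfun_add => //; exact: (mfun_mul _ _ _ _ _ (measurable_cst _) (md _)).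
  by apply/funext => v; rewrite big_ord_recr.
have me : measurable_fun setT e by exact: (msum double).
have mo : measurable_fun setT o by exact: (msum (fun n => n.*2.+1)).
have ma : measurable_fun setT a.
  by have := mw; have := mz => mz' mw'; rewrite /a /asinh; mfun_tac.
have b0 := ltW (half_coef_gt0 R M.*2).
have mb : measurable_fun setT (fun v : R => b M.*2 * w v).
  exact: (mfun_mul _ _ _ _ _ (measurable_cst _) mw).
have w0 (v : R) : `]0, +oo[%classic v -> (0 <= (w v)%:E)%E.
  by move=> /oy v0; rewrite lee_fin weight_ge0.
have e0 (v : R) : `]0, +oo[%classic v -> (0 <= (e v)%:E)%E.
  move=> /oy v0; rewrite lee_fin sumr_ge0// => n _.
  by rewrite mulr_ge0 ?moment_fun_ge0// ltW// half_coef_gt0.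
have o0 (v : R) : `]0, +oo[%classic v -> (0 <= (o v)%:E)%E.
  move=> /oy v0; rewrite lee_fin sumr_ge0// => n _.
  by rewrite mulr_ge0 ?moment_fun_ge0// ltW// half_coef_gt0.
have a0 (v : R) : `]0, +oo[%classic v -> (0 <= (a v)%:E)%E.
  move=> /oy v0; have /andP[z0 _] := arc_bound _ v0.
  rewrite lee_fin /a mulr_ge0 ?weight_ge0// /asinh ln_ge0//.
  rewrite -[leLHS]add0r lerD// -[leLHS]sqrtr1 ler_wsqrtr// lerDl.
  exact: sqr_ge0.
have bw0 (v : R) : `]0, +oo[%classic v -> (0 <= (b M.*2 * w v)%:E)%E.
  by move=> /w0; rewrite !lee_fin; exact: mulr_ge0.
have eo (v : R) : w v * asinh_sum R M.*2 (z v) = e v - o v.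
  rewrite asinh_sum_split mulrBr !mulr_sumr; congr (_ - _); apply: eq_bigr => n _.
    by rewrite mulrCA.
  by rewrite mulrCA.
have bd (v : R) : 0 < v -> e v <= a v + o v /\ a v + o v <= e v + b M.*2 * w v.
  move=> v0; have /andP[z0 z1] := arc_bound _ v0.
  have /andP[h1 h2] := asinh_bound R M (z v) (arc_bound _ v0).
  have wv := weight_ge0 _ v0.
  have := ler_wpM2l wv h1; have := ler_wpM2l wv h2.
  rewrite mulrDr eo -/(a v).
  have : w v * (b M.*2 * z v) <= b M.*2 * w v by rewrite mulrCA ler_wpM2l// ler_piMr.
  by move=> q1 q2 q3; split; lra.
have ia : (\int[mu]_(v in `]0%R, +oo[) (a v)%:E = (pi * ln 2)%:E)%E.
  exact: integral_weight_asinh.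
have iao : (\int[mu]_(v in `]0%R, +oo[) (a v + o v)%:E = (pi * ln 2 + odd_sum M)%:E)%E.
  by rewrite EFinD -ia -io -(ge0_integralD mu moy a0 (mE _ _ moy ma) o0 (mE _ _ moy mo)).
have ieb : (\int[mu]_(v in `]0%R, +oo[) (e v + b M.*2 * w v)%:E =
    (even_sum M + b M.*2 * pi)%:E)%E.
  rewrite EFinD -ie EFinM -(integral_sqrt_weight R).
  rewrite -(ge0_integralZl_EFin mu moy w0 (mE _ _ moy mw) b0).
  by rewrite -(ge0_integralD mu moy e0 (mE _ _ moy me) bw0 (mE _ _ moy mb)).
have mao : measurable_fun setT (fun v => a v + o v) by exact: mfun_add.
have meb : measurable_fun setT (fun v => e v + b M.*2 * w v) by exact: mfun_add.
have ao0 (v : R) : `]0, +oo[%classic v -> (0 <= (a v + o v)%:E)%E.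
  by move=> hv; rewrite EFinD adde_ge0 ?a0 ?o0.
split.
  rewrite -lee_fin -iao -ieb; apply: ge0_le_integral => //; try exact: mE.
  by move=> v /oy /bd[_ h]; rewrite lee_fin.
rewrite -lee_fin -iao -ie; apply: ge0_le_integral => //; try exact: mE.
by move=> v /oy /bd[h _]; rewrite lee_fin.
Qed.

(** Telescoping: the recursion gives b_k - b_(k+1) = b_k / (2k + 2). *)
Lemma half_coef_sum N : \sum_(k < N) b k / (2 * k%:R + 2) = 1 - b N.
Proof.
elim: N => [|N IH]; first by rewrite big_ord0 half_coef0 subrr.
have n0 : 2 * N%:R + 2 != 0 :> R by rewrite gt_eqF// ltr_wpDl// mulr_ge0.
have h : b N.+1 = (2 * N%:R + 1) * b N / (2 * N%:R + 2).
  by apply: (mulfI n0); rewrite half_coefS [RHS]mulrCA divff// mulr1.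
by rewrite big_ord_recr /= IH h; move: (N%:R) (b N) n0 => n u n0; field.
Qed.

(** Since D_k <= pi / (2k + 1) <= 2 pi / (2k + 2), the telescoping sum bounds the total; both series
    have nonnegative terms, so each of them converges. *)
Lemma even_odd_sum_le M : even_sum M + odd_sum M <= 2 * pi.
Proof.
have -> : even_sum M + odd_sum M = \sum_(k < M.*2) b k * D k.
  rewrite /even_sum /odd_sum; elim: M => [|M IH]; first by rewrite !big_ord0 addr0.
  by rewrite doubleS !big_ord_recr /= -IH; ring.
apply: (@le_trans _ _ (\sum_(k < M.*2) 2 * pi * (b k / (2 * k%:R + 2)))).
  apply: ler_sum => k _; have b0 := ltW (half_coef_gt0 R k).
  apply: (le_trans (ler_wpM2l b0 (moment_val_le k))).
  have k1 : 0 < 2 * k%:R + 1 :> R := odd_natr_gt0 k.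
  have k2 : 0 < 2 * k%:R + 2 :> R by apply: (lt_trans k1); rewrite ltrD2l ltr1n.
  have -> : 2 * pi * (b k / (2 * k%:R + 2)) = b k * (pi * (2 / (2 * k%:R + 2))) by ring.
  apply: ler_wpM2l => //; apply: ler_wpM2l; first exact: pi_ge0.
  rewrite ler_pdivlMr// mulrC ler_pdivrMr//.
  by have := ler0n R k; move: (k%:R) => K; lra.
rewrite -mulr_sumr half_coef_sum.
have := half_coef_gt0 R M.*2; have := pi_gt0 R; nra.
Qed.

Lemma even_sum_ge0 M : 0 <= even_sum M.
Proof.
by apply: sumr_ge0 => n _; rewrite mulr_ge0 ?moment_val_ge0// ltW// half_coef_gt0.
Qed.

Lemma odd_sum_ge0 M : 0 <= odd_sum M.
Proof.
by apply: sumr_ge0 => n _; rewrite mulr_ge0 ?moment_val_ge0// ltW// half_coef_gt0.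
Qed.

Lemma is_cvg_even_sum : cvgn even_sum.
Proof.
apply: nondecreasing_is_cvgn.
  apply/nondecreasing_seqP => n; rewrite [leRHS]big_ord_recr /= lerDl.
  by rewrite mulr_ge0 ?moment_val_ge0// ltW// half_coef_gt0.
exists (2 * pi) => _ [n _ <-]; apply: le_trans (even_odd_sum_le n).
by rewrite lerDl odd_sum_ge0.
Qed.

Lemma is_cvg_odd_sum : cvgn odd_sum.
Proof.
apply: nondecreasing_is_cvgn.
  apply/nondecreasing_seqP => n; rewrite [leRHS]big_ord_recr /= lerDl.
  by rewrite mulr_ge0 ?moment_val_ge0// ltW// half_coef_gt0.
exists (2 * pi) => _ [n _ <-]; apply: le_trans (even_odd_sum_le n).
by rewrite lerDr even_sum_ge0.
Qed.

Lemma even_sub_odd : limn even_sum - limn odd_sum = pi * ln 2.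
Proof.
have h : even_sum M - odd_sum M @[M --> \oo] --> limn even_sum - limn odd_sum.
  by apply: cvgB; [exact: is_cvg_even_sum|exact: is_cvg_odd_sum].
apply: (cvg_unique _ h) => //.
have c2 : b M.*2 @[M --> \oo] --> (0 : R).
  apply: (cvg_comp _ _ _ (cvg_half_coef R)).
  by apply/cvgnyPge => A; near=> M; rewrite -addnn (leq_trans _ (leq_addr _ _))//;
    near: M; exact: nbhs_infty_ge.
have cl : (fun M => pi * ln 2 - b M.*2 * pi) @ \oo --> (pi * ln 2 : R).
  rewrite -[X in _ --> X]subr0 -[X in _ - X](mul0r pi).
  by apply: cvgB; [exact: cvg_cst|exact: cvgMl].
apply: (squeeze_cvgr _ cl (cvg_cst (pi * ln 2 : R))).
near=> M; have [h1 h2] := even_odd_bound M.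
by apply/andP; split; lra.
Unshelve. all: by end_near. Qed.

End HypergeometricSum.

(** * Identification of the hypergeometric terms with the moments *)

Section GammaTerms.
Variable R : realType.
Notation mu := (@lebesgue_measure R).
Local Notation b := (half_coef R).
Local Notation D := (moment_val R).
Implicit Types (k n : nat) (s v : R).

Lemma gamma_int_succ s : 0 < s -> (gamma_int R (s + 1) = s%:E * gamma_int R s)%E.
Proof. by move=> s0; rewrite (gamma_intS _ s s0) muleA -EFinM divff ?mul1e// gt_eqF. Qed.

Lemma gamma_int_half_nat n :
  gamma_int R (n%:R + 1 / 2) = (pochhammer (1 / 2) n * Num.sqrt pi)%:E.
Proof.
elim: n => [|n IH]; first by rewrite add0r gamma_int_half pochhammer0 mul1r.
rewrite -natr1 addrAC gamma_int_succ ?ltr_wpDl// IH pochhammerS -EFinM.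
by congr (_%:E); ring.
Qed.

(** The integrand v^(k/2 - 1/4) (1 + v)^(-(k + 3/2)) is (2 sqrt v / (1 + v))^(k + 1/2) times the
    weight, up to the factor 2^(k + 1/2), which is 2^k sqrt 2. *)
Lemma beta_int_moment k : beta_int R (k%:R / 2 + 3 / 4) (k%:R / 2 + 3 / 4) =
  ((2 * k%:R + 1) / (2 ^+ k * Num.sqrt 2) * D k)%:E.
Proof.
have k1 := odd_natr_gt0 R k.
have c0 : 0 <= (2 * k%:R + 1) / (2 ^+ k * Num.sqrt 2) :> R.
  by rewrite divr_ge0 ?mulr_ge0 ?exprn_ge0 ?sqrtr_ge0// ltW.
have moy : measurable (`]0, +oo[%classic : set R) by exact: measurable_itv.
have d0 (v : R) : `]0, +oo[%classic v -> (0 <= (moment_fun R k v)%:E)%E.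
  by move=> /in_oy v0; rewrite lee_fin moment_fun_ge0.
have md : measurable_fun (`]0, +oo[%classic : set R) (fun v : R => (moment_fun R k v)%:E).
  apply: measurable_funTS; apply/measurable_EFinP.
  by rewrite /moment_fun /weight /arc; mfun_tac.
rewrite EFinM -moment_fin /moment -(ge0_integralZl_EFin mu moy d0 md c0).
apply: eq_integral => v; rewrite inE => /in_oy v0; rewrite -EFinM; congr (_%:E).
have v1 : 0 < 1 + v by rewrite addr_gt0.
rewrite /moment_fun /weight /arc.
set q := Num.sqrt v; have q0 : 0 < q by rewrite sqrtr_gt0.
set g := Num.sqrt q; have g0 : 0 < g by rewrite sqrtr_gt0.
set r := Num.sqrt (1 + v); have r0 : 0 < r by rewrite sqrtr_gt0.
have gg : q = g ^+ 2 by rewrite sqr_sqrtr// ltW.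
have e1 : v `^ (k%:R / 2 + 3 / 4 - 1) = q ^+ k / g.
  have -> : k%:R / 2 + 3 / 4 - 1 = 2^-1 * (k%:R + - 2^-1) :> R by field.
  rewrite powRrM (powR12_sqrt (ltW v0)) -/q -(powR_add R q _ _ q0) (powR_mulrn _ (ltW q0)).
  by rewrite powRN (powR12_sqrt (ltW q0)).
have e2 : (1 + v) `^ (- (k%:R / 2 + 3 / 4 + (k%:R / 2 + 3 / 4))) = ((1 + v) ^+ k * (1 + v) * r)^-1.
  have -> : k%:R / 2 + 3 / 4 + (k%:R / 2 + 3 / 4) = k%:R + 1 + 2^-1 :> R by field.
  rewrite powRN -!powR_add// powR_mulrn ?(ltW v1)// powRr1 ?(ltW v1)// powR12_sqrt//.
  exact: ltW.
have e3 : Num.sqrt (2 * q / (1 + v)) = Num.sqrt 2 * g / r.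
  by rewrite !sqrtrM ?mulr_ge0 ?ltW// sqrtrV// ltW.
have e4 : Num.sqrt (2 * q / (1 + v)) ^+ (2 * k + 1) = 2 ^+ k * q ^+ k / (1 + v) ^+ k * (Num.sqrt 2 * g / r).
  rewrite addn1 exprS exprM sqr_sqrtr; last by rewrite divr_ge0 ?mulr_ge0// ltW.
  by rewrite e3 expr_div_n exprMn mulrC.
rewrite e1 e2 e4.
have n1 : 2 ^+ k != 0 :> R by rewrite expf_neq0.
have n2 : Num.sqrt 2 != 0 :> R by rewrite gt_eqF// sqrtr_gt0.
have n3 : (1 + v) ^+ k != 0 by rewrite expf_neq0// gt_eqF.
move: (gt_eqF v1) (gt_eqF g0) (gt_eqF r0) (gt_eqF k1) => n4 n5 n6 n7.
move: (2 ^+ k) (Num.sqrt 2) (1 + v) ((1 + v) ^+ k) (q ^+ k) n1 n2 n3 n4 => A a V U Q n1 n2 n3 n4.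
rewrite gg; move: (g) (r) n5 n6 => g' r' n5 n6.
by field; rewrite n1 n2 n3 n4 n5 n6 n7.
Qed.

Lemma Gamma_sqr k : Gamma (k%:R / 2 + 3 / 4) ^+ 2 =
  (2 * k%:R + 1) / (2 ^+ k * Num.sqrt 2) * D k * (pochhammer (1 / 2) k.+1 * Num.sqrt pi).
Proof.
have := gamma_beta R (k%:R / 2 + 3 / 4) (k%:R / 2 + 3 / 4).
have -> : k%:R / 2 + 3 / 4 + (k%:R / 2 + 3 / 4) = k.+1%:R + 1 / 2 :> R.
  by rewrite -[k.+1%:R]natr1; field.
rewrite beta_int_moment gamma_int_half_nat -EFinM GammaE.
have := gamma_int_ge0 R (k%:R / 2 + 3 / 4).
case: (gamma_int R (k%:R / 2 + 3 / 4)) => [x||]//= _.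
by rewrite -EFinM => -[<-].
Qed.

(** An infinite x is sent to 0 on both sides, so the recursion for [Gamma] follows without knowing
    convergence. *)
Lemma fine_scale s (x : \bar R) : 0 < s -> fine (s%:E * x) = s * fine x.
Proof.
move=> s0; case: x => [x||] //; first by rewrite mulry gtr0_sg// mul1e mulr0.
by rewrite mulrNy gtr0_sg// mul1e mulr0.
Qed.

Lemma GammaS s : 0 < s -> Gamma (s + 1) = s * Gamma s.
Proof.
by move=> s0; rewrite (GammaE R (s + 1)) (GammaE R s) (gamma_int_succ _ s0) fine_scale.
Qed.

Lemma Gamma_pochhammer s n : 0 < s -> Gamma (s + n%:R) = pochhammer s n * Gamma s.
Proof.
move=> s0; elim: n => [|n IH]; first by rewrite addr0 pochhammer0 mul1r.
have sn : 0 < s + n%:R by rewrite ltr_wpDr.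
rewrite -[n.+1%:R]natr1 addrA (GammaS _ sn) IH pochhammerS.
by rewrite mulrCA mulrA.
Qed.

Lemma Gamma_gt0 s : 0 < s <= 1 -> (gamma_int R s < +oo)%E -> 0 < Gamma s.
Proof.
move=> hs fs; have := gamma_int_gt0 R s hs; rewrite GammaE.
by move: fs; case: (gamma_int R s) => [x||].
Qed.

Lemma pochhammer_shift s n : pochhammer s n * (s + n%:R) = s * pochhammer (s + 1) n.
Proof.
elim: n => [|n IH]; first by rewrite !pochhammer0 mul1r mulr1 addr0.
by rewrite !pochhammerS IH -[n.+1%:R]natr1; ring.
Qed.

Lemma pochhammer_gt0 s n : 0 < s -> 0 < pochhammer s n.
Proof. by move=> s0; rewrite /pochhammer prodr_gt0// => i _; rewrite ltr_wpDr. Qed.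

Lemma fact_double n : (n.*2)`!%:R = 4 ^+ n * pochhammer (1 / 2) n * n`!%:R :> R.
Proof.
elim: n => [|n IH]; first by rewrite pochhammer0 !mul1r.
rewrite doubleS !factS !natrM IH pochhammerS exprS -[n.+1%:R]natr1 -![n.*2.+2%:R]natr1.
by rewrite -[n.*2.+1%:R]natr1 -muln2 natrM; move: (n%:R) (n`!%:R) => N F; field.
Qed.

Lemma fact_doubleS n : (n.*2.+1)`!%:R = 4 ^+ n * pochhammer (3 / 2) n * n`!%:R :> R.
Proof.
elim: n => [|n IH]; first by rewrite pochhammer0 !mul1r.
have -> : (n.+1.*2.+1)`! = (n.*2.+3 * (n.*2.+2 * (n.*2.+1)`!))%N.
  by rewrite doubleS (factS n.*2.+2) (factS n.*2.+1).
rewrite natrM natrM IH (factS n) natrM pochhammerS exprS -[n.+1%:R]natr1.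
rewrite -[n.*2.+3%:R]natr1 -[n.*2.+2%:R]natr1.
by rewrite -[n.*2.+1%:R]natr1 -muln2 natrM; move: (n%:R) (n`!%:R) => N F; field.
Qed.

Definition hyp_term (as_ bs : seq R) n : R :=
  (\prod_(a <- as_) pochhammer a n) / (\prod_(b <- bs) pochhammer b n) * 1 ^+ n / (n`!)%:R.

Let c : R := Num.sqrt pi / (2 * Num.sqrt 2).

(** This is [Gamma_sqr] at k = 2n: (3/4)_n Gamma(3/4) = Gamma(n + 3/4), the quotient (1/4)_n /
    (5/4)_n is 1 / (4n + 1), and (2n)! = 4^n (1/2)_n n!. *)
Lemma even_term n : Gamma (3 / 4) ^+ 2 *
  hyp_term [:: 1/4; 1/4; 3/4; 3/4] [:: 1/2; 5/4; 5/4] n = c * (b n.*2 * D n.*2).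
Proof.
rewrite /hyp_term !big_cons !big_nil expr1n !mulr1.
have h1 : pochhammer (1 / 4) n * (1 / 4 + n%:R) = 1 / 4 * pochhammer (5 / 4) n :> R.
  by rewrite pochhammer_shift; congr (_ * pochhammer _ _); field.
have h2 : (pochhammer (3 / 4) n * Gamma (3 / 4)) ^+ 2 = (4 * n%:R + 1) / (4 ^+ n * Num.sqrt 2) *
    D n.*2 * (pochhammer (1 / 2) n.*2 * (1 / 2 + 2 * n%:R) * Num.sqrt pi).
  rewrite -Gamma_pochhammer ?divr_gt0//.
  have -> : 3 / 4 + n%:R = n.*2%:R / 2 + 3 / 4 :> R by rewrite -muln2 natrM; field.
  rewrite Gamma_sqr pochhammerS -[in 2 ^+ _]mul2n exprM -muln2 natrM.
  by rewrite (_ : 2 ^+ 2 = 4); [congr (_ / _ * _ * (_ * _ * _)); ring|ring].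
rewrite /half_coef fact_double.
have Z0 := gt_eqF (pochhammer_gt0 (5 / 4) n (divr_gt0 (ltr0n _ 5) (ltr0n _ 4))).
have H0 := gt_eqF (pochhammer_gt0 (1 / 2) n (divr_gt0 (ltr0n _ 1) (ltr0n _ 2))).
have f0 : n`!%:R != 0 :> R by rewrite pnatr_eq0 -lt0n fact_gt0.
have n4 : 4 * n%:R + 1 != 0 :> R by rewrite gt_eqF// ltr_wpDl// mulr_ge0.
have A0 : 4 ^+ n != 0 :> R by rewrite expf_neq0.
have s0 : Num.sqrt 2 != 0 :> R by rewrite gt_eqF// sqrtr_gt0.
move: h1 h2 Z0 H0 f0 n4 A0 s0; rewrite /c.
move: (pochhammer (1 / 4) n) (pochhammer (5 / 4) n) (pochhammer (3 / 4) n) (Gamma _).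
move: (pochhammer (1 / 2) n) (pochhammer (1 / 2) n.*2) (n`!%:R) (n%:R) (4 ^+ n) (Num.sqrt 2) (Num.sqrt pi).
move=> H P f N A a p X Z Y G h1 h2 Z0 H0 f0 n4 A0 s0.
have -> : X = Z / (4 * N + 1).
  have n4' : 1 / 4 + N != 0.
    by apply: contra n4 => /eqP e; apply/eqP; rewrite -[RHS](mulr0 4) -e; field.
  by apply: (mulIf n4'); rewrite h1; field; rewrite n4.
have e : G ^+ 2 * (Z / (4 * N + 1) * (Z / (4 * N + 1) * (Y * Y)) / (H * (Z * Z)) / f) =
    (Y * G) ^+ 2 / ((4 * N + 1) ^+ 2 * H * f) by field; rewrite n4 Z0 H0 f0.
by rewrite e h2; field; rewrite n4 H0 f0 A0 s0.
Qed.

(** This is [Gamma_sqr] at k = 2n + 1. The square of (3/4)_n / (7/4)_n = 3 / (4n + 3) contributes 9,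
    and Gamma(1/4)^2 = 16 Gamma(5/4)^2; hence 72 = 16 * 9 / 2 leaves 2 Gamma(5/4)^2, with the same
    constant [c] as for the even terms. *)
Lemma odd_term n : Gamma (1 / 4) ^+ 2 / 72 *
  hyp_term [:: 3/4; 3/4; 5/4; 5/4] [:: 3/2; 7/4; 7/4] n = c * (b n.*2.+1 * D n.*2.+1).
Proof.
rewrite /hyp_term !big_cons !big_nil expr1n !mulr1.
have h1 : pochhammer (3 / 4) n * (3 / 4 + n%:R) = 3 / 4 * pochhammer (7 / 4) n :> R.
  by rewrite pochhammer_shift; congr (_ * pochhammer _ _); field.
have h2 : (pochhammer (5 / 4) n * (1 / 4 * Gamma (1 / 4))) ^+ 2 =
    (4 * n%:R + 3) / (2 * 4 ^+ n * Num.sqrt 2) *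
    D n.*2.+1 * (pochhammer (1 / 2) n.*2.+1 * (3 / 2 + 2 * n%:R) * Num.sqrt pi).
  rewrite -GammaS ?divr_gt0//.
  have -> : 1 / 4 + 1 = 5 / 4 :> R by field.
  rewrite -Gamma_pochhammer ?divr_gt0//.
  have -> : 5 / 4 + n%:R = n.*2.+1%:R / 2 + 3 / 4 :> R.
    by rewrite -[n.*2.+1%:R]natr1 -muln2 natrM; field.
  rewrite Gamma_sqr pochhammerS exprS -[in 2 ^+ _]mul2n exprM -[n.*2.+1%:R]natr1 -muln2 natrM.
  by rewrite (_ : 2 ^+ 2 = 4); [congr (_ / _ * _ * (_ * _ * _)); field|ring].
rewrite /half_coef fact_doubleS.
have Z0 := gt_eqF (pochhammer_gt0 (7 / 4) n (divr_gt0 (ltr0n _ 7) (ltr0n _ 4))).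
have H0 := gt_eqF (pochhammer_gt0 (3 / 2) n (divr_gt0 (ltr0n _ 3) (ltr0n _ 2))).
have f0 : n`!%:R != 0 :> R by rewrite pnatr_eq0 -lt0n fact_gt0.
have n4 : 4 * n%:R + 3 != 0 :> R by rewrite gt_eqF// ltr_wpDl// mulr_ge0.
have A0 : 4 ^+ n != 0 :> R by rewrite expf_neq0.
have s0 : Num.sqrt 2 != 0 :> R by rewrite gt_eqF// sqrtr_gt0.
move: h1 h2 Z0 H0 f0 n4 A0 s0; rewrite /c.
move: (pochhammer (3 / 4) n) (pochhammer (7 / 4) n) (pochhammer (5 / 4) n) (Gamma _).
move: (pochhammer (3 / 2) n) (pochhammer (1 / 2) n.*2.+1) (n`!%:R) (n%:R) (4 ^+ n) (Num.sqrt 2) (Num.sqrt pi).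
move=> H P f N A a p X Z Y G h1 h2 Z0 H0 f0 n4 A0 s0.
have -> : X = 3 * Z / (4 * N + 3).
  have n4' : 3 / 4 + N != 0.
    by apply: contra n4 => /eqP e; apply/eqP; rewrite -[RHS](mulr0 4) -e; field.
  by apply: (mulIf n4'); rewrite h1; field; rewrite n4.
have e : G ^+ 2 / 72 * (3 * Z / (4 * N + 3) * (3 * Z / (4 * N + 3) * (Y * Y)) / (H * (Z * Z)) / f) =
    2 * (Y * (1 / 4 * G)) ^+ 2 / ((4 * N + 3) ^+ 2 * H * f) by field; rewrite n4 Z0 H0 f0.
by rewrite e h2; field; rewrite n4 H0 f0 A0 s0.
Qed.

Lemma hypergeom_limit (as_ bs : seq R) (g : R) (u : nat -> R) : g != 0 -> cvgn u ->
  (forall N, g * \sum_(n < N) hyp_term as_ bs n = c * u N) ->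
  g * hypergeom as_ bs 1 = c * limn u.
Proof.
move=> g0 cu E.
have -> : hypergeom as_ bs 1 = g^-1 * (c * limn u).
  apply: cvg_lim => //.
  have -> : (fun N => \sum_(0 <= n < N) ((\prod_(a <- as_) pochhammer a n) /
     (\prod_(b <- bs) pochhammer b n) * 1 ^+ n / n`!%:R)) = (fun N => g^-1 * (c * u N)).
    by apply/funext => N; rewrite -E mulKf// big_mkord.
  by apply: cvgMr; apply: cvgMr; exact: cu.
by rewrite mulrA mulfV// mul1r.
Qed.

(** The square of the integral is a product of two finite values, by [gamma_beta], so the integral
    cannot be infinite. *)
Lemma gamma_int_lty k s : s = k%:R / 2 + 3 / 4 -> (gamma_int R s < +oo)%E.
Proof.
move=> ->; have := gamma_beta R (k%:R / 2 + 3 / 4) (k%:R / 2 + 3 / 4).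
have -> : k%:R / 2 + 3 / 4 + (k%:R / 2 + 3 / 4) = k.+1%:R + 1 / 2 :> R.
  by rewrite -[k.+1%:R]natr1; field.
rewrite beta_int_moment gamma_int_half_nat -EFinM.
by case: (gamma_int R _) => [x||]//=; rewrite ltry.
Qed.

Lemma hypergeometric_bracket :
  Gamma (3 / 4) ^+ 2 / Num.sqrt (2 * pi ^+ 3)
        * hypergeom [:: 1/4; 1/4; 3/4; 3/4] [:: 1/2; 5/4; 5/4] 1
      - Gamma (1 / 4) ^+ 2 / (72 * Num.sqrt (2 * pi ^+ 3))
        * hypergeom [:: 3/4; 3/4; 5/4; 5/4] [:: 3/2; 7/4; 7/4] 1 = ln 2 / 4 :> R.
Proof.
have G34 : 0 < Gamma (3 / 4) :> R.
  apply: Gamma_gt0; first by lra.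
  by apply: (@gamma_int_lty 0); field.
have G54 : (gamma_int R (1 / 4) < +oo)%E.
  (* 1/4 is not of the form k/2 + 3/4, but 5/4 is, with k = 1; the recursion brings finiteness down
     to 1/4. *)
  rewrite gamma_intS ?divr_gt0//.
  have := @gamma_int_lty 1 (1 / 4 + 1) ltac:(by field).
  have := gamma_int_ge0 R (1 / 4 + 1).
  by case: (gamma_int R _) => [x||]//= _ _; rewrite -EFinM ltry.
have G14 : 0 < Gamma (1 / 4) :> R by apply: Gamma_gt0 => //; lra.
have g1 : Gamma (3 / 4) ^+ 2 != 0 :> R by exact: expf_neq0 _ (lt0r_neq0 G34).
have g2 : Gamma (1 / 4) ^+ 2 / 72 != 0 :> R.
  apply: mulf_neq0; first exact: expf_neq0 _ (lt0r_neq0 G14).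
  by rewrite invr_eq0 pnatr_eq0.
have H1 := hypergeom_limit [:: 1/4; 1/4; 3/4; 3/4] [:: 1/2; 5/4; 5/4] _ _ g1 (is_cvg_even_sum R) _.
have {}H1 := H1 ltac:(by move=> N; rewrite mulr_sumr /even_sum mulr_sumr; apply: eq_bigr => n _; rewrite even_term).
have H2 := hypergeom_limit [:: 3/4; 3/4; 5/4; 5/4] [:: 3/2; 7/4; 7/4] _ _ g2 (is_cvg_odd_sum R) _.
have {}H2 := H2 ltac:(by move=> N; rewrite mulr_sumr /odd_sum mulr_sumr; apply: eq_bigr => n _; rewrite odd_term).
have p0 := pi_gt0 R.
have q0 : 0 < Num.sqrt pi :> R by rewrite sqrtr_gt0.
have t0 : 0 < Num.sqrt 2 :> R by rewrite sqrtr_gt0.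
have W : Num.sqrt (2 * pi ^+ 3) = Num.sqrt 2 * (pi * Num.sqrt pi) :> R.
  have -> : pi ^+ 3 = pi ^+ 2 * pi :> R by ring.
  by rewrite sqrtrM// sqrtrM ?sqr_ge0// sqrtr_sqr ger0_norm// ltW.
set w := Num.sqrt (2 * pi ^+ 3) in W *.
have wn : w != 0 by rewrite W !mulf_neq0// gt_eqF.
transitivity ((Gamma (3 / 4) ^+ 2 * hypergeom [:: 1/4; 1/4; 3/4; 3/4] [:: 1/2; 5/4; 5/4] 1 -
  Gamma (1 / 4) ^+ 2 / 72 * hypergeom [:: 3/4; 3/4; 5/4; 5/4] [:: 3/2; 7/4; 7/4] 1) / w).
  move: (hypergeom _ _ _) (hypergeom _ _ _) (Gamma _) (Gamma _) => a1 a2 a3 a4.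
  by field; rewrite wn.
rewrite H1 H2 -mulrBr even_sub_odd W /c.
have s22 : Num.sqrt 2 ^+ 2 = 2 :> R by rewrite sqr_sqrtr.
move: (gt_eqF p0) (gt_eqF q0) (gt_eqF t0) => n1 n2 n3.
transitivity (ln 2 / (2 * Num.sqrt 2 ^+ 2) : R).
  by move: (ln 2) (pi) (Num.sqrt pi) (Num.sqrt 2) n1 n2 n3 => u4 u3 u2 u1 n1 n2 n3; field; rewrite n1 n2 n3.
by rewrite s22; congr (_ / _); ring.
Qed.

End GammaTerms.

Theorem theorem1p2 (R : realType) :
  areal_mahler2 (fun x y : R[i] => ((Num.sqrt (2 : R))%:C + x + y)%C) =
  (L_chi_m4 2 / pi
   + (Gamma (3 / 4) ^+ 2 / Num.sqrt (2 * pi ^+ 3)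
        * hypergeom [:: 1/4; 1/4; 3/4; 3/4] [:: 1/2; 5/4; 5/4] 1
      - Gamma (1 / 4) ^+ 2 / (72 * Num.sqrt (2 * pi ^+ 3))
        * hypergeom [:: 3/4; 3/4; 5/4; 5/4] [:: 3/2; 7/4; 7/4] 1)
   + 3 / 8 - 3 / (2 * pi))%:E.
Proof.
rewrite areal_mahler_sqrt2 hypergeometric_bracket L_chi_m4_2; congr (_%:E).
have p0 : pi != 0 :> R by rewrite gt_eqF// pi_gt0.
by move: (pi) (ln 2) (xtan_integral R) p0 => p l X p0; field.
Qed.
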